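(* Let $1\le d\le 4$ and $n=2$, in the unknown-variance Gaussian prediction model described in the context. Then the best equivariant predictive density $\hat p_R$ is inadmissible under the Kullback--Leibler risk. More precisely, there is a constant $\nu_*>0$ (depending only on $d$) such that for every $\nu$ with $0<\nu\le\nu_*$, the Bayesian predictive density $\hat p_{\mathrm{GM}}$ with respect to the prior $$\pi_{\mathrm{GM}}(\mu,\eta)=\int_0^1\phi\{\mu;0,\eta^{-1}\lambda^{-1}(1-\lambda)\}\,\eta^{a}\lambda^{a}f(\lambda)\,d\lambda,\qquad a=\nu-d/2-1,$$ with $f(\lambda)=(1-\lambda)^{(n-1)d/2-1}\{1-(n-1)\lambda/n\}^{-(n-2)d/2-\nu}=(1-\lambda)^{d/2-1}(1-\lambda/2)^{-\nu}$ for $\lambda\in(0,1)$, dominates $\hat p_R$ under the Kullback--Leibler risk.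
   Context: Model: $x_1,\dots,x_n,y$ are independent with $x_i\sim N_d(\mu,\eta^{-1}I_d)$ and $y\sim N_d(\mu,\eta^{-1}I_d)$, where $\mu\in\mathbb{R}^d$ and $\eta=1/\sigma^2>0$ are unknown; $\bar x_n=n^{-1}\sum_i x_i$, $s_n=\sum_i\|x_i-\bar x_n\|^2$. $\phi(\cdot;\theta,\tau)$ is the $N_d(\theta,\tau I_d)$ density and $\gamma(\cdot;k)$ the chi-square density with $k$ degrees of freedom. For a (possibly improper) prior density $\pi(\mu,\eta)$ on $\mathbb{R}^d\times(0,\infty)$, the Bayesian predictive density is $$\hat p_\pi(y\mid\bar x_n,s_n)=\frac{\iint \phi(y;\mu,\eta^{-1})\,\phi(\bar x_n;\mu,n^{-1}\eta^{-1})\,\eta\gamma\{\eta s_n;(n-1)d\}\,\pi(\mu,\eta)\,d\mu\,d\eta}{\iint \phi(\bar x_n;\mu,n^{-1}\eta^{-1})\,\eta\gamma\{\eta s_n;(n-1)d\}\,\pi(\mu,\eta)\,d\mu\,d\eta}.$$ The best equivariant predictive density is $\hat p_R(y\mid\bar x_n,s_n)=\frac{\Gamma(nd/2)}{\Gamma\{(n-1)d/2\}}\left(\frac{1}{\pi s_n}\frac{n}{n+1}\right)^{d/2}\left(1+\frac{1}{s_n}\frac{n}{n+1}\|y-\bar x_n\|^2\right)^{-nd/2}$. The Kullback--Leibler risk of a predictive density $\hat p$ is $R_{KL}\{(\mu,\eta),\hat p\}=E_{(\mu,\eta)}[\log\{\phi(y;\mu,\eta^{-1})/\hat p(y\mid\bar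 x_n,s_n)\}]$, the expectation being over $(y,\bar x_n,s_n)$. A predictive density $\hat p$ dominates $\hat p_R$ if $R_{KL}\{(\mu,\eta),\hat p\}\le R_{KL}\{(\mu,\eta),\hat p_R\}$ for all $(\mu,\eta)$, with strict inequality for some $(\mu,\eta)$; $\hat p_R$ is inadmissible if some predictive density dominates it. *)

(* Defs.v *)
From HB Require Import structures.
From mathcomp Require Import all_boot all_order all_algebra.
From mathcomp Require Import all_classical all_reals all_analysis.

Set Implicit Arguments.
Unset Strict Implicit.
Unset Printing Implicit Defensive.

Import Order.TTheory GRing.Theory Num.Theory.
Import numFieldNormedType.Exports.

Local Open Scope classical_set_scope.
Local Open Scope ring_scope.

Section GaussPred.
Variable R : realType.

Notation leb := (@lebesgue_measure R).

Definition sqnorm (d : nat) (v : 'rV[R]_d) : R := \sum_(i < d) (v ord0 i) ^+ 2.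

Definition gauss_pdf (d : nat) (x th : 'rV[R]_d) (tau : R) : R :=
  (2 * pi * tau) `^ (- (d%:R / 2)) * expR (- sqnorm (x - th) / (2 * tau)).

(** Lebesgue integral over R^d, realised as iterated one-dimensional
    Lebesgue integrals over the coordinates (first coordinate outermost). *)
Fixpoint iint_seq (n : nat) (F : seq R -> \bar R) : \bar R :=
  match n with
  | 0%N => F [::]
  | n'.+1 => (\int[leb]_(x in [set: R]) iint_seq n' (fun s => F (x :: s)))%E
  end.

Definition vec_int (d : nat) (F : 'rV[R]_d -> \bar R) : \bar R :=
  iint_seq d (fun s => F (\row_(i < d) nth 0 s i)).

Definition Gamma (t : R) : R :=
  Rintegral leb `]0%R, +oo[%classic (fun x => x `^ (t - 1) * expR (- x)).

Definition chisq_pdf (k : nat) (x : R) : R :=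
  if 0 < x then
    x `^ (k%:R / 2 - 1) * expR (- x / 2) / (2 `^ (k%:R / 2) * Gamma (k%:R / 2))
  else 0.

Definition s_pdf (n d : nat) (eta s : R) : R := eta * chisq_pdf (n.-1 * d) (eta * s).

(** A predictive density: q y xbar s = \hat p(y | xbar_n, s_n). *)
Definition pred_density (d : nat) := 'rV[R]_d -> 'rV[R]_d -> R -> R.

(** A (possibly improper) prior density pi(mu, eta), eta > 0. *)
Definition prior_density (d : nat) := 'rV[R]_d -> R -> \bar R.

Definition bayes_num (n d : nat) (prior : prior_density d) (y xbar : 'rV[R]_d) (s : R)
  : \bar R :=
  (\int[leb]_(eta in `]0%R, +oo[%classic) vec_int (fun mu =>
      (gauss_pdf y mu eta^-1 * gauss_pdf xbar mu (n%:R * eta)^-1 * s_pdf n d eta s)%:E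
      * prior mu eta))%E.

Definition bayes_den (n d : nat) (prior : prior_density d) (xbar : 'rV[R]_d) (s : R)
  : \bar R :=
  (\int[leb]_(eta in `]0%R, +oo[%classic) vec_int (fun mu =>
      (gauss_pdf xbar mu (n%:R * eta)^-1 * s_pdf n d eta s)%:E * prior mu eta))%E.

Definition bayes_pred (n d : nat) (prior : prior_density d) : pred_density d :=
  fun y xbar s => fine (bayes_num n prior y xbar s) / fine (bayes_den n prior xbar s).

Definition best_equiv (n d : nat) : pred_density d :=
  fun y xbar s =>
    Gamma ((n * d)%:R / 2) / Gamma ((n.-1 * d)%:R / 2)
    * ((pi * s)^-1 * (n%:R / (n%:R + 1))) `^ (d%:R / 2)
    * (1 + s^-1 * (n%:R / (n%:R + 1)) * sqnorm (y - xbar)) `^ (- ((n * d)%:R / 2)).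

Definition log_ratio (d : nat) (mu : 'rV[R]_d) (eta : R) (q : pred_density d)
  (y xbar : 'rV[R]_d) (s : R) : \bar R :=
  if 0 < q y xbar s then (ln (gauss_pdf y mu eta^-1 / q y xbar s))%:E else +oo%E.

Definition KL_risk (n d : nat) (mu : 'rV[R]_d) (eta : R) (q : pred_density d) : \bar R :=
  (\int[leb]_(s in `]0%R, +oo[%classic) vec_int (fun xbar => vec_int (fun y =>
      (gauss_pdf y mu eta^-1 * gauss_pdf xbar mu (n%:R * eta)^-1 * s_pdf n d eta s)%:E
      * log_ratio mu eta q y xbar s)))%E.

Definition dominates (n d : nat) (q p : pred_density d) : Prop :=
  (forall (mu : 'rV[R]_d) (eta : R), 0 < eta -> (KL_risk n mu eta q <= KL_risk n mu eta p)%E)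
  /\ exists (mu : 'rV[R]_d) (eta : R), 0 < eta /\ (KL_risk n mu eta q < KL_risk n mu eta p)%E.

Definition is_pred_density (d : nat) (q : pred_density d) : Prop :=
  forall (xbar : 'rV[R]_d) (s : R), 0 < s ->
    (forall y, 0 <= q y xbar s) /\ vec_int (fun y => (q y xbar s)%:E) = 1%E.

Definition inadmissible (n d : nat) (p : pred_density d) : Prop :=
  exists q : pred_density d, is_pred_density q /\ dominates n q p.

Definition f_GM (n d : nat) (nu lam : R) : R :=
  (1 - lam) `^ (n.-1%:R * d%:R / 2 - 1)
  * (1 - n.-1%:R / n%:R * lam) `^ (- ((n%:R - 2) * d%:R / 2 + nu)).

Definition prior_GM (n d : nat) (nu : R) : prior_density d :=
  fun mu eta =>
    let a := nu - d%:R / 2 - 1 in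
    (\int[leb]_(lam in `]0%R, 1%R[%classic)
       (gauss_pdf mu 0 (eta^-1 * lam^-1 * (1 - lam)) * eta `^ a * lam `^ a
        * f_GM n d nu lam)%:E)%E.

End GaussPred.

(* Main.v *)
Require Import Defs.
From HB Require Import structures.
From mathcomp Require Import all_boot all_order all_algebra.
From mathcomp Require Import all_classical all_reals all_analysis.
From mathcomp Require Import measurable_realfun ring lra.
Import Order.TTheory GRing.Theory Num.Theory.
Import numFieldNormedType.Exports.
Local Open Scope classical_set_scope.
Local Open Scope ring_scope.

Set Implicit Arguments.
Unset Strict Implicit.
Unset Printing Implicit Defensive.

(** Write A = s + 2|x|^2, T = A + |y|^2, S = s + (2/3)|y - x|^2 and w = S / T.
    Integrating out mu and eta, the two Bayes marginals become integrals over
    the odds r = lambda / (1 - lambda); the denominator is a beta integral, and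
    in the numerator the factor (1 + r/2)^(-nu) (3 + r)^(d/2 + nu) is bounded
    below by an affine function of r (d >= 2) or of sqrt (1 + r/3) (d = 1).  For
    nu <= 1/1000 this gives, pointwise,
      ln (p_GM / p_R) >= nu (ln (3/2) - ln (T / A) + c w),
    with c = 63/50 if d = 1 and c = (99/100) / (d - 1) if d >= 2.
    With g(p) = p^(d/2) exp (- eta |mu|^2 (1 - p) / 2), the Laplace
    representations of ln (T / A) and S / T and Tonelli's theorem yield
      E ln (T / A) = int_0^1 (g^2 - g^3) / (p (1 - p)) dp,
      E w >= d int_0^1 g^3 / p dp.
    Finally (g^2 - g^3) / (- ln g) = int_2^3 g^k dk, and replacing
    - ln g / (p (1 - p)) by g' / g would make the first integral exactly
    int_2^3 dk / k = ln (3/2); the remainder is at most a constant, smaller than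
    c d, times int_0^1 g^3 / p dp.  Hence the risk difference is negative for
    every (mu, eta). *)

(** For two observations x_1, x_2 with mean x, A is |x_1|^2 + |x_2|^2, T adds |y|^2, and S is the
    residual sum of squares of x_1, x_2, y about their common mean. The function g is the Laplace
    transform of one squared norm, which is why A produces g^2 and T produces g^3. The obstacle is
    uniformity in mu. As |mu| grows, T / A tends to 3/2 and w tends to 0, so loss and gain fade
    together. Hence ln (3/2) has to come out exactly, and the error must be measured against the
    same integral of g^3 / p that bounds E w from below, with a ratio free of mu. The case d = 1 is
    special twice. The affine bound would lead to a beta integral with parameter d - 1 = 0, whence
    the square root; and the bound on - ln p that serves d >= 2 leaves a non-integrable 1 / p,
    whence a sharper one. The final margins are 5/4 < 63/50 for d = 1 and 27/32 < (99/100) d / (d -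
    1) otherwise; nu <= 1/1000 pays for the passage from the gain to its logarithm. *)

Lemma ler_of_eq {R : numDomainType} (x y : R) : x = y -> x <= y.
Proof. by move->. Qed.

(** * Iterated integrals *)

Section Integrals.
Context {R : realType}.
Notation leb := (@lebesgue_measure R).
Local Open Scope ereal_scope.

(* No measurability is needed: the integral of a nonnegative function is
   defined as a supremum over simple functions. *)
Lemma le_integral_any d (T : measurableType d) (mu : {measure set T -> \bar R})
    (D : set T) (f g : T -> \bar R) :
  (forall x, D x -> f x <= g x) -> \int[mu]_(x in D) f x <= \int[mu]_(x in D) g x.
Proof.
move=> fg; rewrite /integral.
have fgD x : (f \_ D) x <= (g \_ D) x.
  by rewrite /patch; case: ifPn => // /set_mem /fg.
apply: leeB.
- apply: ereal_sup_le => _ [h hf <-]; exists h => // x.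
  by apply: le_trans (hf x) _; rewrite !funeposE ge_max !le_max fgD lexx orbT.
- apply: ereal_sup_le => _ [h hf <-]; exists h => // x.
  by apply: le_trans (hf x) _; rewrite !funenegE ge_max !le_max leeN2 fgD lexx orbT.
Qed.

(** The integrands are measurable everywhere but have a sign only on the domains of integration.
    Multiplying by the indicator of the rectangle makes them nonnegative on the whole product. *)
Lemma tonelli_on d1 d2 (T1 : measurableType d1) (T2 : measurableType d2)
    (m1 : {sigma_finite_measure set T1 -> \bar R})
    (m2 : {sigma_finite_measure set T2 -> \bar R}) (D : set T1) (E : set T2)
    (f : T1 -> T2 -> \bar R) :
  measurable D -> measurable E ->
  measurable_fun setT (fun p : T1 * T2 => f p.1 p.2) ->
  (forall x y, D x -> E y -> 0 <= f x y) ->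
  \int[m1]_(x in D) \int[m2]_(y in E) f x y =
  \int[m2]_(y in E) \int[m1]_(x in D) f x y.
Proof.
move=> mD mE mf f0.
pose g := fun p : T1 * T2 => f p.1 p.2 * (\1_(D `*` E) p)%:E.
have mg : measurable_fun setT g.
  apply: emeasurable_funM => //; apply/measurable_EFinP/measurable_indic.
  exact: measurableX.
have g0 p : 0 <= g p.
  rewrite /g indicE; case: (boolP (p \in _)); rewrite ?mule0//.
  by rewrite inE => -[? ?]; rewrite mule1 f0.
have gE x y : g (x, y) = f x y * (\1_D x)%:E * (\1_E y)%:E.
  rewrite /g/= -muleA -EFinM; congr (_ * _%:E)%E.
  by rewrite !indicE in_setX/=; do 2 case: (_ \in _); rewrite ?mulr0 ?mulr1 ?mul0r.
have := fubini_tonelli (m1 := m1) (m2 := m2) g mg g0.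
have E1 : \int[m1]_x \int[m2]_y g (x, y) = \int[m1]_(x in D) \int[m2]_(y in E) f x y.
  rewrite [RHS]integral_mkcond; apply: eq_integral => x _; rewrite /patch.
  case: ifPn => xD.
    rewrite [RHS]integral_mkcond; apply: eq_integral => y _; rewrite gE epatch_indic/=.
    by rewrite [in LHS]indicE xD mule1.
  rewrite integral0_eq// => y _; by rewrite gE indicE (negbTE xD) mule0 mul0e.
rewrite E1 => ->.
rewrite [RHS]integral_mkcond; apply: eq_integral => y _; rewrite /patch.
case: ifPn => yE.
  rewrite [RHS]integral_mkcond; apply: eq_integral => x _; rewrite gE epatch_indic/=.
  by rewrite [X in _ * X%:E]indicE yE mule1.
by rewrite integral0_eq// => x _; rewrite gE [X in _ * X%:E]indicE (negbTE yE) mule0.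
Qed.

Lemma tonelli_leb (D E : set R) (f : R -> R -> \bar R) :
  measurable D -> measurable E ->
  measurable_fun [set: R * R] (fun p => f p.1 p.2) ->
  (forall x y, D x -> E y -> 0 <= f x y) ->
  \int[leb]_(x in D) \int[leb]_(y in E) f x y =
  \int[leb]_(y in E) \int[leb]_(x in D) f x y.
Proof.
exact: (@tonelli_on _ _ (measurableTypeR R) (measurableTypeR R) leb leb D E f).
Qed.

Lemma measurable_integral_on d1 d2 (T1 : measurableType d1) (T2 : measurableType d2)
    (m2 : {sigma_finite_measure set T2 -> \bar R}) (E : set T2)
    (f : T1 -> T2 -> \bar R) :
  measurable E -> measurable_fun setT (fun p : T1 * T2 => f p.1 p.2) ->
  (forall x y, E y -> 0 <= f x y) ->
  measurable_fun setT (fun x => \int[m2]_(y in E) f x y).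
Proof.
move=> mE mf f0.
pose g := fun p : T1 * T2 => f p.1 p.2 * (\1_E p.2)%:E.
have mg : measurable_fun setT g.
  apply: emeasurable_funM => //; apply/measurable_EFinP.
  by apply: measurableT_comp => //; exact: measurable_indic.
have g0 p : 0 <= g p.
  rewrite /g indicE; case: (boolP (p.2 \in _)); rewrite ?mule0//.
  by rewrite inE => ?; rewrite mule1 f0.
rewrite (_ : (fun x => _) = fubini_F m2 g); last first.
  apply/funext => x; rewrite integral_mkcond; apply: eq_integral => y _.
  by rewrite epatch_indic.
exact: measurable_fun_fubini_tonelli_F.
Qed.

Lemma eq_iint n (F G : seq R -> \bar R) : (forall s, size s = n -> F s = G s) ->
  iint_seq n F = iint_seq n G.
Proof.
elim: n F G => [|n IH] F G FG /=; first exact: FG.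
by apply: eq_integral => x _; apply: IH => s sn; apply: FG; rewrite /= sn.
Qed.

Lemma le_iint n (F G : seq R -> \bar R) : (forall s, size s = n -> F s <= G s) ->
  iint_seq n F <= iint_seq n G.
Proof.
elim: n F G => [|n IH] F G FG /=; first exact: FG.
by apply: le_integral_any => x _; apply: IH => s sn; apply: FG; rewrite /= sn.
Qed.

Lemma iint0 n : iint_seq n (fun=> 0 : \bar R) = 0.
Proof. by elim: n => //= n ->; rewrite integral0. Qed.

Lemma iint_ge0 n (F : seq R -> \bar R) : (forall s, size s = n -> 0 <= F s) ->
  0 <= iint_seq n F.
Proof. by move=> F0; rewrite -(iint0 n); exact: le_iint. Qed.

Lemma iint_cat n m (F : seq R -> \bar R) :
  iint_seq (n + m) F = iint_seq n (fun s => iint_seq m (fun t => F (s ++ t))).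
Proof. by elim: n F => //= n IH F; apply: eq_integral => x _; rewrite IH. Qed.

(** Only sequences of length [n] matter, so measurability is stated on tuples. The parameter in [T]
    lets inductions on [n] absorb one coordinate after another, see [jmeas_cons]. *)
Definition jmeas n d (T : measurableType d) (F : T -> seq R -> \bar R) :=
  measurable_fun setT (fun p : T * n.-tuple R => F p.1 p.2).

Lemma jmeas_cons n d (T : measurableType d) (F : T -> seq R -> \bar R) :
  jmeas n.+1 F -> jmeas n (fun p : T * R => fun s => F p.1 (p.2 :: s)).
Proof.
move=> mF.
pose h := fun p : (T * R) * n.-tuple R => (p.1.1, [the n.+1.-tuple R of p.1.2 :: p.2]).
have mh : measurable_fun setT h.
  apply/measurable_fun_pairP; split => /=.
    exact: (measurableT_comp measurable_fst measurable_fst).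
  apply: measurable_cons => //.
  exact: (measurableT_comp measurable_snd measurable_fst).
exact: (measurableT_comp mF mh).
Qed.

Lemma jmeas_iint n d (T : measurableType d) (F : T -> seq R -> \bar R) :
  jmeas n F -> (forall t s, size s = n -> 0 <= F t s) ->
  measurable_fun setT (fun t => iint_seq n (F t)).
Proof.
elim: n d T F => [|n IH] d T F mF F0.
  rewrite (_ : (fun t => _) = (fun p : T * 0.-tuple R => F p.1 p.2) \o (fun t : T => (t, [tuple of nil] : 0.-tuple R)))//.
  by apply: (measurableT_comp mF); apply/measurable_fun_pairP; split => /=;
    [exact: measurable_id|exact: measurable_cst].
rewrite /=; apply: (@measurable_integral_on _ _ T _ (@lebesgue_measure R) setT
  (fun t x => iint_seq n (fun s => F t (x :: s)))) => //.
  apply: (IH _ _ (fun p : T * R => fun s => F p.1 (p.2 :: s))).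
    exact: jmeas_cons.
  by move=> t s sn; apply: F0; rewrite /= sn.
by move=> x y _; apply: iint_ge0 => s sn; apply: F0; rewrite /= sn.
Qed.

Lemma jmeas_sub n d d' (T : measurableType d) (T' : measurableType d')
    (h : T' -> T) (F : T -> seq R -> \bar R) :
  measurable_fun setT h -> jmeas n F -> jmeas n (fun t => F (h t)).
Proof.
move=> mh mF.
have mh' : measurable_fun setT (fun p : T' * n.-tuple R => (h p.1, p.2)).
  apply/measurable_fun_pairP; split => /=; last exact: measurable_snd.
  exact: (measurableT_comp mh measurable_fst).
exact: (measurableT_comp mF mh').
Qed.

Lemma iint_swap n d (T : measurableType d) (m : {sigma_finite_measure set T -> \bar R})
    (D : set T) (F : T -> seq R -> \bar R) :
  measurable D -> jmeas n F -> (forall t s, D t -> size s = n -> 0 <= F t s) ->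
  \int[m]_(t in D) iint_seq n (F t) = iint_seq n (fun s => \int[m]_(t in D) F t s).
Proof.
move=> mD; elim: n F => [|n IH] F mF F0 //=.
(* [jmeas_iint] asks for nonnegativity at every parameter value, not only on [D]; the indicator
   provides it. *)
pose F1 := fun t s => F t s * (\1_D t)%:E.
have mF1 : jmeas n.+1 F1.
  apply: emeasurable_funM => //; apply/measurable_EFinP.
  have mi : measurable_fun setT (\1_D : T -> R) by exact: measurable_indic.
  exact: (measurableT_comp mi measurable_fst).
have F10 t s : size s = n.+1 -> 0 <= F1 t s.
  move=> sn; rewrite /F1 indicE; case: (boolP (t \in D)); rewrite ?mule0// inE => tD.
  by rewrite mule1 F0.
have FF1 t s : D t -> F t s = F1 t s.
  by move=> Dt; rewrite /F1 indicE mem_set// mule1.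
transitivity (\int[m]_(t in D) \int[leb]_x iint_seq n (fun s => F1 t (x :: s))).
  apply: eq_integral => t; rewrite inE => Dt; apply: eq_integral => x _.
  by apply: eq_iint => s _; exact: FF1.
rewrite tonelli_on//; first last.
- by move=> t x _ _; apply: iint_ge0 => s sn; apply: F10; rewrite /= sn.
- apply: (@jmeas_iint n _ _ (fun p : T * R => fun s => F1 p.1 (p.2 :: s))).
    exact: jmeas_cons.
  by move=> t s sn; apply: F10; rewrite /= sn.
apply: eq_integral => x _; rewrite IH; first last.
- by move=> t s Dt sn; apply: F10; rewrite /= sn.
- have := jmeas_cons mF1.
  move/(@jmeas_sub _ _ _ _ T (fun t => (t, x))); apply.
  by apply/measurable_fun_pairP; split => /=; [exact: measurable_id|exact: measurable_cst].
by apply: eq_iint => s _; apply: eq_integral => t; rewrite inE => Dt; rewrite -FF1.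
Qed.

(* Integrability at every stage of the iterated integral, for all values of
   the outer variables (not only almost everywhere). *)
Fixpoint Int n (F : seq R -> \bar R) : Prop :=
  match n with
  | 0%N => F [::] \is a fin_num
  | n'.+1 => (forall x, Int n' (fun s => F (x :: s))) /\
      leb.-integrable [set: R] (fun x => iint_seq n' (fun s => F (x :: s)))
  end.

Lemma Int_fin n F : Int n F -> iint_seq n F \is a fin_num.
Proof.
case: n => [//|n] [_ iF] /=.
exact: integrable_fin_num.
Qed.

Lemma eq_Int n F G : (forall s, size s = n -> F s = G s) -> Int n F -> Int n G.
Proof.
elim: n F G => [|n IH] F G FG /=; first by rewrite FG.
case=> iF1 iF2; split.
  by move=> x; apply: IH (iF1 x) => s sn; apply: FG; rewrite /= sn.
rewrite (_ : (fun x => _) = (fun x : R => iint_seq n (fun s => F (x :: s))))//.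
by apply/funext => x; apply: eq_iint => s sn; rewrite FG//= sn.
Qed.

Lemma IntD n F G : Int n F -> Int n G ->
  Int n (fun s => F s + G s) /\
  iint_seq n (fun s => F s + G s) = iint_seq n F + iint_seq n G.
Proof.
elim: n F G => [|n IH] F G /=; first by move=> fF fG; rewrite fin_numD fF fG.
case=> iF1 iF2 [iG1 iG2].
have E : (fun x : R => iint_seq n (fun s => F (x :: s) + G (x :: s))) =
  (fun x => iint_seq n (fun s => F (x :: s)) + iint_seq n (fun s => G (x :: s))).
  by apply/funext => x; rewrite (IH _ _ (iF1 x) (iG1 x)).2.
split; last by rewrite E integralD.
split; first by move=> x; exact: (IH _ _ (iF1 x) (iG1 x)).1.
by rewrite E; exact: integrableD.
Qed.

Lemma IntZ n (k : R) F : Int n F -> Int n (fun s => k%:E * F s) /\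
  iint_seq n (fun s => k%:E * F s) = k%:E * iint_seq n F.
Proof.
elim: n F => [|n IH] F /=; first by move=> fF; rewrite fin_numM.
case=> iF1 iF2.
have E : (fun x : R => iint_seq n (fun s => k%:E * F (x :: s))) =
  (fun x => k%:E * iint_seq n (fun s => F (x :: s))).
  by apply/funext => x; rewrite (IH _ (iF1 x)).2.
split; last by rewrite E integralZl.
split; first by move=> x; exact: (IH _ (iF1 x)).1.
by rewrite E; exact: integrableZl.
Qed.

(** Each induction step moves one fixed coordinate into the parameter [t]. Joint measurability makes
    every slice measurable, so domination yields integrability at every stage and not only almost
    everywhere. *)
Lemma Int_dom_ge0 n d (T : measurableType d) (t : T)
  (F : T -> seq R -> \bar R) (G : seq R -> \bar R) : jmeas n F ->
  (forall t s, size s = n -> 0 <= F t s) ->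
  (forall s, size s = n -> F t s <= G s) -> Int n G -> Int n (F t).
Proof.
elim: n d T t F G => [|n IH] d T t F G mF F0 FG.
  rewrite /= => G0; rewrite ge0_fin_numE ?F0//.
  by apply: le_lt_trans (FG _ _) _ => //; rewrite ltey_eq G0.
case=> iG1 iG2; split.
  move=> x; apply: (@IH _ _ (t, x) (fun p : T * R => fun s => F p.1 (p.2 :: s))
     (fun s => G (x :: s)) _ _ _ (iG1 x)).
  - exact: jmeas_cons.
  - by move=> p s sn; apply: F0; rewrite /= sn.
  - by move=> s sn; apply: FG; rewrite /= sn.
refine (@le_integrable _ _ R leb [set: R] measurableT
  (fun x => iint_seq n (fun s => F t (x :: s))) _ _ _ iG2).
- have mI : measurable_fun setT (fun p : T * R => iint_seq n (fun s => F p.1 (p.2 :: s))).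
    apply: (@jmeas_iint n _ _ (fun p : T * R => fun s => F p.1 (p.2 :: s))).
      exact: jmeas_cons.
    by move=> p s sn; apply: F0; rewrite /= sn.
  have mtx : measurable_fun setT (fun x : R => (t, x)).
    by apply/measurable_fun_pairP; split => /=; [exact: measurable_cst|exact: measurable_id].
  exact: (measurableT_comp mI mtx).
- move=> x _ ; rewrite !gee0_abs; first last.
  + by apply: iint_ge0 => s sn; apply: F0; rewrite /= sn.
  + by apply: iint_ge0 => s sn; apply: le_trans (FG _ _); rewrite ?F0//= sn.
  by apply: le_iint => s sn; apply: FG; rewrite /= sn.
Qed.

(** Positive and negative parts are each dominated by [G]; [IntD] and [IntZ] recombine them. *)
Lemma Int_dom n d (T : measurableType d) (t : T)
  (F : T -> seq R -> \bar R) (G : seq R -> \bar R) : jmeas n F ->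
  (forall s, size s = n -> `|F t s| <= G s) -> Int n G -> Int n (F t).
Proof.
move=> mF FG iG.
have mP : jmeas n (fun t => (F t) ^\+).
  rewrite /jmeas (_ : (fun p => _) = (fun p : T * n.-tuple R => F p.1 p.2)^\+); last first.
    by apply/funext => p; rewrite !funeposE.
  exact: measurable_funepos.
have mN : jmeas n (fun t => (F t) ^\-).
  rewrite /jmeas (_ : (fun p => _) = (fun p : T * n.-tuple R => F p.1 p.2)^\-); last first.
    by apply/funext => p; rewrite !funenegE.
  exact: measurable_funeneg.
have iP : Int n ((F t)^\+).
  apply: (Int_dom_ge0 mP _ _ iG) => [? ? _|s sn]; first exact: funepos_ge0; apply: le_trans (FG _ sn).
  by rewrite -/((abse \o F t) s) fune_abse leeDl ?funeneg_ge0.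
have iN : Int n ((F t)^\-).
  apply: (Int_dom_ge0 mN _ _ iG) => [? ? _|s sn]; first exact: funeneg_ge0; apply: le_trans (FG _ sn).
  by rewrite -/((abse \o F t) s) fune_abse leeDr ?funepos_ge0.
have [+ _] := IntD iP (IntZ (-1) iN).1.
apply: eq_Int => s sn; rewrite EFinN mulN1e.
exact/esym/(congr1 (fun f => f s) (funeposneg (F t))).
Qed.

End Integrals.

(** * Calculus on open intervals *)

Section Derivatives.
Context {R : realType}.
Implicit Types (f g : R -> R) (x a b c : R).

Lemma der_eq f x a b : is_derive x 1 f a -> a = b -> is_derive x 1 f b.
Proof. by move=> ? <-. Qed.

Lemma der_cst c x : is_derive x 1 (fun _ : R => c) 0.
Proof. exact: is_derive_cst. Qed.

Lemma der_id x : is_derive x 1 (fun y : R => y) 1.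
Proof. exact: is_derive_id. Qed.

Lemma derD f g x a b : is_derive x 1 f a -> is_derive x 1 g b ->
  is_derive x 1 (fun y => f y + g y) (a + b).
Proof. by move=> ? ?; exact: is_deriveD. Qed.

Lemma derN f x a : is_derive x 1 f a -> is_derive x 1 (fun y => - f y) (- a).
Proof. by move=> ?; exact: is_deriveN. Qed.

Lemma derM f g x a b : is_derive x 1 f a -> is_derive x 1 g b ->
  is_derive x 1 (fun y => f y * g y) (a * g x + f x * b).
Proof.
move=> fa gb; have h := is_deriveM fa gb.
by rewrite addrC (mulrC a); exact h.
Qed.

Lemma derV f x a : f x != 0 -> is_derive x 1 f a ->
  is_derive x 1 (fun y => (f y)^-1) (- (a / f x ^+ 2)).
Proof.
move=> fx fa; have h := is_deriveV fx fa.
by rewrite mulrC -mulNr; exact h.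
Qed.

Lemma der_comp f g x a b : is_derive (g x) 1 f a -> is_derive x 1 g b ->
  is_derive x 1 (fun y => f (g y)) (b * a).
Proof. by move=> fa gb; rewrite mulrC; exact: is_derive1_comp. Qed.

Lemma der_exp f x a : is_derive x 1 f a ->
  is_derive x 1 (fun y => expR (f y)) (a * expR (f x)).
Proof. by move=> fa; apply: der_comp. Qed.

Lemma der_ln f x a : 0 < f x -> is_derive x 1 f a ->
  is_derive x 1 (fun y => ln (f y)) (a / f x).
Proof. by move=> fx fa; apply: der_comp; exact: is_derive1_ln. Qed.

Lemma der_pow f x a c : 0 < f x -> is_derive x 1 f a ->
  is_derive x 1 (fun y => f y `^ c) (a * (c * f x `^ (c - 1))).
Proof. by move=> fx fa; have h := is_derive1_powR c fx; exact: (der_comp h fa). Qed.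

Lemma der_powx x (b : R) : 0 < b ->
  is_derive x 1 (fun y => b `^ y) (ln b * b `^ x).
Proof.
move=> b0.
rewrite (_ : (fun y => _) = (fun y => expR (y * ln b))); last first.
  by apply/funext => y; rewrite /powR gt_eqF.
eapply der_eq; first (eapply der_exp; eapply derM; [exact: der_id|exact: der_cst]).
by rewrite mul1r mulr0 addr0 /powR gt_eqF.
Qed.

Lemma der_Xn f x a n : is_derive x 1 f a ->
  is_derive x 1 (fun y => f y ^+ n) (n%:R * f x ^+ n.-1 * a).
Proof.
move=> fa; have h := is_deriveX n fa.
rewrite (_ : (fun y => _) = f ^+ n); first exact h.
by apply/funext => y; rewrite fctE.
Qed.

Lemma der_continuous f x a : is_derive x 1 f a -> {for x, continuous f}.
Proof. by move=> fa; apply/differentiable_continuous/derivable1_diffP/ex_derive. Qed.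

Lemma der_derivable f x a : is_derive x 1 f a -> derivable f x 1.
Proof. by case. Qed.

Lemma der_val f x a : is_derive x 1 f a -> f^`()%classic x = a.
Proof. by case=> _; rewrite derive1E. Qed.

End Derivatives.

(** The rules above are phrased with explicit function bodies so that this tactic can select one by
    the syntax of the body, the derivative being an evar. Only side conditions (nonzero or positive
    arguments) survive. The fallback takes a derivative from the context, or treats a power with
    variable exponent. *)
Ltac der_step := lazymatch goal with
  |- is_derive _ _ ?f _ => lazymatch f with
  | (fun _ => ?c) => exact: der_cst
  | (fun x => x) => exact: der_id
  | (fun x => (@?a x + @?b x)%R) => eapply (derD (f := a) (g := b))
  | (fun x => (- @?a x)%R) => eapply (derN (f := a))
  | (fun x => (@?a x * @?b x)%R) => eapply (derM (f := a) (g := b))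
  | (fun x => ((@?a x)^-1)%R) => eapply (derV (f := a))
  | (fun x => (@?a x ^+ ?n)%R) => eapply (der_Xn (f := a))
  | (fun x => expR (@?a x)) => eapply (der_exp (f := a))
  | (fun x => ln (@?a x)) => eapply (der_ln (f := a))
  | (fun x => (@?a x `^ ?c)%R) => eapply (der_pow (f := a))
  | _ => first [eassumption | eapply der_powx]
  end end.
Ltac der := eapply der_eq; [repeat der_step | ]; rewrite /=.
Ltac dcont := eapply der_continuous; repeat der_step.

Section Measurability.
Context {R : realType} d (T : measurableType d).
Implicit Types (f g : T -> R).

Lemma meas_cst c : measurable_fun setT (fun _ : T => c : R).
Proof. exact: measurable_cst. Qed.
Lemma measD f g : measurable_fun setT f -> measurable_fun setT g ->
  measurable_fun setT (fun x => f x + g x).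
Proof. by move=> mf mg; exact: measurable_funD. Qed.
Lemma measN f : measurable_fun setT f -> measurable_fun setT (fun x => - f x).
Proof. by move=> mf; exact: measurableT_comp. Qed.
Lemma measM f g : measurable_fun setT f -> measurable_fun setT g ->
  measurable_fun setT (fun x => f x * g x).
Proof. by move=> mf mg; exact: measurable_funM. Qed.
Lemma measXn f n : measurable_fun setT f -> measurable_fun setT (fun x => f x ^+ n).
Proof. by move=> mf; exact: measurable_funX. Qed.
Lemma meas_exp f : measurable_fun setT f -> measurable_fun setT (fun x => expR (f x)).
Proof. by move=> mf; exact: measurableT_comp. Qed.
Lemma meas_ln f : measurable_fun setT f -> measurable_fun setT (fun x => ln (f x)).
Proof. by move=> mf; apply: measurableT_comp => //; exact: measurable_ln. Qed.
Lemma meas_pow f c : measurable_fun setT f -> measurable_fun setT (fun x => f x `^ c).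
Proof. by move=> mf; apply: (measurableT_comp (measurable_powR c)). Qed.
Lemma meas_norm f : measurable_fun setT f -> measurable_fun setT (fun x => `|f x|).
Proof. by move=> mf; exact: measurableT_comp. Qed.

Lemma measurable_invr : measurable_fun [set: R] (fun x : R => x^-1).
Proof.
(* Going through [powR] of the square needs no case on the sign of x, and both sides are 0 at x =
   0. *)
rewrite (_ : (fun x : R => x^-1) = (fun x => x * (x ^+ 2) `^ (-1))); last first.
  apply/funext => x; have [->|x0] := eqVneq x 0; first by rewrite invr0 mul0r.
  by rewrite powR_inv1 ?sqr_ge0// expr2 invfM mulrA divff// mul1r.
apply: measurable_funM => //.
by apply: (measurableT_comp (measurable_powR (-1))); exact: measurable_funX.
Qed.

Lemma measV f : measurable_fun setT f -> measurable_fun setT (fun x => (f x)^-1).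
Proof. by move=> mf; exact: (measurableT_comp measurable_invr). Qed.

End Measurability.

Ltac meas_step := lazymatch goal with
  |- measurable_fun _ ?f => lazymatch f with
  | (fun _ => ?c) => exact: meas_cst
  | (fun x => x) => exact: measurable_id
  | (fun x => fst x) => exact: measurable_fst
  | (fun x => snd x) => exact: measurable_snd
  | (fun x => (@?a x + @?b x)%R) => eapply (measD (f := a) (g := b))
  | (fun x => (- @?a x)%R) => eapply (measN (f := a))
  | (fun x => (@?a x * @?b x)%R) => eapply (measM (f := a) (g := b))
  | (fun x => ((@?a x)^-1)%R) => eapply (measV (f := a))
  | (fun x => (@?a x ^+ ?n)%R) => eapply (measXn (f := a))
  | (fun x => expR (@?a x)) => eapply (meas_exp (f := a))
  | (fun x => ln (@?a x)) => eapply (meas_ln (f := a))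
  | (fun x => (@?a x `^ ?c)%R) => eapply (meas_pow (f := a))
  | (fun x => (`|@?a x|)%R) => eapply (meas_norm (f := a))
  | _ => eassumption
  end end.
Ltac meas := repeat meas_step.

(** * Exhaustion of open sets by compact intervals and increasing substitutions *)

Section OpenIntervals.
Context {R : realType}.
Notation leb := (@lebesgue_measure R).

(* [D] is the increasing union of the compact intervals [u n, v n]; improper
   integrals over [D] are computed as limits along it. *)
Definition exhaust (D : set R) (u v : nat -> R) :=
  [/\ (forall n, u n < v n), nonincreasing_seq u, nondecreasing_seq v, open D &
      D = \bigcup_n `[u n, v n]%classic].

Lemma exhaust_sub D u v n x : exhaust D u v -> u n <= x <= v n -> D x.
Proof. by case=> _ _ _ _ -> xn; exists n => //=; rewrite in_itv. Qed.

Lemma exhaust_cvg D u v (f : R -> R) : exhaust D u v ->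
  (forall x, D x -> {for x, continuous f}) -> (forall x, D x -> 0 <= f x) ->
  (\int[leb]_(x in `[u n, v n]) (f x)%:E)%E @[n --> \oo] -->
  (\int[leb]_(x in D) (f x)%:E)%E.
Proof.
move=> e cf f0; have [uv nu nv oD DE] := e; rewrite [in X in _ --> X]DE.
apply: (@ge0_nondecreasing_set_cvg_integral _ (measurableTypeR R) R
  (fun n => `[u n, v n]%classic) (EFin \o f) leb).
- move=> m n mn; apply/subsetPset => x /=; rewrite !in_itv/= => /andP[ux xv].
  by rewrite (le_trans (nu _ _ mn) ux) (le_trans xv (nv _ _ mn)).
- by move=> i; exact: measurable_itv.
- move=> i; apply/measurable_EFinP.
  have cw : {within `[u i, v i], continuous f}.
    apply: continuous_in_subspaceT => x /[!inE]/= xi.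
    by apply: cf; apply: exhaust_sub e _; move: xi; rewrite in_itv/=; exact.
  by apply: subspace_continuous_measurable_fun cw; exact: measurable_itv.
- move=> i x /= xi; rewrite lee_fin; apply: f0.
  by apply: exhaust_sub e _; move: xi; rewrite in_itv/=; exact.
Qed.

(** The substitution rule on each compact piece, followed by monotone convergence on both sides: no
    integrability is assumed and both integrals may be infinite. *)
Lemma subst_exhaust D D' u v (G F f : R -> R) : exhaust D u v ->
  exhaust D' (F \o u) (F \o v) ->
  (forall x, D x -> is_derive x 1 F (f x)) ->
  (forall x, D x -> {for x, continuous f}) -> (forall x, D x -> 0 < f x) ->
  (forall x, D' x -> {for x, continuous G}) -> (forall x, D' x -> 0 <= G x) ->
  (\int[leb]_(x in D') (G x)%:E = \int[leb]_(x in D) (G (F x) * f x)%:E)%E.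
Proof.
move=> e e' dF cf f0 cG G0.
have [uv nu nv oD DE] := e.
have incr n : {in `[u n, v n] &, {homo F : x y / x < y}}.
  move=> x y xi yi xy.
  have Dz z : z \in `[x, y] -> D z.
    rewrite in_itv/= => /andP[xz zy]; apply: (exhaust_sub (n := n) e).
    move: xi yi; rewrite !in_itv/= => /andP[ux _] /andP[_ yv].
    by rewrite (le_trans ux xz) (le_trans zy yv).
  rewrite -subr_gt0.
  have [c ci ->] := @MVT R F f x y xy (fun z zi => dF z (Dz z (subset_itv_oo_cc zi)))
     (derivable_within_continuous (fun z zi => der_derivable (dF z (Dz z zi)))).
  by rewrite mulr_gt0 ?subr_gt0//; apply/f0/Dz/subset_itv_oo_cc.
have DD' x : D x -> D' (F x).
  rewrite DE => -[n _]/=; rewrite in_itv/= => /andP[ux xv].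
  apply: (exhaust_sub (n := n) e').
  have un : u n \in `[u n, v n] by rewrite in_itv/= lexx ltW.
  have vn : v n \in `[u n, v n] by rewrite in_itv/= lexx ltW.
  have xn : x \in `[u n, v n] by rewrite in_itv/= ux xv.
  rewrite /=; apply/andP; split.
    by move: ux; rewrite le_eqVlt => /predU1P[->//|/(incr n _ _ un xn)/ltW].
  by move: xv; rewrite le_eqVlt => /predU1P[->//|/(incr n _ _ xn vn)/ltW].
have c1 := exhaust_cvg e' cG G0.
have cGF x : D x -> {for x, continuous (fun x => G (F x) * f x)}.
  move=> Dx; apply: cvgM; last exact: cf.
  apply: continuous_comp; first exact: (der_continuous (dF _ Dx)).
  exact/cG/DD'.
have c2 := exhaust_cvg e cGF (fun x Dx => mulr_ge0 (G0 _ (DD' _ Dx)) (ltW (f0 _ Dx))).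
apply: (cvg_unique _ c1) => //; apply: cvg_trans c2; apply: near_eq_cvg.
apply: nearW => n /=.
have DI x : x \in `[u n, v n] -> D x.
  by rewrite in_itv/= => xn; exact: exhaust_sub e xn.
have un : u n \in `[u n, v n] by rewrite in_itv/= lexx ltW.
have vn : v n \in `[u n, v n] by rewrite in_itv/= lexx ltW.
have F'E x : x \in `[u n, v n] -> F^`()%classic x = f x.
  by move=> xi; exact: (der_val (dF x (DI x xi))).
have nearD x : D x -> \forall y \near x, D y by move=> Dx; exact: open_nbhs_nbhs.
have F'n x : D x -> \forall y \near x, F^`()%classic y = f y.
  move=> Dx; have := nearD x Dx; apply: filterS => y Dy.
  exact: (der_val (dF y Dy)).
(* The derivative of [F] is known to be [f] only on [D]; since [D] is open the two agree near each
   of its points, which transfers continuity. *)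
have cF' x : D x -> {for x, continuous F^`()%classic}.
  move=> Dx; rewrite /prop_for /continuous_at (der_val (dF x Dx)).
  apply: cvg_trans (cf x Dx); apply: near_eq_cvg.
  by have := F'n x Dx; apply: filterS => y /esym.
rewrite (@integration_by_substitution_increasing R F G (u n) (v n)) ?ltW//.
- apply: eq_integral => x; rewrite inE/= => xi.
  by rewrite /GRing.mul/= F'E.
- by move=> x xi; apply: cF'; apply/DI/subset_itv_oo_cc.
- by apply/cvg_ex; exists (F^`()%classic (u n)); apply: cvg_at_right_filter; exact/cF'/DI.
- by apply/cvg_ex; exists (F^`()%classic (v n)); apply: cvg_at_left_filter; exact/cF'/DI.
- split.
  + by move=> x xi; exact: (der_derivable (dF x (DI x (subset_itv_oo_cc xi)))).
  + by apply: cvg_at_right_filter; apply: (der_continuous (dF _ _)); apply: DI.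
  + by apply: cvg_at_left_filter; apply: (der_continuous (dF _ _)); apply: DI.
- apply: continuous_in_subspaceT => x /[!inE]/= xi; apply: cG.
  by apply: (exhaust_sub (n := n) e'); move: xi; rewrite in_itv/=; exact.
Qed.

End OpenIntervals.

(** * Fundamental theorem of calculus and substitutions on (0, 1) and (0, +oo) *)

Section OneDim.
Context {R : realType}.
Notation leb := (@lebesgue_measure R).
Implicit Types (f g F : R -> R) (D : set R) (x : R).

(** Form of integration by parts: the derivative is a difference of nonnegative functions, and the
    identity is written additively so that no difference of possibly infinite integrals appears. *)
Lemma FTC_diff D u v f1 f2 F (la lb : R) : exhaust D u v ->
  (forall x, D x -> is_derive x 1 F (f1 x - f2 x)) ->
  (forall x, D x -> {for x, continuous f1}) -> (forall x, D x -> 0 <= f1 x) ->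
  (forall x, D x -> {for x, continuous f2}) -> (forall x, D x -> 0 <= f2 x) ->
  F (u n) @[n --> \oo] --> la -> F (v n) @[n --> \oo] --> lb ->
  (\int[leb]_(x in D) (f1 x)%:E + la%:E = \int[leb]_(x in D) (f2 x)%:E + lb%:E)%E.
Proof.
move=> e dF c1 f10 c2 f20 Fu Fv; have [uv nu nv oD DE] := e.
have h1 := exhaust_cvg e c1 f10.
have h2 := exhaust_cvg e c2 f20.
have k1 : (\int[leb]_(x in `[u n, v n]) (f1 x)%:E + (F (u n))%:E)%E @[n --> \oo] -->
    (\int[leb]_(x in D) (f1 x)%:E + la%:E)%E.
  apply: cvgeD => //; first by rewrite fin_num_adde_defl.
  by apply: cvg_EFin => //; exact: nearW.
have k2 : (\int[leb]_(x in `[u n, v n]) (f2 x)%:E + (F (v n))%:E)%E @[n --> \oo] -->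
    (\int[leb]_(x in D) (f2 x)%:E + lb%:E)%E.
  apply: cvgeD => //; first by rewrite fin_num_adde_defl.
  by apply: cvg_EFin => //; exact: nearW.
apply: (cvg_unique _ k1) => //; apply: cvg_trans k2; apply: near_eq_cvg.
apply: nearW => n.
have DI x : x \in `[u n, v n] -> D x.
  by rewrite in_itv/= => xn; exact: exhaust_sub e xn.
have uvc : compact `[u n, v n] by exact: segment_compact.
have w1 : {within `[u n, v n], continuous f1}.
  by apply: continuous_in_subspaceT => x /[!inE]/= xi; apply/c1/DI.
have w2 : {within `[u n, v n], continuous f2}.
  by apply: continuous_in_subspaceT => x /[!inE]/= xi; apply/c2/DI.
have i1 := continuous_compact_integrable uvc w1.
have i2 := continuous_compact_integrable uvc w2.
have := @continuous_FTC2 _ (fun x => f1 x - f2 x) F _ _ (uv n).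
under eq_integral do rewrite EFinB.
rewrite integralB// => H.
have {H} : (\int[leb]_(x in `[u n, v n]) (f1 x)%:E -
    \int[leb]_(x in `[u n, v n]) (f2 x)%:E = (F (v n))%:E - (F (u n))%:E)%E.
  apply: H.
  - apply: continuous_in_subspaceT => x /[!inE]/= xi.
    by apply: cvgB; [apply/c1/DI|apply/c2/DI].
  - split.
    + by move=> x xi; exact: (der_derivable (dF x (DI x (subset_itv_oo_cc xi)))).
    + apply: cvg_at_right_filter; apply: (der_continuous (dF _ _)); apply: DI.
      by rewrite in_itv/= lexx ltW.
    + apply: cvg_at_left_filter; apply: (der_continuous (dF _ _)); apply: DI.
      by rewrite in_itv/= lexx ltW.
  - by move=> x xi; exact: (der_val (dF x (DI x (subset_itv_oo_cc xi)))).
have /integrable_fin_num/fineK <- // := i1.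
have /integrable_fin_num/fineK <- // := i2.
rewrite -!EFinB -!EFinD => -[] H; congr EFin; lra.
Qed.

Lemma exists_natV_le (e : R) : 0 < e -> exists n, n.+1%:R^-1 <= e.
Proof.
move=> e0; exists (Num.bound e^-1).
rewrite -[leRHS]invrK lef_pV2 ?posrE ?ltr0n ?invr_gt0//.
apply: ltW; apply: lt_le_trans (archi_boundP _) _; first by rewrite invr_ge0 ltW.
by rewrite ler_nat.
Qed.

Lemma natV_le m n : (m <= n)%N -> n.+1%:R^-1 <= m.+1%:R^-1 :> R.
Proof. by move=> mn; rewrite lef_pV2 ?posrE ?ltr0n// ler_nat. Qed.

(** The offset 3 keeps the first interval nondegenerate and matches the offset 2 of [exhaust0y]: x /
    (1 - x) sends 1 / (n + 3) to 1 / (n + 2) and 1 - 1 / (n + 3) to n + 2, as [subst_odds]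
    requires. *)
Lemma exhaust01 : exhaust `]0%R, 1%R[%classic
  (fun n => n.+3%:R^-1 : R) (fun n => 1 - n.+3%:R^-1).
Proof.
split.
- move=> n; have := @natV_le 2 n.+2 isT.
  by move: (n.+3%:R^-1) => t; lra.
- by move=> m n mn; exact: natV_le.
- by move=> m n mn; rewrite lerD2l lerN2 natV_le.
- exact: interval_open.
- apply/seteqP; split => [x|x [n _]] /=; rewrite !in_itv/=.
    move=> /andP[x0 x1].
    have m0 : 0 < Num.min x (1 - x) by rewrite lt_min x0 subr_gt0.
    have [n nm] := exists_natV_le m0.
    exists n => //=; rewrite in_itv/=.
    have := @natV_le n n.+2 (leq_trans (leqnSn _) (leqnSn _)).
    move: nm; rewrite le_min => /andP[].
    move: (n.+1%:R^-1) (n.+3%:R^-1) => t t' *; apply/andP; split; lra.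
  have : 0 < n.+3%:R^-1 :> R by rewrite invr_gt0 ltr0n.
  by move: (n.+3%:R^-1) => t t0 /andP[? ?]; apply/andP; split; lra.
Qed.

(** The factor [c] makes this the image under scaling of the exhaustion with c = 1, which is the
    form needed by [subst_scale]. *)
Lemma exhaust0y (c : R) : 0 < c -> exhaust `]0%R, +oo[%classic
  (fun n => c * n.+2%:R^-1 : R) (fun n => c * n.+2%:R).
Proof.
move=> c0; split.
- move=> n; rewrite ltr_pM2l//.
  apply: (@lt_le_trans _ _ 1); last by rewrite ler1n.
  by rewrite invf_lt1 ?ltr0n// ltr1n.
- by move=> m n mn; rewrite ler_pM2l// natV_le.
- by move=> m n mn; rewrite ler_pM2l// ler_nat.
- exact: interval_open.
- apply/seteqP; split => [x|x [n _]] /=; rewrite !in_itv/= ?andbT.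
    move=> x0.
    have m0 : 0 < Num.min (x / c) (x / c)^-1 by rewrite lt_min invr_gt0 divr_gt0.
    have [n] := exists_natV_le m0; rewrite le_min => /andP[n1 n2].
    exists n => //=; rewrite in_itv/=; apply/andP; split.
      rewrite mulrC -ler_pdivlMr//; apply: le_trans n1; exact: natV_le.
    rewrite mulrC -ler_pdivrMr//.
    move: n2; rewrite lef_pV2 ?posrE ?ltr0n ?divr_gt0// => /le_trans; apply.
    by rewrite ler_nat.
  move=> /andP[+ _]; apply: lt_le_trans.
  by rewrite mulr_gt0// invr_gt0 ltr0n.
Qed.

Lemma eq_exhaust D (u v u' v' : nat -> R) : u =1 u' -> v =1 v' ->
  exhaust D u v -> exhaust D u' v'.
Proof. by move=> /funext -> /funext ->. Qed.

Lemma cvg_eqr {T : Type} (F : set_system T) (f : T -> R) (l l' : R) :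
  f @ F --> l -> l = l' -> f @ F --> l'.
Proof. by move=> h <-. Qed.

Lemma cvg_natV : (n.+3%:R^-1 : R) @[n --> \oo] --> (0 : R).
Proof.
have := @cvg_harmonic R; rewrite -(cvg_shiftn 2); apply: cvg_trans.
by apply: near_eq_cvg; apply: nearW => n /=; rewrite addn2.
Qed.

Lemma cvg_natV2 : (n.+2%:R^-1 : R) @[n --> \oo] --> (0 : R).
Proof.
have := @cvg_harmonic R; rewrite -(cvg_shiftn 1); apply: cvg_trans.
by apply: near_eq_cvg; apply: nearW => n /=; rewrite addn1.
Qed.

Lemma cvg_nat2 : (n.+2%:R : R) @[n --> \oo] --> +oo.
Proof.
apply/cvgryPge => A; have [n An] : exists n, A <= n%:R.
  exists (Num.bound `|A|); apply: le_trans (ler_norm _) (ltW (archi_boundP _)).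
  exact: normr_ge0.
exists n => // m /= nm; apply: le_trans An _; rewrite ler_nat.
by apply: leq_trans nm _; rewrite -addn2 leq_addr.
Qed.

Lemma FTC_diff01 f1 f2 F (la lb : R) :
  (forall x, 0 < x < 1 -> is_derive x 1 F (f1 x - f2 x)) ->
  (forall x, 0 < x < 1 -> {for x, continuous f1}) -> (forall x, 0 < x < 1 -> 0 <= f1 x) ->
  (forall x, 0 < x < 1 -> {for x, continuous f2}) -> (forall x, 0 < x < 1 -> 0 <= f2 x) ->
  F x @[x --> 0^'+] --> la -> F x @[x --> 1^'-] --> lb ->
  (\int[leb]_(x in `]0%R, 1%R[%classic) (f1 x)%:E + la%:E =
   \int[leb]_(x in `]0%R, 1%R[%classic) (f2 x)%:E + lb%:E)%E.
Proof.
move=> dF c1 f10 c2 f20 Fa Fb.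
have D x : `]0%R, 1%R[%classic x -> 0 < x < 1 by rewrite /= in_itv.
apply: (FTC_diff exhaust01) => //; try by move=> x /D; auto.
- move/cvg_at_rightP : Fa; apply; split; last exact: cvg_natV.
  by move=> n; rewrite invr_gt0 ltr0n.
- move/cvg_at_leftP : Fb; apply; split.
    by move=> n; rewrite ltrBlDr ltrDl invr_gt0 ltr0n.
  rewrite -[X in _ --> X]subr0; apply: cvgB; [exact: cvg_cst|exact: cvg_natV].
Qed.

Lemma FTC_diff0y f1 f2 F (la lb : R) :
  (forall x, 0 < x -> is_derive x 1 F (f1 x - f2 x)) ->
  (forall x, 0 < x -> {for x, continuous f1}) -> (forall x, 0 < x -> 0 <= f1 x) ->
  (forall x, 0 < x -> {for x, continuous f2}) -> (forall x, 0 < x -> 0 <= f2 x) ->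
  F x @[x --> 0^'+] --> la -> F x @[x --> +oo] --> lb ->
  (\int[leb]_(x in `]0%R, +oo[%classic) (f1 x)%:E + la%:E =
   \int[leb]_(x in `]0%R, +oo[%classic) (f2 x)%:E + lb%:E)%E.
Proof.
move=> dF c1 f10 c2 f20 Fa Fb.
have D x : `]0%R, +oo[%classic x -> 0 < x by rewrite /= in_itv/= andbT.
apply: (FTC_diff (exhaust0y ltr01)) => //; try by move=> x /D; auto.
- move/cvg_at_rightP : Fa; apply; split.
    by move=> n; rewrite mul1r invr_gt0 ltr0n.
  by under eq_fun do rewrite mul1r; exact: cvg_natV2.
- under eq_fun do rewrite mul1r.
  exact: (cvg_comp _ _ cvg_nat2 Fb).
Qed.

Lemma cont0 x : {for x, continuous (fun _ : R => 0 : R)}.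
Proof. exact: cvg_cst. Qed.

Lemma FTC01 f F (la lb : R) :
  (forall x, 0 < x < 1 -> is_derive x 1 F (f x)) ->
  (forall x, 0 < x < 1 -> {for x, continuous f}) -> (forall x, 0 < x < 1 -> 0 <= f x) ->
  F x @[x --> 0^'+] --> la -> F x @[x --> 1^'-] --> lb ->
  (\int[leb]_(x in `]0%R, 1%R[%classic) (f x)%:E = (lb - la)%:E)%E.
Proof.
move=> dF cf f0 Fa Fb.
have := @FTC_diff01 f (fun=> 0) F la lb.
move=> /(_ _ cf f0 (fun x _ => @cont0 x) (fun x _ => lexx _) Fa Fb).
rewrite integral0 add0e => H.
have {}H : (\int[leb]_(x in `]0%R, 1%R[%classic) (f x)%:E + la%:E = lb%:E)%E.
  by apply: H => x x01; rewrite subr0; exact: dF.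
by rewrite EFinB -H addeK.
Qed.

Lemma FTC0y f F (la lb : R) :
  (forall x, 0 < x -> is_derive x 1 F (f x)) ->
  (forall x, 0 < x -> {for x, continuous f}) -> (forall x, 0 < x -> 0 <= f x) ->
  F x @[x --> 0^'+] --> la -> F x @[x --> +oo] --> lb ->
  (\int[leb]_(x in `]0%R, +oo[%classic) (f x)%:E = (lb - la)%:E)%E.
Proof.
move=> dF cf f0 Fa Fb.
have := @FTC_diff0y f (fun=> 0) F la lb.
move=> /(_ _ cf f0 (fun x _ => @cont0 x) (fun x _ => lexx _) Fa Fb).
rewrite integral0 add0e => H.
have {}H : (\int[leb]_(x in `]0%R, +oo[%classic) (f x)%:E + la%:E = lb%:E)%E.
  by apply: H => x x01; rewrite subr0; exact: dF.
by rewrite EFinB -H addeK.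
Qed.

Lemma subst_scale (G : R -> R) (c : R) : 0 < c ->
  (forall x, 0 < x -> {for x, continuous G}) -> (forall x, 0 < x -> 0 <= G x) ->
  (\int[leb]_(x in `]0%R, +oo[%classic) (G x)%:E =
   \int[leb]_(x in `]0%R, +oo[%classic) (G (c * x) * c)%:E)%E.
Proof.
move=> c0 cG G0.
have D x : `]0%R, +oo[%classic x -> 0 < x by rewrite /= in_itv/= andbT.
apply: (@subst_exhaust R _ _ _ _ G (fun x => c * x) (fun=> c) (exhaust0y ltr01)).
- by apply: eq_exhaust (exhaust0y c0) => n /=; rewrite mul1r.
- by move=> x _; der; rewrite mul0r mulr1 add0r.
- by move=> x _; exact: cvg_cst.
- by [].
- by move=> x /D; exact: cG.
- by move=> x /D; exact: G0.
Qed.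

Lemma subst_odds (G : R -> R) :
  (forall x, 0 < x -> {for x, continuous G}) -> (forall x, 0 < x -> 0 <= G x) ->
  (\int[leb]_(x in `]0%R, +oo[%classic) (G x)%:E =
   \int[leb]_(x in `]0%R, 1%R[%classic) (G (x / (1 - x)) * (1 - x) ^- 2)%:E)%E.
Proof.
move=> cG G0.
have D x : `]0%R, +oo[%classic x -> 0 < x by rewrite /= in_itv/= andbT.
have D1 x : `]0%R, 1%R[%classic x -> 0 < 1 - x.
  by rewrite /= in_itv/= subr_gt0 => /andP[].
have dx (x : R) : 0 < 1 - x -> is_derive x 1 (fun x => x / (1 - x)) ((1 - x) ^- 2).
  move=> x1; der; first by rewrite gt_eqF.
  by field; rewrite gt_eqF.
have dx2 (x : R) : 0 < 1 - x -> is_derive x 1 (fun x => (1 - x) ^- 2) (2 * (1 - x) ^- 3).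
  move=> x1; der; first by rewrite gt_eqF// exprn_gt0.
  by rewrite /=; field; rewrite gt_eqF.
apply: (@subst_exhaust R _ _ _ _ G (fun x => x / (1 - x)) (fun x => (1 - x) ^- 2) exhaust01).
- apply: eq_exhaust (exhaust0y ltr01) => n /=; rewrite mul1r -[n.+3%:R]natr1;
    have : (0 : R) < n.+2%:R by rewrite ltr0n.
    move: (n.+2%:R) => t t0. field; rewrite ?gt_eqF//; lra.
  move: (n.+2%:R) => t t0; field; rewrite ?gt_eqF//; lra.
- by move=> x /D1; exact: dx.
- by move=> x /D1 /dx2; exact: der_continuous.
- by move=> x /D1 x1; rewrite invr_gt0 exprn_gt0.
- by move=> x /D; exact: cG.
- by move=> x /D; exact: G0.
Qed.

End OneDim.

(** * Gamma and beta integrals *)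

Section Positive.
Context {R : realType}.
Notation leb := (@lebesgue_measure R).
Implicit Types (f g : R -> R) (D : set R) (x : R).

Lemma integralZ_ge0 D f (k : R) : measurable D -> measurable_fun setT f ->
  (forall x, D x -> 0 <= f x) -> 0 <= k ->
  (\int[leb]_(x in D) (k * f x)%:E = k%:E * \int[leb]_(x in D) (f x)%:E)%E.
Proof.
move=> mD mf f0 k0; under eq_integral do rewrite EFinM.
rewrite ge0_integralZl//.
apply/measurable_EFinP; exact: measurable_funS mf.
Qed.

Lemma integralD_ge0 D f g : measurable D -> measurable_fun setT f -> measurable_fun setT g ->
  (forall x, D x -> 0 <= f x) -> (forall x, D x -> 0 <= g x) ->
  (\int[leb]_(x in D) (f x + g x)%:E =
   \int[leb]_(x in D) (f x)%:E + \int[leb]_(x in D) (g x)%:E)%E.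
Proof.
move=> mD mf mg f0 g0; under eq_integral do rewrite EFinD.
rewrite ge0_integralD//.
- by apply/measurable_EFinP; exact: measurable_funS mf.
- by apply/measurable_EFinP; exact: measurable_funS mg.
Qed.

Lemma integral_gt0 D f (a b c : R) : measurable D -> measurable_fun setT f ->
  (forall x, D x -> 0 <= f x) -> a < b -> 0 < c ->
  (forall x, a <= x <= b -> D x /\ c <= f x) ->
  (0 < \int[leb]_(x in D) (f x)%:E)%E.
Proof.
move=> mD mf f0 ab c0 fc.
apply: (@lt_le_trans _ _ (\int[leb]_(x in `[a, b]) c%:E)%E).
  rewrite integral_cst//= lebesgue_measure_itv/= lte_fin ab -EFinB -EFinM lte_fin.
  by rewrite mulr_gt0// subr_gt0.
apply: (@le_trans _ _ (\int[leb]_(x in `[a, b]) (f x)%:E)%E).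
  by apply: le_integral_any => x /=; rewrite in_itv/= lee_fin => /fc[].
apply: ge0_subset_integral => //.
- by apply/measurable_EFinP; exact: measurable_funS mf.
- by move=> x /=; rewrite in_itv/= => /fc[].
Qed.

(** This is [ln (x / b) <= x / b] multiplied by [b]. It supplies the decay of the exponential
    against powers. *)
Lemma powR_le_exp (b x : R) : 0 < b -> 0 < x -> x `^ b <= b `^ b * expR x.
Proof.
move=> b0 x0.
rewrite /powR !gt_eqF// -expRD ler_expR.
have : ln (x / b) <= x / b.
  by apply: ltW; apply: ln_sublinear; rewrite divr_gt0.
rewrite ln_div ?posrE// lerBlDr => h.
rewrite -(ler_pM2l b0) in h.
apply: le_trans h _.
by rewrite mulrDr mulrCA divff ?gt_eqF// mulr1 addrC.
Qed.

End Positive.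

(** * The gamma function and the beta integral *)

Section GammaFunction.
Context {R : realType}.
Notation leb := (@lebesgue_measure R).
Notation Dy := (`]0%R, +oo[%classic : set R).
Implicit Types (a b c x : R).

Lemma DyE x : Dy x <-> 0 < x.
Proof. by rewrite /= in_itv/= andbT. Qed.

Lemma powR_cvgy a : 0 < a -> x `^ a @[x --> +oo] --> +oo.
Proof.
move=> a0; apply/cvgryPge => A; pose B := Num.max A 1.
have B0 : 0 < B by rewrite lt_max ltr01 orbT.
near=> x; apply: (@le_trans _ _ B); first by rewrite le_max lexx.
have -> : B = (B `^ a^-1) `^ a by rewrite -powRrM mulVf ?gt_eqF// powRr1// ltW.
apply: ge0_ler_powR; rewrite ?nnegrE ?powR_ge0 ?ltW//.
Unshelve. all: by end_near. Qed.

Let gam a x : R := x `^ (a - 1) * expR (- x).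

Let mgam a : measurable_fun setT (gam a).
Proof. by rewrite /gam; meas. Qed.

Let gam_ge0 a x : 0 <= gam a x.
Proof. by rewrite mulr_ge0 ?powR_ge0 ?expR_ge0. Qed.

Let gam_lty a : 0 < a -> (\int[leb]_(x in Dy) (gam a x)%:E < +oo)%E.
Proof.
move=> a0.
(* The comparison function [g] has the primitive - 1 / (a (1 + x^a)) and controls both ends of the
   half-line at once. The constant comes from (1 + x^a)^2 <= 2 (1 + x^(2a)) <= 2 (1 + (2a)^(2a)) exp
   x. *)
pose K : R := 2 * (1 + (a * 2) `^ (a * 2)).
pose g x : R := x `^ (a - 1) / (1 + x `^ a) ^+ 2.
have K0 : 0 <= K by rewrite mulr_ge0// addr_ge0// powR_ge0.
have p1 x : 0 < 1 + x `^ a by rewrite ltr_pwDl// powR_ge0.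
have gE : (\int[leb]_(x in Dy) (g x)%:E = (0 - (- (a^-1)))%:E)%E.
  apply: (@FTC0y _ g (fun x => - (a^-1 / (1 + x `^ a)))).
  - move=> x x0; der; rewrite ?gt_eqF//.
    by rewrite /g; field; rewrite !gt_eqF.
  - by move=> x x0; rewrite /g; dcont => //; rewrite expf_neq0// gt_eqF.
  - by move=> x x0; rewrite /g mulr_ge0 ?powR_ge0// invr_ge0 sqr_ge0.
  - eapply cvg_eqr.
      apply: cvgN; apply: cvgM; first exact: cvg_cst.
      apply: cvgV; last first.
        by apply: cvgD; [exact: cvg_cst|exact: powR_cvg0].
      by rewrite addr0.
    by rewrite addr0 invr1 mulr1.
  - eapply cvg_eqr; last by rewrite -oppr0 -(mulr0 a^-1).
    apply: cvgN; apply: cvgM; first exact: cvg_cst.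
    apply/gtr0_cvgV0; first by near=> x.
    apply/cvgryPge => A; have /cvgryPge/(_ A) := powR_cvgy a0.
    by apply: filterS => x /le_trans; apply; rewrite lerDr.
apply: (@le_lt_trans _ _ (\int[leb]_(x in Dy) (K * g x)%:E)%E).
  apply: le_integral_any => x /DyE x0; rewrite lee_fin /gam /g mulrCA.
  rewrite ler_wpM2l ?powR_ge0// -ler_pdivrMr ?invr_gt0 ?exprn_gt0//.
  rewrite invrK.
  have h := @powR_le_exp R (a * 2) x (mulr_gt0 a0 (ltr0Sn _ 1)) x0.
  rewrite expRN mulrC ler_pdivrMr ?expR_gt0//.
  apply: (@le_trans _ _ (2 * (1 + x `^ (a * 2)))).
    rewrite powRrM powR_mulrn ?powR_ge0//; have := sqr_ge0 (1 - x `^ a).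
    by rewrite -subr_ge0 => ?; rewrite -subr_ge0; nra.
  rewrite -mulrA ler_pM2l// mulrDl mul1r lerD//.
  by rewrite -[leLHS]expR0 ler_expR ltW.
rewrite (@integralZ_ge0 _ Dy g K)//.
- by rewrite gE -EFinM ltry.
- by rewrite /g; meas.
- by move=> x _; rewrite /g mulr_ge0 ?powR_ge0// invr_ge0 sqr_ge0.
Unshelve. all: by end_near. Qed.

Lemma mDy : measurable Dy.
Proof. exact: measurable_itv. Qed.

Lemma integral_Gamma a : 0 < a ->
  (\int[leb]_(x in Dy) (x `^ (a - 1) * expR (- x))%:E = (Gamma a)%:E)%E.
Proof.
move=> a0; rewrite /Gamma /Rintegral fineK//.
rewrite ge0_fin_numE; first exact: gam_lty.
by apply: integral_ge0 => x _; rewrite lee_fin; exact: gam_ge0.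
Qed.

Lemma Gamma_gt0 a : 0 < a -> 0 < Gamma a.
Proof.
move=> a0; rewrite -lte_fin -integral_Gamma//.
have lt12 : (1 : R) < 2 by lra.
(* On [1, 2] one has x^(a - 1) >= x^(-1) >= 1/2, because a > 0, and exp (- x) >= exp (- 2). *)
have c0 : 0 < 2^-1 * expR (- 2) :> R by rewrite mulr_gt0 ?expR_gt0// invr_gt0.
apply: (integral_gt0 mDy (mgam a) (fun x _ => gam_ge0 a x) lt12 c0).
move=> x /andP[x1 x2]; split; first by apply/DyE; exact: lt_le_trans x1.
rewrite /gam ler_pM ?invr_ge0 ?expR_ge0//; last by rewrite ler_expR lerN2.
apply: (@le_trans _ _ (x `^ (-1))); last by apply: ler_powR => //; lra.
by rewrite powR_inv1 ?lef_pV2 ?posrE//; lra.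
Qed.

Lemma integral_Gamma_scale a c : 0 < a -> 0 < c ->
  (\int[leb]_(x in Dy) (x `^ (a - 1) * expR (- (c * x)))%:E = (Gamma a * c `^ (- a))%:E)%E.
Proof.
move=> a0 c0.
have := @subst_scale R (gam a) c c0.
have -> : (\int[leb]_(x in Dy) (gam a x)%:E = (Gamma a)%:E)%E by exact: integral_Gamma.
move=> /(_ _ (fun x _ => gam_ge0 a x)) H.
have {H} : (Gamma a)%:E = (\int[leb]_(x in Dy) (c `^ a * (x `^ (a - 1) * expR (- (c * x))))%:E)%E.
  rewrite H; last by move=> x x0; rewrite /gam; dcont.
  apply: eq_integral => x; rewrite inE => /DyE x0; congr EFin.
  rewrite /gam powRM ?ltW// -(@mulr_powRB1 _ c a)// ?ltW//; ring.
rewrite integralZ_ge0 ?powR_ge0//.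
- move=> H.
  have c1 : c `^ a != 0 by rewrite gt_eqF// powR_gt0.
  transitivity ((c `^ (- a))%:E * ((c `^ a)%:E *
    \int[leb]_(x in Dy) (x `^ (a - 1) * expR (- (c * x)))%:E))%E.
    by rewrite muleA -EFinM powRN mulVf// mul1e.
  by rewrite -H -EFinM mulrC.
- by meas.
- by move=> x _; rewrite mulr_ge0 ?powR_ge0 ?expR_ge0.
Qed.

Lemma GammaS a : 0 < a -> Gamma (a + 1) = a * Gamma a.
Proof.
move=> a0.
have := @FTC_diff0y R (fun x => a * gam a x) (gam (a + 1)) (fun x => x `^ a * expR (- x)) 0 0.
have -> : (\int[leb]_(x in Dy) (gam (a + 1) x)%:E = (Gamma (a + 1))%:E)%E.
  by apply: integral_Gamma; rewrite addr_gt0.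
rewrite integralZ_ge0 ?ltW//.
have -> : (\int[leb]_(x in Dy) (gam a x)%:E = (Gamma a)%:E)%E by exact: integral_Gamma.
rewrite !adde0 -EFinM => H; apply/esym/EFin_inj/H => //.
- move=> x x0; der => //; rewrite /gam addrK; ring.
- by move=> x x0; rewrite /gam; dcont.
- by move=> x x0; rewrite mulr_ge0// ltW.
- by move=> x x0; rewrite /gam; dcont.
- eapply cvg_eqr; [apply: cvgM|exact: mul0r].
    exact: powR_cvg0.
  apply: continuous_cvg; first exact: continuous_expR.
  by apply: cvgN; apply: cvg_at_right_filter; exact: cvg_id.
- apply: (@squeeze_cvgr _ _ _ _ (fun=> 0) (fun x => (a + 1) `^ (a + 1) / x)).
  + near=> x; have x0 : 0 < x by near: x; exact: nbhs_pinfty_gt.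
    rewrite mulr_ge0 ?powR_ge0 ?expR_ge0//= expRN ler_pdivrMr ?expR_gt0//.
    rewrite mulrAC ler_pdivlMr// mulrC -[X in X * _](powRr1 (ltW x0)).
    rewrite -powRD; last by rewrite (gt_eqF x0) implybT.
    by rewrite [1 + a]addrC powR_le_exp// addr_gt0.
  + exact: cvg_cst.
  + eapply cvg_eqr; [apply: cvgM; first exact: cvg_cst|exact: mulr0].
    apply/gtr0_cvgV0; last exact: cvg_id.
    by near=> x; near: x; exact: nbhs_pinfty_gt.
Unshelve. all: by end_near. Qed.

(** Gamma (a + b) (A + B r)^(-(a + b)) is a gamma integral in an auxiliary variable y. After
    exchanging the integrals, the one in r is a gamma integral as well. *)
Lemma beta_Gamma a b A B : 0 < a -> 0 < b -> 0 < A -> 0 < B ->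
  (\int[leb]_(r in Dy) (r `^ (a - 1) * (A + B * r) `^ (- (a + b)))%:E =
   (Gamma a * Gamma b / Gamma (a + b) * A `^ (- b) * B `^ (- a))%:E)%E.
Proof.
move=> a0 b0 A0 B0; have ab0 : 0 < a + b by rewrite addr_gt0.
have G0 := Gamma_gt0 ab0.
have ABr r : Dy r -> 0 < A + B * r.
  by move=> /DyE r0; rewrite addr_gt0// mulr_gt0.
pose F r y : R := r `^ (a - 1) * (y `^ (a + b - 1) * expR (- ((A + B * r) * y))).
have E1 : (\int[leb]_(r in Dy) \int[leb]_(y in Dy) (F r y)%:E =
  (Gamma (a + b))%:E * \int[leb]_(r in Dy) (r `^ (a - 1) * (A + B * r) `^ (- (a + b)))%:E)%E.
  rewrite -integralZ_ge0 ?ltW//; first last.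
  - by move=> r _; rewrite mulr_ge0 ?powR_ge0.
  - by meas.
  apply: eq_integral => r; rewrite inE => Dr.
  rewrite integralZ_ge0 ?powR_ge0//; first last.
  - by move=> y _; rewrite mulr_ge0 ?powR_ge0 ?expR_ge0.
  - by meas.
  rewrite integral_Gamma_scale ?ABr// -EFinM; congr EFin.
  by move: (Gamma (a + b)) => gab; ring.
have E2 : (\int[leb]_(r in Dy) \int[leb]_(y in Dy) (F r y)%:E =
   (Gamma a * Gamma b * A `^ (- b) * B `^ (- a))%:E)%E.
  rewrite tonelli_leb//; first last.
  - by move=> x y _ _; rewrite lee_fin /F !mulr_ge0 ?powR_ge0 ?expR_ge0.
  - apply/measurable_EFinP; rewrite /F.
    by meas.
  transitivity (\int[leb]_(y in Dy) ((Gamma a * B `^ (- a)) * (y `^ (b - 1) * expR (- (A * y))))%:E)%E.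
    apply: eq_integral => y; rewrite inE => /DyE y0.
    transitivity (\int[leb]_(r in Dy) ((y `^ (a + b - 1) * expR (- (A * y))) *
       (r `^ (a - 1) * expR (- ((B * y) * r))))%:E)%E.
      apply: eq_integral => r _; congr EFin; rewrite /F.
      rewrite (_ : - ((A + B * r) * y) = - (A * y) + - ((B * y) * r)); last by ring.
      rewrite expRD; ring.
    rewrite integralZ_ge0; first last.
    - by rewrite mulr_ge0 ?powR_ge0 ?expR_ge0.
    - by move=> r _; rewrite mulr_ge0 ?powR_ge0 ?expR_ge0.
    - by meas.
    - exact: mDy.
    rewrite integral_Gamma_scale ?mulr_gt0// -EFinM; congr EFin.
    rewrite powRM ?ltW// [y `^ (a + b - 1)](_ : _ = y `^ (b - 1) * y `^ a); last first.
      by rewrite -powRD; [congr (_ `^ _); ring|rewrite (gt_eqF y0) implybT].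
    rewrite [y `^ (- a)]powRN; field; rewrite gt_eqF// powR_gt0//.
  rewrite integralZ_ge0; first last.
  - exact: mulr_ge0 (ltW (Gamma_gt0 a0)) (powR_ge0 _ _).
  - by move=> r _; rewrite mulr_ge0 ?powR_ge0 ?expR_ge0.
  - by meas.
  - exact: mDy.
  rewrite integral_Gamma_scale// -EFinM; congr EFin.
  by move: (Gamma a) (Gamma b) => ga gb; ring.
transitivity ((Gamma (a + b))^-1%:E * ((Gamma (a + b))%:E *
   \int[leb]_(r in Dy) (r `^ (a - 1) * (A + B * r) `^ (- (a + b)))%:E))%E.
  by rewrite muleA -EFinM mulVf ?gt_eqF// mul1e.
rewrite -E1 E2 -EFinM; congr EFin.
by move: (Gamma a) (Gamma b) (Gamma (a + b)) => ga gb gab; ring.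
Qed.

End GammaFunction.

(** * The one-dimensional inequality *)

Section OneDimIneq.
Context {R : realType}.
Notation leb := (@lebesgue_measure R).
Notation D1 := (`]0%R, 1%R[%classic : set R).
Implicit Types (a b c x p m : R).

Lemma D1E p : D1 p <-> 0 < p < 1.
Proof. by rewrite /= in_itv. Qed.

Lemma mD1 : measurable D1.
Proof. exact: measurable_itv. Qed.

(** With m = eta |mu|^2 this is E exp (- eta (1 - p) / (2 p) |y|^2) for y normal with mean mu and
    covariance eta^(-1) I: the Laplace transform of one squared norm, with its argument ranging over
    the half-line as p ranges over (0, 1). *)
Definition gg (d : nat) m p : R := p `^ (d%:R / 2) * expR (- (m * (1 - p) / 2)).

Lemma mgg d m : measurable_fun setT (gg d m).
Proof. by rewrite /gg; meas. Qed.

Lemma gg_gt0 d m p : 0 < p -> 0 < gg d m p.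
Proof. by move=> p0; rewrite mulr_gt0 ?powR_gt0 ?expR_gt0. Qed.

Lemma ln_gg d m p : 0 < p -> ln (gg d m p) = d%:R / 2 * ln p - m * (1 - p) / 2.
Proof.
by move=> p0; rewrite lnM ?posrE ?powR_gt0 ?expR_gt0// ln_powR expRK.
Qed.

Lemma powRB1 p c : 0 < p -> p `^ (c - 1) = p `^ c / p.
Proof. by move=> p0; rewrite powRB ?(gt_eqF p0) ?implybT// powRr1// ltW. Qed.

Lemma der_gg d m p : 0 < p ->
  is_derive p 1 (gg d m) (gg d m p * ((d%:R / p + m) / 2)).
Proof.
move=> p0; rewrite /gg; der => //.
by rewrite powRB1//; field; rewrite gt_eqF.
Qed.

(** Monotonicity of (exp x - 1) / x, cross-multiplied so as to include 0. It follows from two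
    tangent-line bounds, exp (y - x) >= 1 + (y - x) and exp (- x) >= 1 - x. *)
Lemma exp_slope x y : 0 <= x <= y -> (expR x - 1) * y <= (expR y - 1) * x.
Proof.
move=> /andP[x0 xy].
have h1 : expR x * (1 + (y - x)) <= expR y.
  by rewrite -[in leRHS](subrKC x y) expRD ler_pM2l ?expR_gt0// expR_ge1Dx.
have h2 : expR x * (1 - x) <= 1.
  have := expR_ge1Dx (- x); rewrite -(ler_pM2l (expR_gt0 x)) => /le_trans; apply.
  by rewrite -expRD subrr expR0.
nra.
Qed.

Lemma ln_ge x : 0 < x -> 1 - x^-1 <= ln x.
Proof.
move=> x0; have := @le_ln1Dx R (x^-1 - 1); rewrite subrKC lnV ?posrE//.
have : 0 < x^-1 by rewrite invr_gt0.
move: (x^-1) => t t0 /(_ _) h; have : - ln x <= t - 1 by apply: h; lra.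
lra.
Qed.

Lemma ln_le x : 0 < x -> ln x <= x - 1.
Proof.
move=> x0; have := @le_ln1Dx R (x - 1); rewrite subrKC; apply; lra.
Qed.

Lemma gg_lt1 d m p : (0 < d)%N -> 0 <= m -> 0 < p < 1 -> ln (gg d m p) < 0.
Proof.
move=> d0 m0 /andP[p0 p1]; rewrite ln_gg//.
have : d%:R / 2 * ln p < 0 by rewrite pmulr_rlt0 ?divr_gt0 ?ltr0n// ln_lt0// p0.
have : 0 <= m * (1 - p) / 2 by rewrite !mulr_ge0// subr_ge0 ltW.
lra.
Qed.

(* The value of int_2^3 g^k dk. *)
Definition powmean d m p : R := (gg d m p ^+ 2 - gg d m p ^+ 3) / (- ln (gg d m p)).

Lemma integral_powR_itv23 d m p : (0 < d)%N -> 0 <= m -> 0 < p < 1 ->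
  (\int[leb]_(k in `[2%R, 3%R]) (gg d m p `^ k)%:E = (powmean d m p)%:E)%E.
Proof.
move=> d0 m0 p01; have /andP[p0 p1] := p01.
have g0 := gg_gt0 d m p0; have l0 := gg_lt1 d0 m0 p01.
have dk (k : R) : is_derive k 1 (fun k => gg d m p `^ k / ln (gg d m p)) (gg d m p `^ k).
  apply: der_eq; first exact: (derM (der_powx k g0) (der_cst (ln (gg d m p))^-1 k)).
  by rewrite /=; field; rewrite lt_eqF.
have lt23 : (2 : R) < 3 by lra.
rewrite (@continuous_FTC2 _ _ (fun k => gg d m p `^ k / ln (gg d m p)) _ _ lt23).
- rewrite -EFinB; congr EFin; rewrite /powmean !powR_mulrn ?ltW//.
  by field; rewrite lt_eqF.
- apply: continuous_in_subspaceT => k _.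
  exact: (der_continuous (der_powx k g0)).
- split.
  + by move=> k _; exact: (der_derivable (dk k)).
  + by apply: cvg_at_right_filter; exact: (der_continuous (dk 2)).
  + by apply: cvg_at_left_filter; exact: (der_continuous (dk 3)).
- by move=> k _; exact: (der_val (dk k)).
Qed.

Lemma powmean_ge0 d m p : (0 < d)%N -> 0 <= m -> 0 < p < 1 -> 0 <= powmean d m p.
Proof.
move=> d0 m0 p01; rewrite -lee_fin -integral_powR_itv23//; apply: integral_ge0 => k _.
by rewrite lee_fin powR_ge0.
Qed.

Lemma powmean_le d m p : (0 < d)%N -> 0 <= m -> 0 < p < 1 -> powmean d m p <= gg d m p ^+ 2.
Proof.
move=> d0 m0 p01; have /andP[p0 p1] := p01.
have g0 := gg_gt0 d m p0; have l0 := gg_lt1 d0 m0 p01.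
rewrite /powmean ler_pdivrMr ?oppr_gt0//.
have := @ln_le (gg d m p) g0.
rewrite (_ : _ ^+ 2 - _ = gg d m p ^+ 2 * (1 - gg d m p)); last by ring.
rewrite ler_pM2l ?exprn_gt0//; lra.
Qed.

Lemma gg_powk d m p k : gg d m p `^ k =
  p `^ (d%:R / 2 * k) * expR (- (m * (1 - p) / 2) * k).
Proof. by rewrite /gg powRM ?powR_ge0 ?expR_ge0// -powRrM expRM. Qed.

(** The weight is g' / g, so g^k / k is a primitive; it runs from 0 at p = 0 to 1 / k at p = 1,
    whatever [m] is. *)
Lemma integral_gg_dlog d m k : (0 < d)%N -> 0 <= m -> 0 < k ->
  (\int[leb]_(p in D1) (gg d m p `^ k * ((d%:R / p + m) / 2))%:E = (k^-1)%:E)%E.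
Proof.
move=> d0 m0 k0.
rewrite -[in RHS](subr0 k^-1).
apply: (@FTC01 _ (fun p => gg d m p `^ k * ((d%:R / p + m) / 2))
  (fun p => gg d m p `^ k / k) 0 k^-1).
- move=> p /andP[p0 p1]; have g0 := gg_gt0 d m p0; have h := der_gg d m p0.
  by der => //; rewrite powRB1//; field; rewrite !gt_eqF.
- move=> p /andP[p0 p1]; have g0 := gg_gt0 d m p0; have h := der_gg d m p0.
  by dcont => //; rewrite gt_eqF.
- move=> p /andP[p0 p1]; rewrite mulr_ge0 ?powR_ge0// divr_ge0// addr_ge0//.
  by rewrite divr_ge0// ltW.
- under eq_fun do rewrite gg_powk.
  eapply cvg_eqr; [apply: cvgM; [apply: cvgM|exact: cvg_cst]|].
  + by apply: powR_cvg0; rewrite !mulr_gt0 ?ltr0n ?invr_gt0.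
  + have h : {for 0, continuous (fun p : R => expR (- (m * (1 - p) / 2) * k))} by dcont.
    exact: (cvg_at_right_filter h).
  + by rewrite !mul0r.
- have g1 := gg_gt0 d m ltr01; have h := der_gg d m ltr01.
  have c : {for 1, continuous (fun p : R => gg d m p `^ k / k)} by dcont.
  eapply cvg_eqr; first exact: (cvg_at_left_filter c).
  by rewrite /gg powR1 subrr mulr0 mul0r oppr0 expR0 mulr1 powR1 mul1r.
Qed.

Lemma integral_inv a b : 0 < a -> a < b ->
  (\int[leb]_(k in `[a, b]) (k^-1)%:E = (ln b - ln a)%:E)%E.
Proof.
move=> a0 ab.
have dk (k : R) : 0 < k -> is_derive k 1 (@ln R) k^-1 by exact: is_derive1_ln.
have b0 : 0 < b by exact: lt_trans ab.
have Dk (k : R) : k \in `]a, b[ -> 0 < k.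
  by rewrite in_itv/= => /andP[ak _]; exact: lt_trans ak.
rewrite (@continuous_FTC2 _ _ (@ln R) _ _ ab).
- by rewrite -EFinB.
- apply: continuous_in_subspaceT => k; rewrite inE/= in_itv/= => /andP[ak _].
  by apply: cvgV; [rewrite gt_eqF//; exact: lt_le_trans ak|exact: cvg_id].
- split.
  + by move=> k /Dk/dk; exact: der_derivable.
  + by apply: cvg_at_right_filter; exact: (der_continuous (dk _ a0)).
  + by apply: cvg_at_left_filter; exact: (der_continuous (dk _ b0)).
- by move=> k /Dk/dk; exact: der_val.
Qed.

Lemma integral_powmean d m : (0 < d)%N -> 0 <= m ->
  (\int[leb]_(p in D1) (powmean d m p * ((d%:R / p + m) / 2))%:E = (ln (3 / 2))%:E)%E.
Proof.
move=> d0 m0.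
have w0 p : 0 < p -> 0 <= (d%:R / p + m) / 2.
  by move=> p0; rewrite divr_ge0// addr_ge0// divr_ge0// ltW.
(* Written as an exponential rather than with [powR], because joint measurability in p and the
   exponent k is needed and [meas] handles powers with constant exponent only. *)
pose F p k : R := expR (k * ln (gg d m p)) * ((d%:R / p + m) / 2).
have FE p k : 0 < p -> F p k = gg d m p `^ k * ((d%:R / p + m) / 2).
  by move=> p0; rewrite /F /powR (gt_eqF (gg_gt0 _ _ p0)).
have m23 : measurable (`[2%R, 3%R]%classic : set R) by exact: measurable_itv.
transitivity (\int[leb]_(p in D1) \int[leb]_(k in `[2%R, 3%R]) (F p k)%:E)%E.
  apply: eq_integral => p; rewrite inE => /D1E p01; have /andP[p0 p1] := p01.
  under [RHS]eq_integral do rewrite FE// mulrC.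
  rewrite integralZ_ge0 ?w0//.
  - by rewrite integral_powR_itv23// -EFinM mulrC.
  - exact: measurable_powRr.
  - by move=> k _; exact: powR_ge0.
rewrite tonelli_leb//; first last.
- move=> p k /D1E/andP[p0 p1] _; rewrite lee_fin mulr_ge0 ?expR_ge0// w0//.
- apply/measurable_EFinP; rewrite /F /=.
  by rewrite /gg; meas.
have lt23 : (2 : R) < 3 by lra.
rewrite (ln_div (x := 3) (y := 2)) ?posrE// -integral_inv//; apply: eq_integral => k; rewrite inE/= in_itv/= => /andP[k2 k3].
rewrite -(@integral_gg_dlog d m)//; last by lra.
by apply: eq_integral => p; rewrite inE => /D1E/andP[p0 _]; rewrite FE.
Qed.

(* What is left of (g^2 - g^3) / (p (1 - p)) once g' / g has been split off
   from - ln g / (p (1 - p)). *)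
Definition log_rem (d : nat) m p : R := gg d m p ^+ 2 *
  ((d%:R * (- ln p - (1 - p)) + m * (1 - p) ^+ 2) / (2 * (p * (1 - p)))).

Lemma log_rem_ge0 d m p : 0 <= m -> 0 < p < 1 -> 0 <= log_rem d m p.
Proof.
move=> m0 /andP[p0 p1]; rewrite mulr_ge0 ?sqr_ge0// divr_ge0//; last first.
  by rewrite !mulr_ge0// ?subr_ge0 ltW.
rewrite addr_ge0// mulr_ge0 ?sqr_ge0//.
by have := ln_le p0; lra.
Qed.

(** The quantity [N] is - ln g / (p (1 - p)) minus g' / g. It is nonnegative since - ln p >= 1 - p,
    which permits replacing [powmean] by its upper bound g^2 in the product with [N]. *)
Lemma log_term_le d m p : (0 < d)%N -> 0 <= m -> 0 < p < 1 ->
  (gg d m p ^+ 2 - gg d m p ^+ 3) / (p * (1 - p)) <=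
  powmean d m p * ((d%:R / p + m) / 2) + log_rem d m p.
Proof.
move=> d0 m0 p01; have /andP[p0 p1] := p01.
have q0 : 0 < 1 - p by rewrite subr_gt0.
have l0 := gg_lt1 d0 m0 p01.
set N := (d%:R * (- ln p - (1 - p)) + m * (1 - p) ^+ 2) / (2 * (p * (1 - p))).
have N0 : 0 <= N.
  rewrite divr_ge0//; last by rewrite !mulr_ge0// ltW.
  rewrite addr_ge0// mulr_ge0 ?sqr_ge0//; have := ln_le p0; lra.
have -> : (gg d m p ^+ 2 - gg d m p ^+ 3) / (p * (1 - p)) =
    powmean d m p * ((d%:R / p + m) / 2) + powmean d m p * N.
  have -> : gg d m p ^+ 2 - gg d m p ^+ 3 = powmean d m p * - ln (gg d m p).
    by rewrite /powmean divfK// oppr_eq0 lt_eqF.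
  by rewrite ln_gg// /N; field; rewrite !gt_eqF.
by rewrite lerD2l /log_rem ler_wpM2r// powmean_le.
Qed.

Lemma integral_log_le_remainder d m : (0 < d)%N -> 0 <= m ->
  (\int[leb]_(p in D1) ((gg d m p ^+ 2 - gg d m p ^+ 3) / (p * (1 - p)))%:E <=
   (ln (3 / 2))%:E + \int[leb]_(p in D1) (log_rem d m p)%:E)%E.
Proof.
move=> d0 m0; rewrite -(integral_powmean d0 m0) -integralD_ge0.
- by apply: le_integral_any => p /D1E p01; rewrite lee_fin log_term_le.
- exact: mD1.
- by rewrite /powmean /gg; meas.
- by rewrite /log_rem /gg; meas.
- move=> p /D1E p01; have /andP[p0 p1] := p01.
  by rewrite mulr_ge0 ?powmean_ge0// divr_ge0// addr_ge0// divr_ge0// ltW.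
- by move=> p /D1E; exact: log_rem_ge0.
Qed.

Lemma gg2E d m p : 0 <= p -> gg d m p ^+ 2 = p ^+ d * expR (- (m * (1 - p))).
Proof.
move=> p0; rewrite /gg exprMn -(@powR_mulrn _ (p `^ _)) ?powR_ge0// -powRrM.
rewrite mulfVK// powR_mulrn// -expRM_natr; congr (_ * expR _); by field.
Qed.

Lemma ggE d m p : 0 <= p -> gg d m p = Num.sqrt p ^+ d * expR (- (m * (1 - p) / 2)).
Proof.
by move=> p0; rewrite /gg mulrC [_ / 2]mulrC powRrM powR12_sqrt// powR_mulrn// mulrC.
Qed.

Lemma gg3E d m p : 0 <= p ->
  gg d m p ^+ 3 = Num.sqrt p ^+ (d * 3) * expR (- (3 / 2 * m * (1 - p))).
Proof.
move=> p0; rewrite ggE// exprMn -exprM -expRM_natr; congr (_ * expR _); by field.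
Qed.

Lemma integral_closed01 (G : R -> R) : measurable_fun setT G ->
  (\int[leb]_(p in D1) (G p)%:E = \int[leb]_(p in `[0%R, 1%R]) (G p)%:E)%E.
Proof.
move=> mG; rewrite -integral_itv_obnd_cbnd; last first.
  by apply/measurable_EFinP; exact: measurable_funS mG.
rewrite -integral_itv_bndo_bndc//.
by apply/measurable_EFinP; exact: measurable_funS mG.
Qed.

(** With p = (3/2) x - 1/2 one has 1 - p = (3/2) (1 - x): the exponential of g^2 at p becomes that
    of g^3 at x, so integrals of the two kinds can be compared pointwise. The range [0, 1/3] of x
    stays free and is later discarded by positivity. *)
Lemma subst_affine01 (G : R -> R) : continuous G ->
  (\int[leb]_(p in D1) (G p)%:E =
   \int[leb]_(x in `[(3^-1)%R, 1%R]) (G (3 / 2 * x - 1 / 2) * (3 / 2))%:E)%E.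
Proof.
move=> cG; rewrite integral_closed01; last exact: continuous_measurable_fun.
pose F (x : R) : R := 3 / 2 * x - 1 / 2.
have dF x : is_derive x 1 F (3 / 2) by rewrite /F; der; field.
have F'E : F^`()%classic = cst (3 / 2).
  by apply/funext => x; exact: (der_val (dF x)).
have F0 : F 3^-1 = 0 by rewrite /F; field.
have F1 : F 1 = 1 by rewrite /F; field.
rewrite -[X in `[X, _]]F0 -[X in `[_, X]]F1.
rewrite (@integration_by_substitution_increasing R F G 3^-1 1).
- by apply: eq_integral => x _; rewrite /GRing.mul/= F'E.
- lra.
- by move=> x y _ _ xy; rewrite /F; lra.
- by rewrite F'E => x _; exact: cvg_cst.
- by rewrite F'E; exact: is_cvg_cst.
- by rewrite F'E; exact: is_cvg_cst.
- split.
  + by move=> x _; exact: (der_derivable (dF x)).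
  + by apply: cvg_at_right_filter; exact: (der_continuous (dF _)).
  + by apply: cvg_at_left_filter; exact: (der_continuous (dF _)).
- by apply: continuous_subspaceT.
Qed.

(** For x = exp t this reads t <= sinh t. The difference of the two sides has derivative (1 - 1/x)^2
    / 2. *)
Lemma ln_le_sinh x : 1 <= x -> ln x <= (x - x^-1) / 2.
Proof.
rewrite le_eqVlt => /predU1P[<-|x1]; first by rewrite ln1 invr1 subrr mul0r.
pose f (y : R) : R := (y - y^-1) / 2 - ln y.
pose f' (y : R) : R := (1 - y^-1) ^+ 2 / 2.
have df (y : R) : 0 < y -> is_derive y 1 f (f' y).
  move=> y0; rewrite /f; der; rewrite ?gt_eqF//.
  by rewrite /f'; field; rewrite gt_eqF.
have pos (z : R) : z \in `[1, x] -> 0 < z by rewrite in_itv/= => /andP[z1 _]; lra.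
have [c _ E] := @MVT R f f' 1 x x1 (fun z zi => df z (pos z (subset_itv_oo_cc zi)))
   (derivable_within_continuous (fun z zi => der_derivable (df z (pos z zi)))).
have : 0 <= f x - f 1 by rewrite E mulr_ge0 ?subr_ge0 ?(ltW x1)// mulr_ge0 ?sqr_ge0.
by rewrite {2}/f ln1 invr1 !subrr mul0r subr0 subr0 /f subr_ge0.
Qed.

(** [ln_le_sinh] gives - ln p - (1 - p) <= (1 - p)^2 / (2 p), and (k + 2) / 2 <= k + 1 then bounds
    [log_rem] by [f1]. As [f1 - f2] is the derivative of [F], which vanishes at both ends, the
    unbounded factor m disappears. The vanishing at 0 uses the power p^(k + 1), that is d >= 2. *)
Lemma integral_log_rem_ge2 k m : 0 <= m ->
  (\int[leb]_(p in D1) (log_rem k.+2 m p)%:E <=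
   \int[leb]_(p in D1) (1 / 2 * (p ^+ k.+1 * expR (- (m * (1 - p)))))%:E)%E.
Proof.
move=> m0.
pose f1 p : R := 1 / 2 * (expR (- (m * (1 - p))) *
  (k.+1%:R * p ^+ k * (1 - p) + m * (p ^+ k.+1 * (1 - p)))).
pose f2 p : R := 1 / 2 * (p ^+ k.+1 * expR (- (m * (1 - p)))).
pose F p : R := 1 / 2 * (p ^+ k.+1 * ((1 - p) * expR (- (m * (1 - p))))).
have cF p : {for p, continuous F} by rewrite /F; dcont.
have E : (\int[leb]_(p in D1) (f1 p)%:E = \int[leb]_(p in D1) (f2 p)%:E)%E.
  have := @FTC_diff01 R f1 f2 F 0 0; rewrite !adde0; apply.
  - move=> p _; rewrite /F /f1 /f2; der.
    rewrite [p ^+ k.+1]exprS; ring.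
  - by move=> p _; rewrite /f1; dcont.
  - move=> p /andP[p0 p1]; rewrite /f1.
    by rewrite !mulr_ge0 ?expR_ge0// addr_ge0// !mulr_ge0// ?exprn_ge0 ?subr_ge0// ltW.
  - by move=> p _; rewrite /f2; dcont.
  - by move=> p /andP[p0 p1]; rewrite /f2 !mulr_ge0 ?expR_ge0// exprn_ge0// ltW.
  - eapply cvg_eqr; first exact: (cvg_at_right_filter (cF 0)).
    by rewrite /F expr0n/= mul0r mulr0.
  - eapply cvg_eqr; first exact: (cvg_at_left_filter (cF 1)).
    by rewrite /F subrr mul0r !mulr0.
rewrite -/f2 -E; apply: le_integral_any => p /D1E/andP[p0 p1]; rewrite lee_fin.
have q0 : 0 < 1 - p by rewrite subr_gt0.
have h : - ln p - (1 - p) <= (1 - p) ^+ 2 / (2 * p).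
  have p1' : 1 <= p^-1 by rewrite invf_ge1// ltW.
  have := ln_le_sinh p1'; rewrite lnV ?posrE// invrK => h.
  rewrite [leRHS](_ : _ = (p^-1 - p) / 2 - (1 - p)); first by rewrite lerD2r.
  by field; rewrite gt_eqF.
rewrite /log_rem /f1 (gg2E _ _ (ltW p0)).
move: (expR_gt0 (- (m * (1 - p)))); move: (expR _) => e e0.
rewrite [leRHS]mulrCA [_ * e]mulrC -[leLHS]mulrA (ler_pM2l e0).
apply: (@le_trans _ _ (p ^+ k.+2 * ((k.+2%:R * ((1 - p) ^+ 2 / (2 * p)) + m * (1 - p) ^+ 2) /
   (2 * (p * (1 - p)))))).
  rewrite ler_pM2l ?exprn_gt0// ler_pM2r ?invr_gt0 ?mulr_gt0//.
  by rewrite lerD2r ler_pM2l ?ltr0n.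
rewrite (_ : p ^+ _ * _ = 1 / 2 * (k.+2%:R / 2 * p ^+ k * (1 - p) + m * (p ^+ k.+1 * (1 - p)))); last first.
  by rewrite !exprS; field; rewrite !gt_eqF.
rewrite ler_pM2l// lerD2r ler_pM2r// ler_pM2r ?exprn_gt0//.
rewrite -natr1 -[X in _ <= X]natr1.
have : (0 : R) <= k%:R by [].
by rewrite -[k.+1%:R]natr1; move: (k%:R) => t; lra.
Qed.

(** After the affine substitution the exponentials agree on [1/3, 1], and a polynomial inequality in
    sqrt x remains. *)
Lemma integral_pow_exp_le_gg3 k m : 0 <= m ->
  (\int[leb]_(p in D1) (1 / 2 * (p ^+ k.+1 * expR (- (m * (1 - p)))))%:E <=
   (27 / 32)%:E * \int[leb]_(p in D1) (gg k.+2 m p ^+ 3 / p)%:E)%E.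
Proof.
move=> m0.
have c0 : 0 <= 27 / 32 :> R by lra.
rewrite -integralZ_ge0//; last 2 first.
- by rewrite /gg; meas.
- by move=> p /D1E/andP[p0 _]; rewrite divr_ge0 ?exprn_ge0// ltW// gg_gt0.
rewrite (@subst_affine01 (fun p => 1 / 2 * (p ^+ k.+1 * expR (- (m * (1 - p)))))); last by move=> p; dcont.
rewrite [leRHS]integral_closed01; last by rewrite /gg; meas.
apply: (@le_trans _ _ (\int[leb]_(x in `[(3^-1)%R, 1%R]) (27 / 32 * (gg k.+2 m x ^+ 3 / x))%:E)%E).
  apply: le_integral_any => x /=; rewrite in_itv/= => /andP[x3 x1]; rewrite lee_fin.
  have x0 : 0 < x by lra.
  rewrite (gg3E _ _ (ltW x0)).
  have -> : - (m * (1 - (3 / 2 * x - 1 / 2))) = - (3 / 2 * m * (1 - x)) by field.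
  rewrite (_ : 1 / 2 * _ * _ = 3 / 4 * (3 / 2 * x - 1 / 2) ^+ k.+1 * expR (- (3 / 2 * m * (1 - x)))); last by field.
  rewrite [leRHS](_ : _ = 27 / 32 * (Num.sqrt x ^+ (k.+2 * 3) / x) * expR (- (3 / 2 * m * (1 - x)))); last by ring.
  rewrite ler_pM2r ?expR_gt0//.
  have := sqr_sqrtr (ltW x0); have : 0 < Num.sqrt x by rewrite sqrtr_gt0.
  move: (Num.sqrt x) => t t0 tx; rewrite -tx.
  have -> : t ^+ (k.+2 * 3) / t ^+ 2 = t ^+ 4 * (t ^+ 3) ^+ k.
    rewrite mulnC -exprM -(addn2 k) mulnDr exprD mulrAC -mulrA [RHS]mulrC; congr (_ * _).
    by field; rewrite gt_eqF.
  (* Here t^4 (t^3)^k has to dominate k + 1 equal factors: one takes the quartic bound, from (3 t^2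
     - 2)^2 >= 0, and k take the cubic bound, from (t - 1)^2 (t + 1/2) >= 0. The constant is 27/32 =
     (3/4) (9/8). *)
  have h1 : 3 / 2 * t ^+ 2 - 1 / 2 <= t ^+ 3.
    have := mulr_ge0 (sqr_ge0 (t - 1)) (_ : 0 <= t + 1 / 2) => /(_ _); nra.
  have h2 : 3 / 2 * t ^+ 2 - 1 / 2 <= 9 / 8 * t ^+ 4.
    have := sqr_ge0 (3 * t ^+ 2 - 2); nra.
  have h0 : 0 <= 3 / 2 * t ^+ 2 - 1 / 2 by rewrite tx; lra.
  rewrite (_ : 27 / 32 * _ = 3 / 4 * (9 / 8 * t ^+ 4 * (t ^+ 3) ^+ k)); last by field.
  rewrite ler_pM2l// exprS ler_pM ?exprn_ge0// lerXn2r ?nnegrE ?exprn_ge0// ltW//.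
apply: ge0_subset_integral => //.
- by apply/measurable_EFinP; apply: measurable_funS; [| |rewrite /gg; meas].
- move=> x /=; rewrite in_itv/= => /andP[x0 _]; rewrite lee_fin.
  by rewrite mulr_ge0// divr_ge0// exprn_ge0// mulr_ge0 ?powR_ge0 ?expR_ge0.
- by move=> x /=; rewrite !in_itv/= => /andP[? ->]; rewrite andbT; lra.
Qed.

Lemma integral_powR01 (c : R) : 0 < c + 1 ->
  (\int[leb]_(p in D1) (p `^ c)%:E = ((c + 1)^-1)%:E)%E.
Proof.
move=> c0; rewrite -[in RHS](subr0 (c + 1)^-1).
apply: (@FTC01 _ (fun p => p `^ c) (fun p => (c + 1)^-1 * p `^ (c + 1))).
- move=> p /andP[p0 _]; der => //; rewrite addrK; field; rewrite gt_eqF//.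
- by move=> p /andP[p0 _]; dcont.
- by move=> p _; exact: powR_ge0.
- by eapply cvg_eqr; [apply: cvgM; [exact: cvg_cst|exact: powR_cvg0]|rewrite mulr0].
- have c1 : {for 1, continuous (fun p : R => (c + 1)^-1 * p `^ (c + 1))} by dcont.
  eapply cvg_eqr; first exact: (cvg_at_left_filter c1).
  by rewrite powR1 mulr1.
Qed.

(** [ln_le_sinh] at 1 / sqrt p, doubled. Near 0 it grows like p^(-1/2) instead of p^(-1), which
    keeps the remainder integrable when d = 1. *)
Lemma neg_ln_le p : 0 < p -> p < 1 -> - ln p <= (1 - p) / Num.sqrt p.
Proof.
move=> p0 p1; have s0 : 0 < Num.sqrt p by rewrite sqrtr_gt0.
have s1 : 1 <= (Num.sqrt p)^-1 by rewrite invf_ge1// -sqrtr1 ler_wsqrtr// ltW.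
have := ln_le_sinh s1; rewrite lnV ?posrE// invrK.
have -> : ln p = ln (Num.sqrt p) + ln (Num.sqrt p).
  by rewrite -lnM// -expr2 sqr_sqrtr// ltW.
have -> : (1 - p) / Num.sqrt p = (Num.sqrt p)^-1 - Num.sqrt p.
  rewrite mulrBl mul1r -[X in X / _](sqr_sqrtr (ltW p0)) expr2.
  by rewrite mulfK// gt_eqF.
lra.
Qed.

(** Same integration by parts as for d >= 2, but [F] no longer vanishes at 0. Its boundary value exp
    (- m) / 2 stays on the left, where it later outweighs the exp (- m) / 3 of
    [integral_sqrtV_exp_le]. *)
Lemma integral_log_rem_1 m : 0 <= m ->
  (\int[leb]_(p in D1) (log_rem 1 m p)%:E + (1 / 2 * expR (- m))%:E <=
   \int[leb]_(p in D1) (1 / 2 * (p `^ (- (1 / 2)) * expR (- (m * (1 - p)))))%:E)%E.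
Proof.
move=> m0.
pose e p : R := expR (- (m * (1 - p))).
pose f1 p : R := 1 / 2 * (m * ((1 - p) * e p)).
pose f2 p : R := 1 / 2 * e p.
pose F p : R := 1 / 2 * ((1 - p) * e p).
pose h p : R := 1 / 2 * (p `^ (- (1 / 2)) * e p).
have e0 p : 0 <= e p by exact: expR_ge0.
have cF p : {for p, continuous F} by rewrite /F /e; dcont.
have f10 p : D1 p -> 0 <= f1 p.
  by move=> /D1E/andP[p0 p1]; rewrite /f1 !mulr_ge0// subr_ge0 ltW.
have f20 p : D1 p -> 0 <= f2 p by move=> _; rewrite /f2 mulr_ge0.
have h0 p : D1 p -> 0 <= h p by move=> _; rewrite /h !mulr_ge0// powR_ge0.
have R0 p : D1 p -> 0 <= log_rem 1 m p by move=> /D1E; exact: log_rem_ge0.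
have me : measurable_fun setT e by rewrite /e; meas.
have mf1 : measurable_fun setT f1 by rewrite /f1; meas.
have mf2 : measurable_fun setT f2 by rewrite /f2; meas.
have mh : measurable_fun setT h by rewrite /h; meas.
have mR : measurable_fun setT (log_rem 1 m) by rewrite /log_rem /gg; meas.
have E : (\int[leb]_(p in D1) (f1 p)%:E + (1 / 2 * expR (- m))%:E =
          \int[leb]_(p in D1) (f2 p)%:E)%E.
  have := @FTC_diff01 R f1 f2 F (1 / 2 * expR (- m)) 0; rewrite adde0; apply.
  - by move=> p _; rewrite /F /f1 /f2 /e; der; ring.
  - by move=> p _; rewrite /f1 /e; dcont.
  - by move=> p /D1E; exact: f10.
  - by move=> p _; rewrite /f2 /e; dcont.
  - by move=> p /D1E; exact: f20.
  - eapply cvg_eqr; first exact: (cvg_at_right_filter (cF 0)).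
    by rewrite /F /e !subr0 mulr1 !mul1r.
  - eapply cvg_eqr; first exact: (cvg_at_left_filter (cF 1)).
    by rewrite /F subrr mul0r !mulr0.
(* Finiteness is needed to cancel this integral in the extended reals at the end. *)
have f1fin : (\int[leb]_(p in D1) (f1 p)%:E \is a fin_num)%E.
  rewrite ge0_fin_numE; last by apply: integral_ge0 => p /f10; rewrite lee_fin.
  apply: (@le_lt_trans _ _ (\int[leb]_(p in D1) m%:E)%E).
    apply: le_integral_any => p /D1E/andP[p0 p1]; rewrite lee_fin /f1.
    have e1 : e p <= 1 by rewrite -expR0 ler_expR oppr_le0 mulr_ge0// subr_ge0 ltW.
    have : m * ((1 - p) * e p) <= m * 1.
      by rewrite ler_wpM2l// mulr_ile1// ?subr_ge0 ?(ltW p1)//; lra.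
    have : 0 <= m * ((1 - p) * e p) by rewrite !mulr_ge0// subr_ge0 ltW.
    lra.
  by rewrite integral_cst//= lebesgue_measure_itv/= lte01 oppr0 adde0 mule1 ltry.
have H : (\int[leb]_(p in D1) (log_rem 1 m p)%:E + \int[leb]_(p in D1) (f2 p)%:E <=
   \int[leb]_(p in D1) (h p)%:E + \int[leb]_(p in D1) (f1 p)%:E)%E.
  rewrite -!integralD_ge0//.
  apply: le_integral_any => p /D1E/andP[p0 p1]; rewrite lee_fin.
  have q0 : 0 < 1 - p by rewrite subr_gt0.
  have s0 : 0 < Num.sqrt p by rewrite sqrtr_gt0.
  have lnp := neg_ln_le p0 p1.
  rewrite /log_rem gg2E ?(ltW p0)// /f2 /h /f1 -/(e p).
  rewrite [p `^ _]powRN [1 / 2]mul1r powR12_sqrt ?(ltW p0)//.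
  have -> : p ^+ 1 * e p * ((1%:R * (- ln p - (1 - p)) + m * (1 - p) ^+ 2) / (2 * (p * (1 - p)))) +
      2^-1 * e p = 2^-1 * e p * (- ln p / (1 - p) + m * (1 - p)).
    by field; rewrite !gt_eqF.
  rewrite [leRHS](_ : _ = 2^-1 * e p * ((Num.sqrt p)^-1 + m * (1 - p))); last by ring.
  rewrite ler_pM2l ?mulr_gt0 ?expR_gt0// lerD2r ler_pdivrMr// mulrC.
  exact: lnp.
rewrite -(@leeD2rE _ (\int[leb]_(p in D1) (f1 p)%:E))//; apply: le_trans H.
by rewrite -E [X in (_ <= _ + X)%E]addeC addeA.
Qed.

Lemma half_powR p : 0 < p -> p `^ (1 / 2) = Num.sqrt p.
Proof. by move=> p0; rewrite mul1r powR12_sqrt// ltW. Qed.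

Lemma exp_slopeM m p p0 : 0 <= m -> 0 <= p <= p0 ->
  (expR (m * p) - 1) * p0 <= (expR (m * p0) - 1) * p.
Proof.
rewrite le_eqVlt => /predU1P[<- _|m0]; first by rewrite !mul0r expR0 subrr !mul0r.
move=> /andP[p1 p2]; have := @exp_slope (m * p) (m * p0).
rewrite mulr_ge0 ?(ltW m0)//= ler_pM2l// p2 => /(_ isT).
by rewrite mulrCA [leRHS]mulrCA ler_pM2l.
Qed.

(* Both factors of the difference change sign at p = 9/16, where
   1/(2 sqrt p) = 2/3. *)
Lemma sqrtV_exp_chord m p K : 0 <= m -> 0 < p < 1 -> K * (9 / 16) = expR (m * (9 / 16)) - 1 ->
  1 / 2 * (p `^ (- (1 / 2)) * expR (m * p)) + (K * (2 / 3) * p + 2 / 3) <=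
  2 / 3 * expR (m * p) + (1 / 2 * p `^ (- (1 / 2)) + K / 2 * p `^ (1 / 2)).
Proof.
move=> m0 /andP[p0 p1] KE.
have s0 : 0 < Num.sqrt p by rewrite sqrtr_gt0.
have pE : Num.sqrt p ^+ 2 = p by rewrite sqr_sqrtr// ltW.
have up : p <= 9 / 16 -> expR (m * p) - 1 <= K * p.
  move=> p9; have := @exp_slopeM m p (9 / 16) m0.
  rewrite (ltW p0) p9 => /(_ isT); rewrite -KE; nra.
have dn : 9 / 16 < p -> K * p <= expR (m * p) - 1.
  move=> p9; have := @exp_slopeM m (9 / 16) p m0.
  rewrite (ltW p9) => /(_ _); rewrite -KE => h.
  have : K * (9 / 16) * p <= (expR (m * p) - 1) * (9 / 16) by apply: h; lra.
  nra.
rewrite powRN !half_powR//.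
move: (Num.sqrt p) s0 pE (expR (m * p)) up dn => t t0 pE e up dn.
rewrite -subr_ge0.
have -> : 2 / 3 * e + (1 / 2 / t + K / 2 * t) - (1 / 2 * (t^-1 * e) + (K * (2 / 3) * p + 2 / 3)) =
  ((4 / 3 * t - 1) * (e - 1 - K * p)) / (2 * t).
  by rewrite -pE; field; rewrite gt_eqF.
rewrite divr_ge0//; last by rewrite mulr_ge0// ltW.
have [p9|p9] := leP p (9 / 16).
  have := up p9; have : t <= 3 / 4 by nra.
  by move=> h1 h2; rewrite mulr_le0//; lra.
have := dn p9; have : 3 / 4 <= t by nra.
by move=> h1 h2; rewrite mulr_ge0//; lra.
Qed.

Lemma integral_e01_fin m : 0 <= m ->
  (\int[leb]_(p in D1) (expR (- (m * (1 - p))))%:E \is a fin_num)%E.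
Proof.
move=> m0; rewrite ge0_fin_numE; last by apply: integral_ge0 => p _; rewrite lee_fin expR_ge0.
apply: (@le_lt_trans _ _ (\int[leb]_(p in D1) 1%:E)%E).
  apply: le_integral_any => p /D1E/andP[p0 p1]; rewrite lee_fin.
  by rewrite -[leRHS]expR0 ler_expR oppr_le0 mulr_ge0// subr_ge0 ltW.
by rewrite integral_cst//= lebesgue_measure_itv/= lte01 oppr0 adde0 mule1 ltry.
Qed.

(** Chebyshev-type argument: 1 / (2 sqrt p) is compared with the constant 2/3, and exp (m p) with
    its chord from 0 to the crossing point 9/16. The level 2/3 is the one for which 1 / (2 sqrt p) -
    2/3 is orthogonal to p on (0, 1), so the chord slope [K] cancels after integration and only exp
    (- m) / 3 is left. *)
Lemma integral_sqrtV_exp_le m : 0 <= m ->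
  (\int[leb]_(p in D1) (1 / 2 * (p `^ (- (1 / 2)) * expR (- (m * (1 - p)))))%:E <=
   (2 / 3)%:E * \int[leb]_(p in D1) (expR (- (m * (1 - p))))%:E + (1 / 3 * expR (- m))%:E)%E.
Proof.
move=> m0.
pose K := (expR (m * (9 / 16)) - 1) / (9 / 16) * expR (- m).
pose e p : R := expR (- (m * (1 - p))).
have K0 : 0 <= K.
  rewrite mulr_ge0 ?expR_ge0// divr_ge0//.
  by rewrite subr_ge0 -[leLHS]expR0 ler_expR mulr_ge0//; lra.
have me : measurable_fun setT e by rewrite /e; meas.
have e0 p : 0 <= e p by exact: expR_ge0.
pose h p : R := 1 / 2 * (p `^ (- (1 / 2)) * e p).
pose em := expR (- m).
have em0 : 0 <= em by exact: expR_ge0.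
have I1 : (\int[leb]_(p in D1) (p `^ 1)%:E = (1 / 2)%:E)%E.
  by rewrite integral_powR01; [congr EFin; field|lra].
have I2 : (\int[leb]_(p in D1) (p `^ (- (1 / 2)))%:E = 2%:E)%E.
  by rewrite integral_powR01; [congr EFin; field|lra].
have I3 : (\int[leb]_(p in D1) (p `^ (1 / 2))%:E = (2 / 3)%:E)%E.
  by rewrite integral_powR01; [congr EFin; field|lra].
have I4 (c : R) : (\int[leb]_(p in D1) c%:E = c%:E)%E.
  by rewrite integral_cst//= lebesgue_measure_itv/= lte01 oppr0 adde0 mule1.
have H : (\int[leb]_(p in D1) (h p + (K * (2 / 3) * p `^ 1 + 2 / 3 * em))%:E <=
   \int[leb]_(p in D1) (2 / 3 * e p + (1 / 2 * em * p `^ (- (1 / 2)) + K / 2 * p `^ (1 / 2)))%:E)%E.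
  apply: le_integral_any => p /D1E p01; rewrite lee_fin; have /andP[p0 p1] := p01.
  have := @sqrtV_exp_chord m p ((expR (m * (9 / 16)) - 1) / (9 / 16)) m0 p01.
  rewrite divfK; last by rewrite gt_eqF//; lra.
  move=> /(_ erefl) /(ler_wpM2r em0).
  rewrite /h (powRr1 (ltW p0)).
  have -> : e p = expR (m * p) * em by rewrite /e /em -expRD; congr expR; ring.
  rewrite /K -/em.
  set k := (expR (m * (9 / 16)) - 1) / _.
  by move=> h1; rewrite [leLHS](_ : _ = (1 / 2 * (p `^ (- (1 / 2)) * expR (m * p)) +
    (k * (2 / 3) * p + 2 / 3)) * em) ?[leRHS](_ : _ = (2 / 3 * expR (m * p) +
    (1 / 2 * p `^ (- (1 / 2)) + k / 2 * p `^ (1 / 2))) * em)//; ring.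
have mp c : measurable_fun setT (fun p : R => p `^ c) by exact: measurable_powR.
have c23 : 0 <= 2 / 3 :> R by lra.
have k23 : 0 <= K * (2 / 3) by rewrite mulr_ge0.
have k2 : 0 <= K / 2 by rewrite divr_ge0.
have e12 : 0 <= 1 / 2 * em by rewrite mulr_ge0.
move: H.
have pg (c x : R) : 0 <= x `^ c by exact: powR_ge0.
rewrite integralD_ge0; [|exact: mD1|by rewrite /h; meas|by meas
  |by move=> p _; rewrite /h !mulr_ge0|by move=> p _; rewrite addr_ge0// mulr_ge0].
rewrite [X in (_ + X <= _)%E]integralD_ge0; [|exact: mD1|by meas|by meas
  |by move=> p _; rewrite mulr_ge0|by move=> p _; rewrite mulr_ge0].
rewrite [X in (_ + (X + _) <= _)%E]integralZ_ge0; [|exact: mD1|exact: mp|by []|by []].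
rewrite I1 I4.
rewrite [X in (_ <= X)%E]integralD_ge0; [|exact: mD1|by meas|by meas
  |by move=> p _; rewrite mulr_ge0|by move=> p _; rewrite addr_ge0// mulr_ge0].
rewrite [X in (_ <= X + _)%E]integralZ_ge0; [|exact: mD1|exact: me|by []|by []].
rewrite [X in (_ <= _ + X)%E]integralD_ge0; [|exact: mD1|by meas|by meas
  |by move=> p _; rewrite mulr_ge0|by move=> p _; rewrite mulr_ge0].
rewrite [X in (_ <= _ + (X + _))%E]integralZ_ge0; [|exact: mD1|exact: mp|by []|by []].
rewrite [X in (_ <= _ + (_ + X))%E]integralZ_ge0; [|exact: mD1|exact: mp|by []|by []].
rewrite I2 I3.
have := integral_e01_fin m0; rewrite -/(e _) => /fineK <-.
rewrite -!EFinM -!EFinD -leeBrDr// => /le_trans; apply.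
rewrite -EFinB lee_fin /em; lra.
Qed.

(** 8/15 is (2/3) / (5/4): the mean of (5/4) sqrt x over [1/3, 1] is at least 1. It amounts to
    3^(-3/2) <= 1/5, that is 25 <= 27. *)
Lemma integral_sqrt_ge : ((8 / 15)%:E <= \int[leb]_(x in `[(3^-1)%R, 1%R]) (x `^ (1 / 2))%:E)%E.
Proof.
have lt31 : (3^-1 : R) < 1 by lra.
have pos (x : R) : 3^-1 <= x -> 0 < x by lra.
have p31 : (0 : R) < 3^-1 by lra.
have dF (x : R) : 0 < x -> is_derive x 1 (fun x : R => 2 / 3 * x `^ (3 / 2)) (x `^ (1 / 2)).
  move=> x0; der => //; have -> : 3 / 2 - 1 = 1 / 2 :> R by field.
  by field.
rewrite (@continuous_FTC2 _ _ (fun x : R => 2 / 3 * x `^ (3 / 2)) _ _ lt31).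
- rewrite -EFinB lee_fin powR1.
  have : (3^-1 : R) `^ (3 / 2) <= 1 / 5.
    rewrite -(@ler_sqr _ _ (1 / 5)) ?nnegrE ?powR_ge0//.
    rewrite -powR_mulrn ?powR_ge0// -powRrM mulfVK//.
    by rewrite powR_mulrn//; lra.
  by move: (_ `^ _) => t; lra.
- apply: continuous_in_subspaceT => x; rewrite inE/= in_itv/= => /andP[/pos x0 _].
  by dcont.
- split.
  + by move=> x; rewrite in_itv/= => /andP[/ltW/pos/dF + _]; exact: der_derivable.
  + by apply: cvg_at_right_filter; exact: (der_continuous (dF _ p31)).
  + by apply: cvg_at_left_filter; exact: (der_continuous (dF _ ltr01)).
- by move=> x; rewrite in_itv/= => /andP[/ltW/pos/dF + _]; exact: der_val.
Qed.

(* Both factors of the difference change sign at x = 16/25, where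
   (5/4) sqrt x = 1. *)
Lemma sqrt_exp_level m x : 0 <= m -> 0 < x ->
  expR (- (3 / 2 * m * (1 - x))) + expR (- (3 / 2 * m * (9 / 25))) * (5 / 4) * x `^ (1 / 2) <=
  5 / 4 * (x `^ (1 / 2) * expR (- (3 / 2 * m * (1 - x)))) + expR (- (3 / 2 * m * (9 / 25))).
Proof.
move=> m0 x0; rewrite half_powR//.
have s0 : 0 < Num.sqrt x by rewrite sqrtr_gt0.
have xE : Num.sqrt x ^+ 2 = x by rewrite sqr_sqrtr// ltW.
have up : x <= 16 / 25 -> expR (- (3 / 2 * m * (1 - x))) <= expR (- (3 / 2 * m * (9 / 25))).
  by move=> h; rewrite ler_expR lerN2 ler_wpM2l ?mulr_ge0//; lra.
have dn : 16 / 25 < x -> expR (- (3 / 2 * m * (9 / 25))) <= expR (- (3 / 2 * m * (1 - x))).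
  by move=> h; rewrite ler_expR lerN2 ler_wpM2l ?mulr_ge0//; lra.
move: (Num.sqrt x) s0 xE (expR _) (expR _) up dn => t t0 xE e1 e0 up dn.
rewrite -subr_ge0.
have [x9|x9] := leP x (16 / 25).
  have := up x9; have : t <= 4 / 5 by nra.
  move=> h1 h2; have : 0 <= (1 - 5 / 4 * t) * (e1 - e0) by rewrite mulr_ge0//; lra.
  lra.
have := dn x9; have : 4 / 5 <= t by nra.
move=> h1 h2; have : 0 <= (5 / 4 * t - 1) * (e0 - e1) by rewrite mulr_ge0//; lra.
lra.
Qed.

(** Under the affine substitution both sides carry the increasing weight [E], with 1 on the left and
    (5/4) sqrt x on the right. Since (5/4) sqrt x also increases and has mean at least 1 on
    [1/3, 1], integrating [sqrt_exp_level] gives the claim; [e0] is the value of [E] at the crossing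
    point 16/25. *)
Lemma integral_exp_le_gg3 m : 0 <= m ->
  ((2 / 3)%:E * \int[leb]_(p in D1) (expR (- (m * (1 - p))))%:E <=
   (5 / 4)%:E * \int[leb]_(p in D1) (gg 1 m p ^+ 3 / p)%:E)%E.
Proof.
move=> m0.
pose E x : R := expR (- (3 / 2 * m * (1 - x))).
pose e0 : R := expR (- (3 / 2 * m * (9 / 25))).
pose I := (`[(3^-1)%R, 1%R]%classic : set R).
have mI : measurable I by exact: measurable_itv.
have E0 x : 0 <= E x by exact: expR_ge0.
have e00 : 0 <= e0 by exact: expR_ge0.
have e004 : 0 <= e0 * (5 / 4) by rewrite mulr_ge0.
have mE : measurable_fun setT E by rewrite /E; meas.
have mp (c : R) : measurable_fun setT (fun p : R => p `^ c) by exact: measurable_powR.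
have pg (c x : R) : 0 <= x `^ c by exact: powR_ge0.
have Ipos x : I x -> 0 < x /\ x <= 1.
  by rewrite /I/= in_itv/= => /andP[? ?]; split => //; lra.
have c23 : 0 <= 2 / 3 :> R by lra.
have c54 : 0 <= 5 / 4 :> R by lra.
have c54' : (0 < (5 / 4 : R)%:E)%E by rewrite lte_fin; lra.
rewrite -integralZ_ge0; [|exact: mD1|by meas|by move=> p _; exact: expR_ge0|by []].
rewrite (@subst_affine01 (fun p => 2 / 3 * expR (- (m * (1 - p))))); last by move=> p; dcont.
under eq_integral => x _.
  rewrite (_ : 2 / 3 * _ * _ = E x); last first.
    rewrite /E (_ : - (m * _) = - (3 / 2 * m * (1 - x))); first by field.
    by field.
  over.
have H : (\int[leb]_(x in I) (E x + e0 * (5 / 4) * x `^ (1 / 2))%:E <=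
          \int[leb]_(x in I) (5 / 4 * (x `^ (1 / 2) * E x) + e0)%:E)%E.
  by apply: le_integral_any => x /Ipos[x0 x1]; rewrite lee_fin sqrt_exp_level.
have I4 (c : R) : (\int[leb]_(p in I) c%:E = (2 / 3 * c)%:E)%E.
  rewrite integral_cst//= lebesgue_measure_itv/= lte_fin.
  have -> : (3^-1 : R) < 1 by lra.
  by rewrite -EFinB -EFinM; congr EFin; field.
move: H.
rewrite integralD_ge0; [|exact: mI|by meas|by meas|by []|by move=> p _; rewrite mulr_ge0].
rewrite [X in (_ + X <= _)%E]integralZ_ge0; [|exact: mI|exact: mp|by []|by []].
rewrite integralD_ge0; [|exact: mI|by meas|by meas|by move=> p _; rewrite !mulr_ge0|by []].
rewrite I4 [X in (_ <= X + _)%E]integralZ_ge0; [|exact: mI|by meas|by move=> p _; rewrite mulr_ge0|by []].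
move=> H.
apply: (@le_trans _ _ ((5 / 4)%:E * \int[leb]_(x in I) (x `^ (1 / 2) * E x)%:E)%E); last first.
  rewrite lee_pmul2l//.
  rewrite [leRHS]integral_closed01; last by rewrite /gg; meas.
  apply: (@le_trans _ _ (\int[leb]_(x in I) (gg 1 m x ^+ 3 / x)%:E)%E).
    apply: le_integral_any => x /Ipos[x0 x1]; rewrite lee_fin (gg3E _ _ (ltW x0)) half_powR//.
    rewrite -/(E x) -[X in _ <= _ / X](sqr_sqrtr (ltW x0)).
    have s0 : 0 < Num.sqrt x by rewrite sqrtr_gt0.
    apply: ler_of_eq; field; rewrite gt_eqF//.
  apply: ge0_subset_integral => //.
  - by apply/measurable_EFinP; apply: measurable_funS; [| |rewrite /gg; meas].
  - move=> x /=; rewrite in_itv/= => /andP[x0 _]; rewrite lee_fin.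
    by rewrite divr_ge0// exprn_ge0// mulr_ge0 ?powR_ge0 ?expR_ge0.
  - by move=> x /=; rewrite /I/= !in_itv/= => /andP[? ->]; rewrite andbT; lra.
have h2 : (e0%:E * (2 / 3)%:E <= (e0 * (5 / 4))%:E * \int[leb]_(x in I) (x `^ (1 / 2))%:E)%E.
  rewrite [(e0 * _)%:E]EFinM -muleA lee_pmul2l ?lte_fin ?expR_gt0//.
  apply: (@le_trans _ _ ((5 / 4)%:E * (8 / 15)%:E)%E); first by rewrite -EFinM lee_fin; lra.
  by rewrite lee_pmul2l// integral_sqrt_ge.
rewrite -(@leeD2rE _ (2 / 3 * e0)%:E)//; apply: le_trans H.
by rewrite leeD2l// mulrC EFinM.
Qed.

(** 5/4 comes from the mean of sqrt x over [1/3, 1], and 27/32 from the polynomial bounds on the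
    same interval; [kappa_lt_log_gain] is what they have to satisfy. *)
Definition kappa (d : nat) : R := if d == 1%N then 5 / 4 else 27 / 32.

Lemma integral_log_le d m : (0 < d)%N -> 0 <= m ->
  (\int[leb]_(p in D1) ((gg d m p ^+ 2 - gg d m p ^+ 3) / (p * (1 - p)))%:E <=
   (ln (3 / 2))%:E + (kappa d)%:E * \int[leb]_(p in D1) (gg d m p ^+ 3 / p)%:E)%E.
Proof.
move=> d0 m0; apply: le_trans (integral_log_le_remainder d0 m0) _; rewrite leeD2l//.
case: d d0 => [//|[|k]] _; last first.
  by apply: le_trans (integral_log_rem_ge2 k m0) _; exact: integral_pow_exp_le_gg3.
rewrite /kappa eqxx; apply: le_trans (integral_exp_le_gg3 m0).
have h := le_trans (integral_log_rem_1 m0) (integral_sqrtV_exp_le m0).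
rewrite -(@leeD2rE _ (1 / 2 * expR (- m))%:E)//; apply: le_trans h _.
rewrite leeD2l// lee_fin ler_pM2r ?expR_gt0//; lra.
Qed.

End OneDimIneq.

(** * Bayes marginals *)

Section ProductIntegrals.
Context {R : realType}.
Notation leb := (@lebesgue_measure R).

Lemma iint_prod n (f : nat -> R -> R) (c : nat -> R) :
  (forall i, (i < n)%N -> leb.-integrable [set: R] (EFin \o f i) /\
     (\int[leb]_(x in [set: R]) (f i x)%:E = (c i)%:E)%E) ->
  Int n (fun s => (\prod_(i < n) f i (nth 0 s i))%:E) /\
  iint_seq n (fun s => (\prod_(i < n) f i (nth 0 s i))%:E) = (\prod_(i < n) c i)%:E.
Proof.
elim: n f c => [|n IH] f c fc; first by rewrite /= !big_ord0.
have [i0 e0] := fc 0%N isT.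
have [iI eI] := IH (fun i => f i.+1) (fun i => c i.+1) (fun i ni => fc i.+1 ni).
have E x : (fun s => (\prod_(i < n.+1) f i (nth 0 (x :: s) i))%:E) =
    (fun s => (f 0%N x)%:E * (\prod_(i < n) f i.+1 (nth 0 s i))%:E)%E.
  by apply/funext => s; rewrite big_ord_recl -EFinM.
have E2 x : iint_seq n (fun s => (\prod_(i < n.+1) f i (nth 0 (x :: s) i))%:E) =
   ((\prod_(i < n) c i.+1)%:E * (f 0%N x)%:E)%E.
  by rewrite E (IntZ _ iI).2 eI muleC.
split; last first.
  rewrite /=; under eq_integral do rewrite E2.
  by rewrite integralZl// e0 -EFinM mulrC big_ord_recl.
split; first by move=> x; rewrite E; exact: (IntZ _ iI).1.
rewrite (_ : (fun x => _) = (fun x => (\prod_(i < n) c i.+1)%:E * (EFin \o f 0%N) x)%E).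
  exact: integrableZl.
by apply/funext => x; exact: E2.
Qed.

Lemma integral_gauss (a b c : R) : 0 < a ->
  leb.-integrable [set: R] (EFin \o (fun x => expR (- (a * x ^+ 2 - 2 * b * x + c)))) /\
  (\int[leb]_(x in [set: R]) (expR (- (a * x ^+ 2 - 2 * b * x + c)))%:E =
   ((pi / a) `^ (1 / 2) * expR (b ^+ 2 / a - c))%:E)%E.
Proof.
move=> a0.
pose sg := Num.sqrt (2 * a)^-1.
have a20 : 0 < (2 * a)^-1 by rewrite invr_gt0 mulr_gt0.
have sg0 : sg != 0 by rewrite gt_eqF// sqrtr_gt0.
have sg2 : sg ^+ 2 = (2 * a)^-1 by rewrite sqr_sqrtr// ltW.
pose k := (pi / a) `^ (1 / 2) * expR (b ^+ 2 / a - c).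
have E x : expR (- (a * x ^+ 2 - 2 * b * x + c)) = k * normal_pdf (b / a) sg x.
  rewrite normal_pdfE// /normal_peak /normal_fun sg2.
  rewrite /k mul1r powR12_sqrt; last by rewrite divr_ge0 ?pi_ge0 ?ltW.
  rewrite (_ : (2 * a)^-1 * pi *+ 2 = pi / a); last by rewrite -mulr_natl; field; rewrite gt_eqF.
  rewrite mulrACA divff ?mul1r; last by rewrite gt_eqF// sqrtr_gt0 divr_gt0 ?pi_gt0.
  rewrite -expRD; congr expR; rewrite -[(2 * a)^-1 *+ 2]mulr_natl; field.
  by rewrite gt_eqF.
have F : (EFin \o (fun x => expR (- (a * x ^+ 2 - 2 * b * x + c)))) =
    (fun x => k%:E * (normal_pdf (b / a) sg x)%:E)%E.
  by apply/funext => x /=; rewrite E.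
have i := @integrable_normal_pdf R (b / a) sg.
split; first by rewrite F; exact: integrableZl.
under eq_integral do rewrite E EFinM.
by rewrite integralZl// integral_normal_pdf mule1.
Qed.

Lemma vec_int_prod d (f : nat -> R -> R) (c : nat -> R) (k : R) :
  (forall i, (i < d)%N -> leb.-integrable [set: R] (EFin \o f i) /\
     (\int[leb]_(x in [set: R]) (f i x)%:E = (c i)%:E)%E) ->
  vec_int (fun v : 'rV[R]_d => (k * \prod_(i < d) f i (v ord0 i))%:E) =
  (k * \prod_(i < d) c i)%:E.
Proof.
move=> fc; have [iP eP] := iint_prod fc.
rewrite /vec_int EFinM -eP -(IntZ k iP).2; apply: eq_iint => s sn.
by rewrite EFinM; congr (_ * _%:E)%E; apply: eq_bigr => i _; rewrite mxE.
Qed.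

Lemma prodr_expR n (f : 'I_n -> R) : \prod_(i < n) expR (f i) = expR (\sum_(i < n) f i).
Proof. by rewrite expR_sum. Qed.

Lemma vec_int_gauss d (a k : R) (b c : 'I_d -> R) : 0 < a ->
  vec_int (fun v : 'rV[R]_d => (k * expR (- \sum_(i < d)
     (a * v ord0 i ^+ 2 - 2 * b i * v ord0 i + c i)))%:E) =
  (k * ((pi / a) `^ (d%:R / 2) * expR (\sum_(i < d) (b i ^+ 2 / a - c i))))%:E.
Proof.
(* Coordinate families indexed by ['I_d] are extended to [nat] through [inord], which needs a
   nonempty index type. *)
move=> a0; case: d b c => [|d] b c.
  by rewrite /vec_int/= !big_ord0 oppr0 expR0 mul0r powRr0 mul1r.
pose f i x := expR (- (a * x ^+ 2 - 2 * b (inord i) * x + c (inord i))).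
pose C i := (pi / a) `^ (1 / 2) * expR (b (inord i) ^+ 2 / a - c (inord i)).
have := @vec_int_prod d.+1 f C k (fun i _ => integral_gauss _ _ a0).
rewrite big_split/= big_const_ord iter_mulr_1 prodr_expR.
rewrite (_ : (pi / a) `^ (1 / 2) ^+ d.+1 = (pi / a) `^ (d.+1%:R / 2)); last first.
  by rewrite -powR_mulrn ?powR_ge0// -powRrM; congr (_ `^ _); field.
under [X in _ = (k * (_ * expR X))%:E -> _]eq_bigr do rewrite inord_val.
move=> <-; congr vec_int; apply/funext => v; congr ((k * _)%:E).
rewrite prodr_expR; congr expR; rewrite sumrN; congr (- _).
by apply: eq_bigr => i _; rewrite inord_val.
Qed.

End ProductIntegrals.

Section VectorMeasurability.
Context {R : realType} (dT : measure_display) (T : measurableType dT).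

Lemma meas_nth n i : measurable_fun setT (fun p : T * n.-tuple R => nth 0 p.2 i).
Proof.
have [ni|ni] := leqP n i.
  rewrite (_ : (fun p => _) = (fun=> 0)); first exact: meas_cst.
  by apply/funext => p; rewrite nth_default// size_tuple.
rewrite (_ : (fun p => _) = (fun p : T * n.-tuple R => tnth p.2 (Ordinal ni))); last first.
  by apply/funext => p; rewrite (tnth_nth 0).
exact: (measurableT_comp (measurable_tnth (Ordinal ni)) measurable_snd).
Qed.

Lemma meas_sum n (f : 'I_n -> T -> R) : (forall i, measurable_fun setT (f i)) ->
  measurable_fun setT (fun t => \sum_(i < n) f i t).
Proof. by move=> mf; exact: measurable_sum. Qed.

Lemma meas_sqnorm d (v : T -> 'rV[R]_d) :
  (forall i, measurable_fun setT (fun t => v t ord0 i)) ->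
  measurable_fun setT (fun t => sqnorm (v t)).
Proof. by move=> mv; apply: meas_sum => i; apply: measXn. Qed.

Lemma meas_gauss_pdf d (x th : T -> 'rV[R]_d) (tau : T -> R) :
  (forall i, measurable_fun setT (fun t => x t ord0 i)) ->
  (forall i, measurable_fun setT (fun t => th t ord0 i)) ->
  measurable_fun setT tau ->
  measurable_fun setT (fun t => gauss_pdf (x t) (th t) (tau t)).
Proof.
move=> mx mth mtau; rewrite /gauss_pdf.
have ms : measurable_fun setT (fun t => sqnorm (x t - th t)).
  apply: meas_sqnorm => i; have mxi := mx i; have mti := mth i.
  rewrite (_ : (fun t => _) = (fun t => x t ord0 i - th t ord0 i)); first by meas.
  by apply/funext => t; rewrite !mxE.
by meas.
Qed.

End VectorMeasurability.

Lemma powE {R : realType} (x c : R) : 0 < x -> x `^ c = expR (c * ln x).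
Proof. by move=> x0; rewrite /powR gt_eqF. Qed.

Lemma sqnorm_ge0 {R : realType} d (v : 'rV[R]_d) : 0 <= sqnorm v.
Proof. by apply: sumr_ge0 => i _; rewrite sqr_ge0. Qed.

Lemma gauss_pdf_ge0 {R : realType} d (x th : 'rV[R]_d) tau : 0 <= gauss_pdf x th tau.
Proof. by rewrite mulr_ge0 ?powR_ge0 ?expR_ge0. Qed.

(** * Integrating mu and eta out of likelihood times prior *)

Section BayesIntegral.
Context {R : realType}.
Notation leb := (@lebesgue_measure R).
Notation Dy := (`]0%R, +oo[%classic : set R).
Notation D1 := (`]0%R, 1%R[%classic : set R).
Variables (d : nat) (nu : R) (wr s : R) (x y : 'rV[R]_d).
Hypotheses (d0 : (0 < d)%N) (nu0 : 0 < nu) (w0 : 0 <= wr) (s0 : 0 < s).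

Let de : R := d%:R.
Let de0 : 0 < de. Proof. by rewrite ltr0n. Qed.
Let a := nu - de / 2 - 1.
Let e := (wr + 1) * de / 2 + nu.
Let e0 : 0 < e.
Proof. by rewrite addr_gt0// !mulr_gt0// ltr_wpDl. Qed.

(** The first two factors are the density of [y] raised to the power [wr], so that a single Gaussian
    integration over mu yields both marginals. *)
Definition lik (eta : R) (mu : 'rV[R]_d) : R :=
  (2 * pi * eta^-1) `^ (- (wr * (d%:R / 2))) * expR (- wr * sqnorm (y - mu) / (2 * eta^-1))
  * gauss_pdf x mu (2 * eta)^-1 * s_pdf 2 d eta s.

Definition latent (eta lam : R) (mu : 'rV[R]_d) : R :=
  gauss_pdf mu 0 (eta^-1 * lam^-1 * (1 - lam)) * eta `^ (nu - d%:R / 2 - 1)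
  * lam `^ (nu - d%:R / 2 - 1) * f_GM 2 d nu lam.

(** Completing the square: the minimum over mu of wr |y - mu|^2 + 2 |x - mu|^2 + s + r |mu|^2 is (M0
    + r M1) / (wr + 2 + r). Thus [M1] is a sum of squares about 0 and [M0] is wr + 2 times the
    residual sum about the weighted mean. *)
Definition M1 := wr * sqnorm y + 2 * sqnorm x + s.
Definition M0 := (wr + 2) * s + 2 * wr * sqnorm (y - x).

Lemma M0_gt0 : 0 < M0.
Proof.
rewrite ltr_pwDl//; last by rewrite !mulr_ge0// sqnorm_ge0.
by rewrite mulr_gt0// ltr_wpDl.
Qed.

Lemma M1_gt0 : 0 < M1.
Proof. by rewrite ltr_wpDl// addr_ge0// mulr_ge0// sqnorm_ge0. Qed.

Let odds lam : R := lam / (1 - lam).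
Let Q lam : R := (M0 + odds lam * M1) / (wr + 2 + odds lam).
Let C0 : R := (2 * pi) `^ (- (wr * (de / 2))) * pi `^ (- (de / 2)) *
  s `^ (de / 2 - 1) / (2 `^ (de / 2) * Gamma (de / 2)).
Let Kl lam : R := lam `^ a * f_GM 2 d nu lam * (odds lam) `^ (de / 2) *
  (wr + 2 + odds lam) `^ (- (de / 2)).
Let K eta lam : R := C0 * Kl lam * (eta `^ (e - 1) * expR (- (Q lam / 2 * eta))).

Let s_pdfE eta : 0 < eta -> s_pdf 2 d eta s =
  eta * ((eta * s) `^ (de / 2 - 1) * expR (- (eta * s) / 2) / (2 `^ (de / 2) * Gamma (de / 2))).
Proof. by move=> eta0; rewrite /s_pdf /chisq_pdf mulr_gt0//= mul1n. Qed.

Let odds_gt0 lam : 0 < lam < 1 -> 0 < odds lam.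
Proof. by move=> /andP[l0 l1]; rewrite divr_gt0// subr_gt0. Qed.

Let vec_int_lik_latent eta lam : 0 < eta -> 0 < lam < 1 ->
  vec_int (fun mu => (lik eta mu * latent eta lam mu)%:E) = (K eta lam)%:E.
Proof.
move=> eta0 lam01; have /andP[l0 l1] := lam01; have r0 := odds_gt0 lam01.
have l1' : 0 < 1 - lam by rewrite subr_gt0.
have wr0 : 0 < wr + 2 + odds lam by rewrite ltr_wpDl// addr_ge0.
pose A := eta / 2 * (wr + 2 + odds lam).
have A0 : 0 < A by rewrite !mulr_gt0.
pose k := (2 * pi * eta^-1) `^ (- (wr * (d%:R / 2))) * (2 * pi * (2 * eta)^-1) `^ (- (d%:R / 2)) *
  s_pdf 2 d eta s * ((2 * pi * (eta^-1 * lam^-1 * (1 - lam))) `^ (- (d%:R / 2)) *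
  eta `^ (nu - d%:R / 2 - 1) * lam `^ (nu - d%:R / 2 - 1) * f_GM 2 d nu lam).
pose B (i : 'I_d) := eta / 2 * (wr * y ord0 i + 2 * x ord0 i).
pose Cc (i : 'I_d) := eta / 2 * (wr * y ord0 i ^+ 2 + 2 * x ord0 i ^+ 2).
rewrite (_ : (fun mu => _) = (fun mu : 'rV[R]_d => (k * expR (- \sum_(i < d)
     (A * mu ord0 i ^+ 2 - 2 * B i * mu ord0 i + Cc i)))%:E)); last first.
  apply/funext => mu; congr EFin.
  rewrite /lik /latent /gauss_pdf.
  set E1 := expR _; set E2 := expR _; set E3 := expR _.
  rewrite [LHS](_ : _ = k * (E1 * E2 * E3)); last by rewrite /k; ring.
  congr (_ * _); rewrite -!expRD; congr expR.
  rewrite /sqnorm !mulNr -!opprD; congr (- _).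
  rewrite mulr_sumr !mulr_suml -!big_split/=; apply: eq_bigr => i _.
  by rewrite !mxE /A /B /Cc /odds; field; rewrite !gt_eqF.
rewrite vec_int_gauss//; congr EFin.
rewrite [X in expR X](_ : _ = - (eta / 2 * (Q lam - s))); last first.
  rewrite /Q /M0 /M1 /sqnorm.
  rewrite [RHS](_ : _ = - (eta / 2 / (wr + 2 + odds lam)) * (2 * wr * \sum_(i < d) (y - x) ord0 i ^+ 2 +
    odds lam * (wr * \sum_(i < d) y ord0 i ^+ 2 + 2 * \sum_(i < d) x ord0 i ^+ 2))); last first.
    by field; rewrite gt_eqF.
  rewrite !mulr_sumr -!big_split/= !mulr_sumr -big_split/= mulr_sumr; apply: eq_bigr => i _.
  by rewrite !mxE /A /B /Cc; field; rewrite !gt_eqF.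
rewrite /k /K /Kl /C0 s_pdfE//.
have p0 := @pi_gt0 R.
have G0 : 0 < Gamma (de / 2) by apply: Gamma_gt0; rewrite divr_gt0.
rewrite (_ : 2 * pi * (2 * eta)^-1 = pi / eta); last by field; rewrite gt_eqF.
rewrite (_ : 2 * pi * (eta^-1 * lam^-1 * (1 - lam)) = 2 * pi / eta / odds lam); last first.
  by rewrite /odds; field; rewrite !gt_eqF.
rewrite (_ : pi / A = 2 * pi / eta / (wr + 2 + odds lam)); last first.
  by rewrite /A; field; rewrite !gt_eqF.
rewrite -/de.
move: (f_GM 2 d nu lam) => f.
move: (Q lam) (odds lam) (wr + 2 + odds lam) r0 wr0 => q r t r0 t0.
(* Every power becomes the exponential of a multiple of a logarithm, so that the comparison of
   exponents is left to [ring]. *)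
have P (c : R) (u : R) : 0 < u -> u `^ c = expR (c * ln u) by move=> u0; exact: powE.
have p2 : (0 : R) < 2 by [].
rewrite !P ?divr_gt0 ?mulr_gt0 ?invr_gt0//.
rewrite !lnM ?posrE ?divr_gt0 ?mulr_gt0 ?invr_gt0// !lnV ?posrE//.
set D := expR (de / 2 * ln 2) * _.
set E1 := expR (- (wr * (de / 2)) * (ln 2 + ln pi - ln eta)).
set E2 := expR (- (de / 2) * (ln pi - ln eta)).
set E3 := expR ((de / 2 - 1) * (ln eta + ln s)).
set E4 := expR (- (eta * s) / 2).
set E5 := expR (- (de / 2) * (ln 2 + ln pi - ln eta - ln r)).
set E6 := expR ((nu - de / 2 - 1) * ln eta).
set E7 := expR ((nu - de / 2 - 1) * ln lam).
set E8 := expR (de / 2 * (ln 2 + ln pi - ln eta - ln t)).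
set E9 := expR (- (eta / 2 * (q - s))).
transitivity ((expR (ln eta) * E1 * E2 * E3 * E4 * E5 * E6 * E7 * E8 * E9) * (f / D)).
  by rewrite lnK ?posrE//; ring.
set F1 := expR (- (wr * (de / 2)) * (ln 2 + ln pi)).
set F2 := expR (- (de / 2) * ln pi).
set F3 := expR ((de / 2 - 1) * ln s).
set F4 := expR (de / 2 * ln r).
set F5 := expR (- (de / 2) * ln t).
set F6 := expR ((e - 1) * ln eta).
set F7 := expR (- (q / 2 * eta)).
transitivity ((F1 * F2 * F3 * E7 * F4 * F5 * F6 * F7) * (f / D)); last by ring.
congr (_ * _); rewrite -!expRD; congr expR; rewrite /e; ring.
Qed.

Let K_ge0 eta lam : 0 < lam < 1 -> 0 <= K eta lam.
Proof.
move=> lam01; rewrite /K /Kl /C0 /f_GM.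
have G0 : 0 < Gamma (de / 2) by apply: Gamma_gt0; rewrite divr_gt0.
by rewrite !mulr_ge0 ?powR_ge0 ?expR_ge0// invr_ge0 mulr_ge0 ?powR_ge0// ltW.
Qed.

Let latent_ge0 eta lam mu : 0 <= latent eta lam mu.
Proof. by rewrite /latent /f_GM !mulr_ge0 ?powR_ge0// gauss_pdf_ge0. Qed.

Let lik_ge0 eta mu : 0 < eta -> 0 <= lik eta mu.
Proof.
move=> eta0; rewrite /lik s_pdfE//.
have G0 : 0 < Gamma (de / 2) by apply: Gamma_gt0; rewrite divr_gt0.
rewrite !mulr_ge0 ?powR_ge0 ?expR_ge0 ?gauss_pdf_ge0 ?(ltW eta0)//.
by rewrite invr_ge0 mulr_ge0 ?powR_ge0// ltW.
Qed.

Let G r : R := C0 * (Gamma e * 2 `^ e) * (r `^ (nu - 1) * (1 + r / 2) `^ (- nu) *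
  (wr + 2 + r) `^ (e - de / 2) * (M0 + r * M1) `^ (- e)).

(* [wr = 1] gives the numerator and [wr = 0] the denominator of the Bayes
   predictive density; the integration variable is r = lambda / (1 - lambda). *)
Lemma bayes_integral (E := (wr + 1) * d%:R / 2 + nu) :
  (\int[leb]_(eta in Dy) vec_int (fun mu => (lik eta mu)%:E *
     \int[leb]_(lam in D1) (latent eta lam mu)%:E) =
   \int[leb]_(r in Dy) ((2 * pi) `^ (- (wr * (d%:R / 2))) * pi `^ (- (d%:R / 2)) *
     s `^ (d%:R / 2 - 1) / (2 `^ (d%:R / 2) * Gamma (d%:R / 2)) * (Gamma E * 2 `^ E) *
     (r `^ (nu - 1) * (1 + r / 2) `^ (- nu) *
      (wr + 2 + r) `^ (E - d%:R / 2) * (M0 + r * M1) `^ (- E)))%:E)%E.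
Proof.
rewrite -[RHS]/(\int[leb]_(r in Dy) (G r)%:E)%E.
have mD1 : measurable D1 by exact: measurable_itv.
have mDy : measurable Dy by exact: measurable_itv.
transitivity (\int[leb]_(eta in Dy) \int[leb]_(lam in D1) (K eta lam)%:E)%E.
  apply: eq_integral => eta; rewrite inE => /DyE eta0.
  pose F (lam : R) (t : seq R) : \bar R :=
    (lik eta (\row_(i < d) nth 0 t i) * latent eta lam (\row_(i < d) nth 0 t i))%:E.
  have mrow i : measurable_fun setT (fun p : R * d.-tuple R => (\row_(j < d) nth 0 p.2 j : 'rV[R]_d) ord0 i).
    rewrite (_ : (fun p => _) = (fun p : R * d.-tuple R => nth 0 p.2 i)); first exact: meas_nth.
    by apply/funext => p; rewrite mxE.
  have mF : jmeas d F.
    apply/measurable_EFinP; rewrite /F /lik /latent.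
    have m1 : measurable_fun setT (fun p : R * d.-tuple R => sqnorm (y - \row_(j < d) nth 0 p.2 j)).
      apply: meas_sqnorm => i; have mri := mrow i.
      rewrite (_ : (fun p => _) = (fun p : R * d.-tuple R => y ord0 i - (\row_(j < d) nth 0 p.2 j : 'rV[R]_d) ord0 i)); first by meas.
      by apply/funext => t; rewrite !mxE.
    have m2 : measurable_fun setT (fun p : R * d.-tuple R => gauss_pdf x (\row_(j < d) nth 0 p.2 j) (2 * eta)^-1).
      by apply: meas_gauss_pdf; [move=> i; exact: meas_cst|exact: mrow|exact: meas_cst].
    have m3 : measurable_fun setT (fun p : R * d.-tuple R => gauss_pdf (\row_(j < d) nth 0 p.2 j) 0 (eta^-1 * p.1^-1 * (1 - p.1))).
      by apply: meas_gauss_pdf; [exact: mrow|move=> i; exact: meas_cst|meas].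
    by rewrite /f_GM; meas.
  transitivity (iint_seq d (fun t => \int[leb]_(lam in D1) F lam t)%E).
    apply: eq_iint => t td; rewrite -integralZ_ge0 ?lik_ge0//.
    rewrite /latent /f_GM.
    have m3 : measurable_fun setT (fun l : R => gauss_pdf (\row_(j < d) nth 0 t j) 0 (eta^-1 * l^-1 * (1 - l))).
      by apply: meas_gauss_pdf; [move=> i; exact: meas_cst|move=> i; exact: meas_cst|meas].
    by meas.
  rewrite -(@iint_swap _ _ _ (measurableTypeR R) leb D1 F)//.
  - apply: eq_integral => lam; rewrite inE => /D1E lam01.
    by rewrite -vec_int_lik_latent.
  - by move=> lam t _ _; rewrite lee_fin mulr_ge0// lik_ge0.
rewrite tonelli_leb//; first last.
- by move=> eta lam _ /D1E lam01; rewrite lee_fin K_ge0.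
- by apply/measurable_EFinP; rewrite /K /Kl /Q /odds /f_GM; meas.
have p1r (r : R) : 0 < r -> 0 < 1 + r / 2 by move=> r0; rewrite addr_gt0// divr_gt0.
have w2r r : 0 < r -> 0 < wr + 2 + r by move=> r0; rewrite ltr_wpDl// addr_ge0.
have mmr r : 0 < r -> 0 < M0 + r * M1.
  by move=> r0; rewrite addr_gt0 ?mulr_gt0// ?M0_gt0 ?M1_gt0.
rewrite (@subst_odds R G); first last.
- move=> r r0; rewrite /G /C0.
  have G0 : 0 < Gamma (de / 2) by apply: Gamma_gt0; rewrite divr_gt0.
  have G1 := Gamma_gt0 e0.
  rewrite !mulr_ge0 ?powR_ge0 ?(ltW G1)//.
  by rewrite invr_ge0 mulr_ge0 ?powR_ge0// ltW.
- move=> r r0; rewrite /G; have h1 := p1r r r0; have h2 := w2r r r0; have h3 := mmr r r0.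
  by dcont.
apply: eq_integral => lam; rewrite inE => /D1E lam01.
have /andP[l0 l1] := lam01; have r0 := odds_gt0 lam01.
have l1' : 0 < 1 - lam by rewrite subr_gt0.
have lh : 0 < 1 - 1 / 2 * lam by lra.
have t0 := w2r _ r0; have m0 := mmr _ r0.
have C00 : 0 <= C0.
  have G0 : 0 < Gamma (de / 2) by apply: Gamma_gt0; rewrite divr_gt0.
  rewrite /C0 !mulr_ge0 ?powR_ge0//.
  by rewrite invr_ge0 mulr_ge0 ?powR_ge0// ltW.
rewrite /K integralZ_ge0//; last 3 first.
- by meas.
- by move=> eta _; rewrite mulr_ge0 ?powR_ge0 ?expR_ge0.
- by rewrite mulr_ge0// /Kl /f_GM !mulr_ge0 ?powR_ge0.
have q0 : 0 < Q lam / 2 by rewrite divr_gt0// divr_gt0.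
rewrite integral_Gamma_scale// -EFinM; congr EFin.
(* The exponents of the prior are tuned so that lambda^a f(lambda) (lambda / (1 - lambda))^(d/2)
   dlambda turns into r^(nu - 1) (1 + r/2)^(-nu) dr; the factor (1 - lambda)^(-2) is the
   Jacobian. *)
have key : Kl lam * (Q lam / 2) `^ (- e) = 2 `^ e * (odds lam `^ (nu - 1) *
    (1 + odds lam / 2) `^ (- nu) * (wr + 2 + odds lam) `^ (e - de / 2) *
    (M0 + odds lam * M1) `^ (- e)) * (1 - lam) ^- 2; last first.
  rewrite /G -/(odds lam) -[LHS]mulrA [Kl lam * _]mulrCA key; ring.
have P (c : R) (u : R) : 0 < u -> u `^ c = expR (c * ln u) by move=> u0; exact: powE.
have -> : 1 + odds lam / 2 = (1 - 1 / 2 * lam) / (1 - lam).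
  by rewrite /odds; field; rewrite gt_eqF.
have -> : (1 - lam) ^- 2 = (1 - lam) `^ (- 2%:R) by rewrite powR_invn// ltW.
rewrite /Kl /f_GM /Q /=.
rewrite !P ?divr_gt0//.
rewrite !ln_div ?posrE ?divr_gt0//.
rewrite -!expRD; congr expR; rewrite /a -/de; by field.
Qed.

End BayesIntegral.

(** * Lower bound for the log-ratio *)

Section RatioBound.
Context {R : realType}.
Notation leb := (@lebesgue_measure R).
Notation Dy := (`]0%R, +oo[%classic : set R).
Notation D1 := (`]0%R, 1%R[%classic : set R).
Implicit Types (u nu t y w s r : R).

Lemma bernoulli_powR u nu : 0 <= u -> 0 <= nu <= 1 -> (1 + u) `^ nu <= 1 + nu * u.
Proof.
move=> u0 nu01; have u1 : 0 < 1 + u by rewrite ltr_pwDl.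
have lu : 0 <= ln (1 + u) by rewrite ln_ge0// lerDl.
rewrite powE//; have := exp_slopeM lu nu01.
by rewrite !mulr1 lnK ?posrE// mulrC [1 + u]addrC addrK lerBlDl [u * nu]mulrC.
Qed.

(** With t = y / (1 + y) one has 1 + (3/2) y = (1 + t/2) (1 + y), so the right side is (1 +
    t/2)^(-nu) >= 1 / (1 + nu t/2) >= 1 - nu t/2. *)
Lemma powR_ratio_ge y nu : 0 <= y -> 0 <= nu <= 1 ->
  1 - nu * (y / (1 + y)) / 2 <= (1 + 3 / 2 * y) `^ (- nu) * (1 + y) `^ nu.
Proof.
move=> y0 nu01; have /andP[nu0 nu1] := nu01.
have y1 : 0 < 1 + y by rewrite ltr_pwDl.
pose t := y / (1 + y).
have t0 : 0 <= t by rewrite divr_ge0// ltW.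
have -> : 1 + 3 / 2 * y = (1 + t / 2) * (1 + y) by rewrite /t; field; rewrite gt_eqF.
have t2 : 0 <= t / 2 by rewrite divr_ge0.
have t1 : 0 < 1 + t / 2 by rewrite ltr_pwDl.
rewrite powRM ?(ltW t1) ?(ltW y1)// -[leRHS]mulrA -powRD; last by rewrite (gt_eqF y1) implybT.
rewrite addNr powRr0 mulr1 powRN.
have := bernoulli_powR t2 nu01 => h.
have p0 : 0 < (1 + t / 2) `^ nu by rewrite powR_gt0.
rewrite -/t -[leRHS]mul1r ler_pdivlMr//.
have : 0 <= nu * (t / 2) by rewrite mulr_ge0.
have : (1 - nu * t / 2) * (1 + t / 2) `^ nu <= (1 - nu * t / 2) * (1 + nu * (t / 2)) \/ 1 - nu * t / 2 < 0.
  by have [?|?] := leP 0 (1 - nu * t / 2); [left; rewrite ler_wpM2l|right].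
by move=> [] ? ?; nra.
Qed.

(** For d >= 2, (1 + y)^(d/2) >= 1 + y with y = r/3, and this factor clears the denominator in
    [powR_ratio_ge]. The bound is affine in r, so each of its terms integrates to a beta
    function. *)
Lemma mixfactor_ge2 d nu r : (2 <= d)%N -> 0 < nu <= 1 -> 0 < r ->
  3 `^ (d%:R / 2 + nu) * (1 + (1 - nu / 2) * (r / 3)) <=
  (1 + r / 2) `^ (- nu) * (3 + r) `^ (d%:R / 2 + nu).
Proof.
move=> d2 /andP[nu0 nu1] r0; pose y := r / 3.
have y0 : 0 < y by rewrite divr_gt0.
have y1 : 0 < 1 + y by rewrite addr_gt0.
have -> : 1 + r / 2 = 1 + 3 / 2 * y by rewrite /y; field.
have -> : 3 + r = 3 * (1 + y) by rewrite /y; field.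
rewrite -/y powRM ?(ltW y1)// [leRHS]mulrCA ler_pM2l ?powR_gt0//.
rewrite [_ `^ (d%:R / 2 + nu)]powRD; last by rewrite (gt_eqF y1) implybT.
rewrite [leRHS]mulrCA.
have nu01 : 0 <= nu <= 1 by rewrite (ltW nu0) nu1.
have h := powR_ratio_ge (ltW y0) nu01.
apply: (@le_trans _ _ ((1 + y) * (1 - nu * (y / (1 + y)) / 2))).
  apply: ler_of_eq; field; rewrite gt_eqF//.
have q : 0 <= 1 - nu * (y / (1 + y)) / 2.
  have : y / (1 + y) <= 1 by rewrite ler_pdivrMr//; lra.
  have : 0 <= y / (1 + y) by rewrite divr_ge0// ltW.
  by nra.
apply: ler_pM => //; first exact: ltW.
rewrite -[leLHS]powRr1 ?(ltW y1)//; apply: ler_powR; first by lra.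
by rewrite ler_pdivlMr// mul1r ler_nat.
Qed.

(** The estimate of [mixfactor_ge2] with sqrt (1 + y) in place of 1 + y. Writing t for that root,
    the slack is nu (t - 1)^2 / (2 t). *)
Lemma mixfactor_ge1 nu r : 0 < nu <= 1 -> 0 < r ->
  3 `^ (1%:R / 2 + nu) * (1 + (1 - nu) * (Num.sqrt (1 + r / 3) - 1)) <=
  (1 + r / 2) `^ (- nu) * (3 + r) `^ (1%:R / 2 + nu).
Proof.
move=> /andP[nu0 nu1] r0; pose y := r / 3.
have y0 : 0 < y by rewrite divr_gt0.
have y1 : 0 < 1 + y by rewrite addr_gt0.
have -> : 1 + r / 2 = 1 + 3 / 2 * y by rewrite /y; field.
have -> : 3 + r = 3 * (1 + y) by rewrite /y; field.
rewrite -/y powRM ?(ltW y1)// [leRHS]mulrCA ler_pM2l ?powR_gt0//.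
rewrite [_ `^ (1%:R / 2 + nu)]powRD; last by rewrite (gt_eqF y1) implybT.
rewrite [leRHS]mulrCA.
have nu01 : 0 <= nu <= 1 by rewrite (ltW nu0) nu1.
have h := powR_ratio_ge (ltW y0) nu01.
rewrite half_powR//.
have s0 : 0 < Num.sqrt (1 + y) by rewrite sqrtr_gt0.
apply: (@le_trans _ _ (Num.sqrt (1 + y) * (1 - nu * (y / (1 + y)) / 2))); last by rewrite ler_pM2l.
have sE : Num.sqrt (1 + y) ^+ 2 = 1 + y by rewrite sqr_sqrtr// ltW.
have s1 : 1 <= Num.sqrt (1 + y) by rewrite -[leLHS]sqrtr1 ler_wsqrtr//; lra.
move: (Num.sqrt (1 + y)) s0 sE s1 => t t0 tE t1.
rewrite -tE (_ : y = t ^+ 2 - 1); last by rewrite tE; ring.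
rewrite -subr_ge0 (_ : _ - _ = nu * (t - 1) ^+ 2 / (2 * t)); last by field; rewrite gt_eqF.
have q : 0 <= (t - 1) ^+ 2 by rewrite sqr_ge0.
have t2 : 0 <= 2 * t by rewrite mulr_ge0// ltW.
have n2 : 0 <= nu * (t - 1) ^+ 2 by rewrite mulr_ge0// ltW.
exact: divr_ge0.
Qed.

End RatioBound.

(** * The square-root kernel that replaces the affine bound when d = 1 *)

Section KernelIntegral.
Context {R : realType}.
Notation leb := (@lebesgue_measure R).
Notation Dy := (`]0%R, +oo[%classic : set R).
Implicit Types (u nu x t w s r : R).

Lemma Gamma1 : Gamma 1 = 1 :> R.
Proof.
apply: EFin_inj; rewrite -integral_Gamma// -[in RHS](opprK 1) -[- -1]add0r.
apply: (@FTC0y _ (fun x => x `^ (1 - 1) * expR (- x)) (fun x => - expR (- x))).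
- move=> x x0; der; rewrite subrr powRr0; ring.
- by move=> x x0; dcont.
- by move=> x _; rewrite mulr_ge0 ?powR_ge0 ?expR_ge0.
- have c1 : {for 0, continuous (fun x : R => - expR (- x))} by dcont.
  by eapply cvg_eqr; [exact: (cvg_at_right_filter c1)|rewrite oppr0 expR0].
- by rewrite -oppr0; apply: cvgN; exact: cvgr_expR.
Qed.

Lemma integral_pow1D b : 0 < b -> (\int[leb]_(x in Dy) ((1 + x) `^ (- (1 + b)))%:E = (b^-1)%:E)%E.
Proof.
move=> b0; have := @beta_Gamma R 1 b 1 1 ltr01 b0 ltr01 ltr01.
rewrite [1 + b]addrC GammaS// Gamma1 !powR1 !mulr1 mul1r invfM mulrCA divff ?mulr1 ?gt_eqF ?Gamma_gt0// => <-.
by apply: eq_integral => x _; rewrite subrr powRr0 !mul1r.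
Qed.

(** Put u = sqrt (1 + x). At nu = 0 the kernel is 1 / (u^2 (1 + u)), and expanding 1 / (1 + u) in
    powers of 1/u with the last term halved gives the lower bound u^(-3) - u^(-4) + u^(-5) / 2. The
    term with nu pays for (x / (1 + x))^nu, through exp v >= 1 + v and [neg_ln_le]. The integrals of
    the pieces are 2, 1, 1/3 and nu, whence 4/3 - nu in the next lemma. *)
Lemma sqrt_kernel_pointwise nu x : 0 < nu -> 0 < x ->
  (1 + x) `^ (- (1 + 1 / 2)) + 1 / 2 * (1 + x) `^ (- (1 + 3 / 2)) <=
  x `^ (nu - 1) * (1 + x) `^ (- (1 + nu)) * (Num.sqrt (1 + x) - 1) +
  nu / 2 * (x `^ (1 / 2 - 1) * (1 + x) `^ (- (1 / 2 + 1))) + (1 + x) `^ (- (1 + 1)).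
Proof.
move=> nu0 x0; have x1 : 0 < 1 + x by rewrite addr_gt0.
have t0 : 0 < Num.sqrt x by rewrite sqrtr_gt0.
have u0 : 0 < Num.sqrt (1 + x) by rewrite sqrtr_gt0.
have t2 : Num.sqrt x ^+ 2 = x by rewrite sqr_sqrtr// ltW.
have u2 : Num.sqrt (1 + x) ^+ 2 = 1 + x by rewrite sqr_sqrtr// ltW.
have u1 : 1 <= Num.sqrt (1 + x) by rewrite -[leLHS]sqrtr1 ler_wsqrtr//; lra.
have H (k : nat) : (1 + x) `^ (- (k%:R / 2)) = Num.sqrt (1 + x) ^- k.
  by rewrite powRN -half_powR// -powR_mulrn ?powR_ge0// -powRrM; congr (_ `^ _)^-1; field.
have -> : 1 + 1 / 2 = 3%:R / 2 :> R by field.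
have -> : 1 + 3 / 2 = 5%:R / 2 :> R by field.
have -> : 1 / 2 + 1 = 3%:R / 2 :> R by field.
have -> : (1 + x) `^ (- (1 + 1)) = (1 + x) `^ (- (4%:R / 2)) by congr (_ `^ _); field.
rewrite !H.
have -> : x `^ (1 / 2 - 1) = (Num.sqrt x)^-1.
  by rewrite -half_powR// -powRN; congr (_ `^ _); field.
pose z := x / (1 + x).
have z0 : 0 < z by rewrite divr_gt0.
have -> : x `^ (nu - 1) * (1 + x) `^ (- (1 + nu)) = z `^ nu / (Num.sqrt x ^+ 2 * Num.sqrt (1 + x) ^+ 2).
  rewrite t2 u2 -[X in _ / X]powRr1 ?mulr_ge0 ?ltW// -powRN !powE ?divr_gt0 ?mulr_gt0//.
  rewrite ln_div ?posrE// lnM ?posrE// -!expRD; congr expR; ring.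
have hz : 1 - nu * Num.sqrt (1 + x) ^- 2 / Num.sqrt z <= z `^ nu.
  rewrite u2 powE//; apply: le_trans (expR_ge1Dx _); rewrite lerD2l.
  have z1 : z < 1 by rewrite ltr_pdivrMr// mul1r ltrDr.
  have := neg_ln_le z0 z1.
  rewrite (_ : 1 - z = (1 + x)^-1); last by rewrite /z; field; rewrite gt_eqF.
  by move=> h; rewrite -mulrA -mulrN ler_pM2l// lerNl.
have zE : Num.sqrt z = Num.sqrt x / Num.sqrt (1 + x) by rewrite sqrtrM ?(ltW x0)// sqrtrV// ltW.
move: hz; rewrite zE => hz.
have tu : Num.sqrt (1 + x) ^+ 2 = 1 + Num.sqrt x ^+ 2 by rewrite u2 t2.
move: hz t0 u0 u1 tu {t2 u2 zE H}.
set t : R := Num.sqrt x; set u : R := Num.sqrt (1 + x) => hz t0 u0 u1 tu.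
move: (z `^ nu) hz => Z hz.
have v0 : 0 < 1 + u by rewrite addr_gt0.
have -> : Z / (t ^+ 2 * u ^+ 2) * (u - 1) = Z / (u ^+ 2 * (1 + u)).
  have -> : t ^+ 2 = (u - 1) * (1 + u) by rewrite (_ : t ^+ 2 = u ^+ 2 - 1); [ring|rewrite tu; ring].
  have : 1 < u.
    rewrite -(ltr_pXn2r (n:=2))// ?nnegrE ?(ltW u0)// expr1n tu.
    by rewrite ltrDl exprn_gt0.
  by move=> u1'; field; rewrite !gt_eqF// subr_gt0.
apply: (@le_trans _ _ ((1 - nu * u ^- 2 / (t / u)) / (u ^+ 2 * (1 + u)) + nu / 2 * (t^-1 / u ^+ 3) + u ^- 4)); last first.
  by rewrite !lerD2r ler_pM2r// invr_gt0 mulr_gt0// exprn_gt0.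
rewrite -subr_ge0 (_ : _ - _ = (u - 1) / (2 * u ^+ 5 * (1 + u)) + nu * (u - 1) / (2 * t * u ^+ 3 * (1 + u))); last first.
  by field; rewrite !gt_eqF.
have p5 : 0 < u ^+ 5 by rewrite exprn_gt0.
have p3 : 0 < u ^+ 3 by rewrite exprn_gt0.
have v1 : 0 <= u - 1 by rewrite subr_ge0.
have q1 : 0 < 2 * u ^+ 5 * (1 + u) by rewrite !mulr_gt0.
have q2 : 0 < 2 * t * u ^+ 3 * (1 + u) by rewrite !mulr_gt0.
by apply: addr_ge0; apply: divr_ge0 => //; rewrite ?mulr_ge0 ?(ltW nu0)// ltW.
Qed.

Lemma sqrt_kernel_integral nu : 0 < nu ->
  ((4 / 3 - nu)%:E <= \int[leb]_(x in Dy) (x `^ (nu - 1) * (1 + x) `^ (- (1 + nu)) *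
     ((1 + x) `^ (1 / 2) - 1))%:E)%E.
Proof.
move=> nu0.
have P (x : R) : 0 < x -> 1 <= (1 + x) `^ (1 / 2).
  by move=> x0; rewrite -[leLHS](powRr0 (1 + x)) ler_powR//; lra.
have f0 (x : R) : Dy x -> 0 <= x `^ (nu - 1) * (1 + x) `^ (- (1 + nu)) * ((1 + x) `^ (1 / 2) - 1).
  by move=> /DyE x0; rewrite !mulr_ge0 ?powR_ge0// subr_ge0 P.
have h : (\int[leb]_(x in Dy) ((1 + x) `^ (- (1 + 1 / 2)) + 1 / 2 * (1 + x) `^ (- (1 + 3 / 2)))%:E <=
  \int[leb]_(x in Dy) (x `^ (nu - 1) * (1 + x) `^ (- (1 + nu)) * ((1 + x) `^ (1 / 2) - 1) +
  nu / 2 * (x `^ (1 / 2 - 1) * (1 + x) `^ (- (1 / 2 + 1))) + (1 + x) `^ (- (1 + 1)))%:E)%E.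
  apply: le_integral_any => x /DyE x0; rewrite lee_fin half_powR ?addr_gt0//.
  exact: sqrt_kernel_pointwise.
move: h.
rewrite integralD_ge0; [|exact: mDy|by meas|by meas|by move=> x _; exact: powR_ge0|
  by move=> x _; rewrite mulr_ge0 ?powR_ge0].
rewrite integralZ_ge0; [|exact: mDy|by meas|by move=> x _; exact: powR_ge0|by []].
rewrite integralD_ge0; [|exact: mDy|by meas|by meas| |by move=> x _; exact: powR_ge0]; last first.
  by move=> x Dx; rewrite addr_ge0 ?f0// !mulr_ge0 ?powR_ge0 ?(ltW nu0).
rewrite integralD_ge0; [|exact: mDy|by meas|by meas|exact: f0|
  by move=> x _; rewrite !mulr_ge0 ?powR_ge0 ?(ltW nu0)].
rewrite integralZ_ge0; [|exact: mDy|by meas|by move=> x _; rewrite mulr_ge0 ?powR_ge0|by rewrite divr_ge0// ltW].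
rewrite !integral_pow1D//.
have -> : (\int[leb]_(x in Dy) (x `^ (1 / 2 - 1) * (1 + x) `^ (- (1 / 2 + 1)))%:E = 2%:E)%E.
  have h2 : (0 : R) < 1 / 2 by [].
  have := @beta_Gamma R (1 / 2) 1 1 1 h2 ltr01 ltr01 ltr01.
  rewrite GammaS// Gamma1 !powR1 !mulr1 invfM mulrCA divff ?mulr1 ?gt_eqF ?Gamma_gt0//.
  rewrite mul1r invrK => <-.
  by apply: eq_integral => x _; rewrite mul1r.
have : (0 <= \int[leb]_(x in Dy) (x `^ (nu - 1) * (1 + x) `^ (- (1 + nu)) *
    ((1 + x) `^ (1 / 2) - 1))%:E)%E by apply: integral_ge0 => x Dx; rewrite lee_fin f0.
move: (\int[leb]_(x in Dy) _)%E; case=> [r| |] //= _; rewrite ?leey//.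
rewrite -!EFinM -!EFinD !lee_fin; lra.
Qed.

(** Concavity of the square root pulls the ratio w = M0 / (3 M1) out of the integral as a factor;
    the kernel left behind does not depend on the data. *)
Lemma sqrt1D_concave w x : 0 < w <= 1 -> 0 < x ->
  w * ((1 + x) `^ (1 / 2) - 1) <= Num.sqrt (1 + w * x) - 1.
Proof.
move=> /andP[w0 w1] x0; have x1 : 0 < 1 + x by rewrite addr_gt0.
rewrite half_powR//.
have u0 : 0 < Num.sqrt (1 + x) by rewrite sqrtr_gt0.
have u2 : Num.sqrt (1 + x) ^+ 2 = 1 + x by rewrite sqr_sqrtr// ltW.
have u1 : 1 <= Num.sqrt (1 + x) by rewrite -[leLHS]sqrtr1 ler_wsqrtr//; lra.
move: u0 u2 u1; set u : R := Num.sqrt (1 + x) => u0 u2 u1.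
have h : 0 <= 1 + w * (u - 1) by rewrite addr_ge0// mulr_ge0 ?(ltW w0)// subr_ge0.
rewrite -lerBlDr opprK addrC -[leLHS]ger0_norm// -sqrtr_sqr ler_wsqrtr//.
have -> : x = u ^+ 2 - 1 by rewrite u2; ring.
rewrite -subr_ge0 (_ : _ - _ = w * (1 - w) * (u - 1) ^+ 2); last by ring.
by rewrite !mulr_ge0 ?sqr_ge0 ?(ltW w0)// subr_ge0.
Qed.

End KernelIntegral.

(** * Lower bound and finiteness of the mixture integral over the odds r *)

Section KernelBounds.
Context {R : realType}.
Notation leb := (@lebesgue_measure R).
Notation Dy := (`]0%R, +oo[%classic : set R).
Implicit Types (M nu x w s r a b : R).

Definition mixker (d : nat) nu M0 M1 r : R := r `^ (nu - 1) * (1 + r / 2) `^ (- nu) *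
  (3 + r) `^ (d%:R / 2 + nu) * (M0 + r * M1) `^ (- (d%:R + nu)).

(** Coefficient of nu w in the relative gain of the numerator. For d >= 2 the factor 1 / (d - 1)
    comes from the quotient nu / (d - 1) of two beta functions; for d = 1, 127/100 lies just below
    the kernel bound 4/3 - nu. *)
Definition gain (d : nat) nu : R :=
  if d == 1%N then (1 - nu) * (127 / 100) else (1 - nu / 2) / (d%:R - 1).

Lemma meas_mixker d nu M0 M1 : measurable_fun setT (mixker d nu M0 M1).
Proof. by rewrite /mixker; meas. Qed.

Lemma mixker_ge0 d nu M0 M1 r : 0 <= mixker d nu M0 M1 r.
Proof. by rewrite !mulr_ge0 ?powR_ge0. Qed.

(** The affine bound produces the beta integrals with parameters (nu, d) and (nu + 1, d - 1). Their
    quotient is (nu / (d - 1)) (M0 / M1), which is the source of the term linear in nu. *)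
Lemma integral_mixker_ge2 d nu M0 M1 : (2 <= d)%N -> 0 < nu <= 1 -> 0 < M0 -> 0 < M1 ->
  ((3 `^ (d%:R / 2 + nu) * (Gamma nu * Gamma d%:R / Gamma (nu + d%:R) * M0 `^ (- d%:R) *
    M1 `^ (- nu)) * (1 + nu * gain d nu * (M0 / (3 * M1))))%:E <=
   \int[leb]_(r in Dy) (mixker d nu M0 M1 r)%:E)%E.
Proof.
move=> d2 nu01 M00 M10; have /andP[nu0 nu1] := nu01.
have d1 : 0 < d%:R - 1 :> R by rewrite subr_gt0 ltr1n.
have k0 : 0 <= (1 - nu / 2) / 3 by rewrite divr_ge0//; lra.
apply: (@le_trans _ _ (\int[leb]_(r in Dy) (3 `^ (d%:R / 2 + nu) *
   (r `^ (nu - 1) * (M0 + M1 * r) `^ (- (nu + d%:R)) + (1 - nu / 2) / 3 *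
    (r `^ (nu + 1 - 1) * (M0 + M1 * r) `^ (- (nu + 1 + (d%:R - 1)))))%R)%:E)%E); last first.
  apply: le_integral_any => r /DyE r0; rewrite lee_fin.
  rewrite (_ : nu + 1 + (d%:R - 1) = nu + d%:R); last by ring.
  rewrite (_ : nu + 1 - 1 = nu); last by ring.
  have -> : r `^ nu = r * r `^ (nu - 1) by rewrite mulr_powRB1// ltW.
  rewrite [leLHS](_ : _ = 3 `^ (d%:R / 2 + nu) * (1 + (1 - nu / 2) * (r / 3)) *
    (r `^ (nu - 1) * (M0 + M1 * r) `^ (- (nu + d%:R)))); last by field.
  rewrite [leRHS](_ : _ = (1 + r / 2) `^ (- nu) * (3 + r) `^ (d%:R / 2 + nu) *
    (r `^ (nu - 1) * (M0 + M1 * r) `^ (- (nu + d%:R)))); last first.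
    by rewrite /mixker [M1 * r]mulrC [nu + d%:R]addrC; ring.
  by rewrite ler_wpM2r ?mulr_ge0 ?powR_ge0// mixfactor_ge2.
rewrite integralZ_ge0; [|exact: mDy|by meas|by move=> r _; rewrite addr_ge0// ?(mulr_ge0 k0)// mulr_ge0 ?powR_ge0|exact: powR_ge0].
rewrite integralD_ge0; [|exact: mDy|by meas|by meas|by move=> r _; rewrite mulr_ge0 ?powR_ge0|
  by move=> r _; apply: mulr_ge0 => //; rewrite mulr_ge0 ?powR_ge0].
rewrite integralZ_ge0; [|exact: mDy|by meas|by move=> r _; rewrite mulr_ge0 ?powR_ge0|by []].
have d0 : 0 < d%:R :> R by lra.
have nu2 : 0 < nu + 1 by rewrite addr_gt0.
rewrite (beta_Gamma nu0 d0 M00 M10) (beta_Gamma nu2 d1 M00 M10).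
rewrite -EFinM lee_fin.
rewrite (_ : nu + 1 + (d%:R - 1) = nu + d%:R); last by ring.
have -> : Gamma d%:R = (d%:R - 1) * Gamma (d%:R - 1) :> R.
  by rewrite -GammaS// subrK.
rewrite GammaS//.
have -> : M0 `^ (- (d%:R - 1)) = M0 * M0 `^ (- d%:R).
  by rewrite -[X in X * _](powRr1 (ltW M00)) -powRD ?(gt_eqF M00) ?implybT//; congr (_ `^ _); ring.
have -> : M1 `^ (- (nu + 1)) = M1 `^ (- nu) / M1.
  by rewrite -[X in _ / X](powRr1 (ltW M10)) -powRN -powRD ?(gt_eqF M10) ?implybT//; congr (_ `^ _); ring.
have -> : gain d nu = (1 - nu / 2) / (d%:R - 1).
  by rewrite /gain; case: eqP d2 => // ->.
have G0 : Gamma (nu + d%:R) != 0 by rewrite gt_eqF// Gamma_gt0// addr_gt0.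
apply: ler_of_eq.
move: (Gamma nu) (Gamma (d%:R - 1)) (Gamma (nu + d%:R)) G0 => g1 g2 g3 g30.
by field; rewrite g30 !gt_eqF.
Qed.

Lemma integral_mixker_1 nu M0 M1 : 0 < nu <= 1 / 1000 -> 0 < M0 -> 0 < M1 -> M0 <= 3 * M1 ->
  ((3 `^ (1%:R / 2 + nu) * (Gamma nu * Gamma 1%:R / Gamma (nu + 1%:R) * M0 `^ (- 1%:R) *
    M1 `^ (- nu)) * (1 + nu * gain 1 nu * (M0 / (3 * M1))))%:E <=
   \int[leb]_(r in Dy) (mixker 1 nu M0 M1 r)%:E)%E.
Proof.
move=> /andP[nu0 nuk] M00 M10 M01.
have nu1 : nu <= 1 by lra.
pose g r : R := r `^ (nu - 1) * (M0 + M1 * r) `^ (- (nu + 1)).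
pose h r : R := ((1 + r / 3) `^ (1 / 2) - 1) * g r.
have P (r : R) : 0 < r -> 1 <= (1 + r / 3) `^ (1 / 2).
  move=> r0; rewrite -[leLHS](powRr0 (1 + r / 3)) ler_powR//.
  by rewrite lerDl divr_ge0// ltW.
have g0 (r : R) : 0 <= g r by rewrite mulr_ge0 ?powR_ge0.
have h0 (r : R) : 0 < r -> 0 <= h r by move=> r0; rewrite mulr_ge0// subr_ge0 P.
have mg : measurable_fun setT g by rewrite /g; meas.
have mh : measurable_fun setT h by rewrite /h; meas.
apply: (@le_trans _ _ (\int[leb]_(r in Dy) (3 `^ (1 / 2 + nu) * (g r + (1 - nu) * h r))%:E)%E); last first.
  apply: le_integral_any => r /DyE r0; rewrite lee_fin.
  have r3 : 0 < 1 + r / 3 by rewrite addr_gt0// divr_gt0.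
  rewrite [leLHS](_ : _ = 3 `^ (1 / 2 + nu) * (1 + (1 - nu) * (Num.sqrt (1 + r / 3) - 1)) * g r);
    last by rewrite /h half_powR//; ring.
  rewrite [leRHS](_ : _ = (1 + r / 2) `^ (- nu) * (3 + r) `^ (1 / 2 + nu) * g r); last first.
    by rewrite /mixker /g [M1 * r]mulrC [nu + 1]addrC; ring.
  by rewrite ler_wpM2r// mixfactor_ge1// nu0.
have n1 : 0 <= 1 - nu by lra.
rewrite integralZ_ge0; [|exact: mDy|by meas| |exact: powR_ge0]; last first.
  by move=> r /DyE r0; rewrite addr_ge0// mulr_ge0// h0.
rewrite integralD_ge0; [|exact: mDy|by meas|by meas|by []|]; last first.
  by move=> r /DyE r0; rewrite mulr_ge0// h0.
rewrite integralZ_ge0; [|exact: mDy|by meas|by move=> r /DyE; exact: h0|by []].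
have -> : (\int[leb]_(r in Dy) (g r)%:E = (nu^-1 * M0^-1 * M1 `^ (- nu))%:E)%E.
  rewrite /g beta_Gamma// GammaS// Gamma1; congr EFin; rewrite powR_inv1 ?(ltW M00)//.
  have := Gamma_gt0 nu0; move: (Gamma nu) => G G0.
  by field; rewrite !gt_eqF.
pose w := M0 / (3 * M1).
have w0 : 0 < w by rewrite divr_gt0// mulr_gt0.
have w1 : w <= 1 by rewrite ler_pdivrMr ?mulr_gt0// mul1r.
have hh : ((w * M0^-1 * M1 `^ (- nu) * (127 / 100))%:E <= \int[leb]_(r in Dy) (h r)%:E)%E.
  (* Scaling r = (M0 / M1) x turns M0 + M1 r into M0 (1 + x) and 1 + r/3 into 1 + w x. *)
  have c0 : 0 < M0 / M1 by rewrite divr_gt0.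
  have gE (x : R) : 0 < x -> g (M0 / M1 * x) =
      x `^ (nu - 1) * (1 + x) `^ (- (1 + nu)) * (M0^-1 * M1 `^ (- nu)) / (M0 / M1).
    move=> x0; have x1 : 0 < 1 + x by rewrite addr_gt0.
    rewrite /g (_ : M0 + M1 * (M0 / M1 * x) = M0 * (1 + x)); last by field; rewrite gt_eqF.
    rewrite -[M0^-1](powR_inv1 (ltW M00)) -(powR_inv1 (ltW c0)) !powE ?mulr_gt0 ?invr_gt0//.
    rewrite !lnM ?posrE ?mulr_gt0 ?invr_gt0// lnV ?posrE//.
    by rewrite -!expRD; congr expR; ring.
  rewrite (@subst_scale _ h _ c0); first last.
  - exact: h0.
  - move=> r r0; have r3 : 0 < 1 + r / 3 by rewrite addr_gt0// divr_gt0.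
    have m3 : 0 < M0 + M1 * r by rewrite addr_gt0// mulr_gt0.
    by rewrite /h /g; dcont.
  apply: (@le_trans _ _ (\int[leb]_(x in Dy) ((w * M0^-1 * M1 `^ (- nu)) * (x `^ (nu - 1) *
      (1 + x) `^ (- (1 + nu)) * ((1 + x) `^ (1 / 2) - 1)))%:E)%E); last first.
    apply: le_integral_any => x /DyE x0; rewrite lee_fin.
    have x1 : 0 < 1 + x by rewrite addr_gt0.
    have w01 : 0 < w <= 1 by rewrite w0.
    have := sqrt1D_concave w01 x0.
    have m3 : 0 < 1 + M0 / M1 * x / 3 by rewrite addr_gt0// divr_gt0// mulr_gt0.
    rewrite /h (half_powR x1) (half_powR m3).
    rewrite (_ : M0 / M1 * x / 3 = w * x); last by rewrite /w; field; rewrite gt_eqF.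
    rewrite gE//.
    move=> hs.
    rewrite [leLHS](_ : _ = (w * (Num.sqrt (1 + x) - 1)) * (x `^ (nu - 1) * (1 + x) `^ (- (1 + nu)) * (M0^-1 * M1 `^ (- nu)))); last by ring.
    rewrite [leRHS](_ : _ = (Num.sqrt (1 + w * x) - 1) * (x `^ (nu - 1) * (1 + x) `^ (- (1 + nu)) * (M0^-1 * M1 `^ (- nu)))); last by field; rewrite !gt_eqF.
    have q : 0 <= x `^ (nu - 1) * (1 + x) `^ (- (1 + nu)) * (M0^-1 * M1 `^ (- nu)).
      by rewrite !mulr_ge0 ?powR_ge0// invr_ge0 ltW.
    exact: ler_wpM2r.
  have k0 : 0 <= w * M0^-1 * M1 `^ (- nu) by rewrite mulr_ge0 ?powR_ge0// divr_ge0// ltW.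
  rewrite integralZ_ge0; [|exact: mDy|by meas| |by []]; last first.
    move=> x /DyE x0; rewrite !mulr_ge0 ?powR_ge0// subr_ge0.
    by rewrite -[leLHS](powRr0 (1 + x)) ler_powR//; lra.
  rewrite EFinM lee_wpmul2l ?lee_fin//.
  apply: le_trans (sqrt_kernel_integral nu0); rewrite lee_fin; lra.
apply: (@le_trans _ _ ((3 `^ (1 / 2 + nu))%:E * ((nu^-1 * M0^-1 * M1 `^ (- nu))%:E +
   (1 - nu)%:E * (w * M0^-1 * M1 `^ (- nu) * (127 / 100))%:E))%E); last first.
  by rewrite lee_wpmul2l ?lee_fin ?powR_ge0// leeD2l// lee_wpmul2l// lee_fin.
rewrite -EFinM lee_fin GammaS// Gamma1 powR_inv1 ?(ltW M00)// -/w /gain eqxx.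
have := Gamma_gt0 nu0; move: (Gamma nu) => G G0.
apply: ler_of_eq.
by field; rewrite !gt_eqF.
Qed.

Lemma integral_mixker_ge d nu M0 M1 : (0 < d)%N -> 0 < nu <= 1 / 1000 -> 0 < M0 -> 0 < M1 -> M0 <= 3 * M1 ->
  ((3 `^ (d%:R / 2 + nu) * (Gamma nu * Gamma d%:R / Gamma (nu + d%:R) * M0 `^ (- d%:R) *
    M1 `^ (- nu)) * (1 + nu * gain d nu * (M0 / (3 * M1))))%:E <=
   \int[leb]_(r in Dy) (mixker d nu M0 M1 r)%:E)%E.
Proof.
move=> d0 nuk M00 M10 M01; case: d d0 => [//|[|k]] _; first exact: integral_mixker_1.
by apply: integral_mixker_ge2 => //; have /andP[-> ?] /= := nuk; lra.
Qed.

Lemma integral_mixker_fin d nu M0 M1 : (0 < d)%N -> 0 < nu -> 0 < M0 -> 0 < M1 -> M0 <= 3 * M1 ->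
  (\int[leb]_(r in Dy) (mixker d nu M0 M1 r)%:E)%E \is a fin_num.
Proof.
move=> d0 nu0 M00 M10 M01.
rewrite ge0_fin_numE; last by apply: integral_ge0 => r _; rewrite lee_fin mixker_ge0.
(* As M0 <= 3 M1, the linear form M0 + r M1 is at least (M0 / 3) (3 + r), so part of its negative
   power cancels the growing power of 3 + r. The constant [k] bounds 1 + r/2 and the rest below by k
   (1 + r), leaving a beta integrand. *)
pose k := Num.min (1 / 2) (M0 / 3).
have k0 : 0 < k by rewrite lt_min; apply/andP; split; [lra|exact: divr_gt0].
have dd : 0 < d%:R / 2 :> R by rewrite divr_gt0// ltr0n.
apply: (@le_lt_trans _ _ (\int[leb]_(r in Dy) (((M0 / 3) `^ (- (d%:R / 2 + nu)) * k `^ (- (nu + d%:R / 2))) *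
    (r `^ (nu - 1) * (1 + 1 * r) `^ (- (nu + d%:R / 2))))%:E)%E); last first.
  rewrite integralZ_ge0; [|exact: mDy|by meas|by move=> r _; rewrite mulr_ge0 ?powR_ge0|by rewrite mulr_ge0 ?powR_ge0].
  by rewrite beta_Gamma// -EFinM ltry.
apply: le_integral_any => r /DyE r0; rewrite lee_fin.
have r1 : 0 < 1 + r by rewrite addr_gt0.
have r2 : 0 < 1 + r / 2 by rewrite addr_gt0// divr_gt0.
have r3 : 0 < 3 + r by rewrite addr_gt0.
have Mr : 0 < M0 + r * M1 by rewrite addr_gt0// mulr_gt0.
have L a b c : 0 < a -> a <= b -> 0 <= c -> b `^ (- c) <= a `^ (- c).
  move=> a0 ab c0; rewrite !powRN lef_pV2 ?posrE ?powR_gt0//; last exact: lt_le_trans ab.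
  by rewrite ge0_ler_powR// nnegrE ltW//; exact: lt_le_trans ab.
have kh : k <= 1 / 2 by rewrite ge_min lexx.
have kM : k <= M0 / 3 by rewrite ge_min lexx orbT.
have e1 : (1 + r / 2) `^ (- nu) <= (k * (1 + r)) `^ (- nu).
  apply: L; rewrite ?mulr_gt0 ?(ltW nu0)//.
  apply: (@le_trans _ _ (1 / 2 * (1 + r))); first by rewrite ler_pM2r.
  lra.
have MM : M0 / 3 * (3 + r) <= M0 + r * M1.
  by have : M0 / 3 * r <= M1 * r; [rewrite ler_pM2r//; lra|nra].
have e2 : (M0 + r * M1) `^ (- (d%:R / 2)) <= (k * (1 + r)) `^ (- (d%:R / 2)).
  apply: L; rewrite ?mulr_gt0 ?(ltW dd)//; apply: le_trans MM.
  by apply: ler_pM; rewrite ?(ltW k0) ?(ltW r1)//; lra.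
have e3 : (M0 + r * M1) `^ (- (d%:R / 2 + nu)) <= (M0 / 3 * (3 + r)) `^ (- (d%:R / 2 + nu)).
  by apply: L => //; rewrite ?mulr_gt0 ?divr_gt0 ?addr_ge0 ?(ltW dd) ?(ltW nu0).
apply: (@le_trans _ _ (r `^ (nu - 1) * (k * (1 + r)) `^ (- nu) * (3 + r) `^ (d%:R / 2 + nu) *
   ((M0 / 3 * (3 + r)) `^ (- (d%:R / 2 + nu)) * (k * (1 + r)) `^ (- (d%:R / 2))))).
  rewrite /mixker (_ : - (d%:R + nu) = - (d%:R / 2 + nu) + - (d%:R / 2)); last by field.
  rewrite [(M0 + r * M1) `^ _]powRD ?(gt_eqF Mr) ?implybT//.
  have e4 := ler_pM (powR_ge0 _ _) (powR_ge0 _ _) e3 e2.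
  apply: ler_pM e4; rewrite ?mulr_ge0 ?powR_ge0//.
  by rewrite ler_wpM2r ?powR_ge0// ler_wpM2l ?powR_ge0.
apply: ler_of_eq; rewrite mul1r.
rewrite !powE ?mulr_gt0 ?divr_gt0// !lnM ?posrE ?divr_gt0 ?invr_gt0//.
by rewrite -!expRD; congr expR; field.
Qed.

End KernelBounds.

(** * Closed forms of the marginals and the pointwise bound on the log-ratio *)

Section BayesRatio.
Context {R : realType}.
Notation leb := (@lebesgue_measure R).
Notation Dy := (`]0%R, +oo[%classic : set R).
Notation D1 := (`]0%R, 1%R[%classic : set R).
Variables (d : nat) (d0 : (0 < d)%N).
Implicit Types (nu s w : R) (x y : 'rV[R]_d).

Definition quadA x s : R := 2 * sqnorm x + s.
Definition quadT y x s : R := sqnorm y + 2 * sqnorm x + s.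
Definition quadS y x s : R := s + 2 / 3 * sqnorm (y - x).

Lemma quadA_ge x s : s <= quadA x s.
Proof. by rewrite lerDr mulr_ge0// sqnorm_ge0. Qed.

Lemma quadS_ge y x s : s <= quadS y x s.
Proof. by rewrite lerDl mulr_ge0// sqnorm_ge0. Qed.

Lemma quadAT y x s : quadA x s <= quadT y x s.
Proof. by rewrite lerD2r lerDr sqnorm_ge0. Qed.

(** T - S is three times the squared norm of the mean (2 x + y) / 3 of the three observations. *)
Lemma quadST y x s : quadS y x s <= quadT y x s.
Proof.
rewrite /quadS addrC lerD2r /sqnorm !mulr_sumr -big_split/=; apply: ler_sum => i _.
rewrite !mxE -subr_ge0 (_ : _ - _ = (y ord0 i + 2 * x ord0 i) ^+ 2 / 3); last by field.
by rewrite divr_ge0 ?sqr_ge0.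
Qed.

Lemma quadA_gt0 x s : 0 < s -> 0 < quadA x s.
Proof. by move=> s0; exact: lt_le_trans (quadA_ge x s). Qed.

Lemma quadS_gt0 y x s : 0 < s -> 0 < quadS y x s.
Proof. by move=> s0; exact: lt_le_trans (quadS_ge y x s). Qed.

Lemma quadT_gt0 y x s : 0 < s -> 0 < quadT y x s.
Proof. by move=> s0; apply: lt_le_trans (quadAT y x s); exact: quadA_gt0. Qed.

Let dd : 0 < d%:R / 2 :> R. Proof. by rewrite divr_gt0// ltr0n. Qed.

Definition marg_const s : R := pi `^ (- (d%:R / 2)) * s `^ (d%:R / 2 - 1) /
  (2 `^ (d%:R / 2) * Gamma (d%:R / 2)).

Lemma marg_const_gt0 s : 0 < s -> 0 < marg_const s.
Proof.
by move=> s0; rewrite divr_gt0 ?mulr_gt0 ?powR_gt0 ?pi_gt0// Gamma_gt0.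
Qed.

Lemma bayes_denE nu x s : 0 < nu -> 0 < s ->
  bayes_den 2 (@prior_GM R 2 d nu) x s = (marg_const s * 2 `^ (d%:R / 2 + nu + nu) *
    (Gamma nu * Gamma (d%:R / 2) * (2 * s) `^ (- (d%:R / 2)) * quadA x s `^ (- nu)))%:E.
Proof.
move=> nu0 s0.
transitivity (\int[leb]_(r in Dy) (marg_const s * (Gamma (d%:R / 2 + nu) * 2 `^ (d%:R / 2 + nu)) * 2 `^ nu *
    (r `^ (nu - 1) * (2 * s + quadA x s * r) `^ (- (nu + d%:R / 2))))%:E)%E.
  transitivity (\int[leb]_(eta in Dy) vec_int (fun mu => (lik 0 s x 0 eta mu)%:E *
     \int[leb]_(lam in D1) (latent nu eta lam mu)%:E))%E.
    apply: eq_integral => eta _; apply: eq_iint => t _; congr (_%:E * _)%E.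
    by rewrite /lik mul0r oppr0 powRr0 !mul0r expR0 !mul1r.
  rewrite (@bayes_integral R d nu 0 s x 0 d0 nu0 (lexx 0) s0).
  apply: eq_integral => r; rewrite inE => /DyE r0; congr EFin.
  rewrite !mul0r oppr0 powRr0 add0r !mul1r -/(marg_const s).
  (* With no factor from [y], the power nu of 2 + r cancels (1 + r/2)^(-nu) up to 2^nu. This is the
     purpose of the factor (1 - lambda/2)^(-nu) in the prior: the denominator becomes an exact beta
     integral. *)
  rewrite (_ : 0 + 2 + r = 2 * (1 + r / 2)); last by field.
  rewrite (_ : M0 0 s x 0 + r * M1 0 s x 0 = 2 * s + quadA x s * r); last first.
    by rewrite /M0 /M1 /quadA; ring.
  rewrite (_ : d%:R / 2 + nu - d%:R / 2 = nu); last by ring.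
  have r1 : 0 < 1 + r / 2 by rewrite addr_gt0// divr_gt0.
  rewrite powRM ?(ltW r1)// [nu + d%:R / 2]addrC powRN.
  by field; rewrite gt_eqF// powR_gt0.
have G0 : 0 < Gamma (nu + d%:R / 2) by rewrite Gamma_gt0// addr_gt0.
rewrite integralZ_ge0; [|exact: mDy|by meas|by move=> r _; rewrite mulr_ge0 ?powR_ge0|]; last first.
  apply: mulr_ge0; rewrite ?powR_ge0//; apply: mulr_ge0; first exact/ltW/marg_const_gt0.
  by rewrite mulr_ge0 ?powR_ge0// addrC ltW.
have s2 : 0 < 2 * s by rewrite mulr_gt0.
rewrite (beta_Gamma nu0 dd s2 (quadA_gt0 x s0)) -EFinM; congr EFin.
rewrite [2 `^ (d%:R / 2 + nu + nu)]powRD; last by rewrite pnatr_eq0 implybT.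
rewrite [d%:R / 2 + nu]addrC.
by move: (Gamma (nu + _)) G0 => g g0; field; rewrite gt_eqF.
Qed.

Lemma bayes_numE nu y x s : 0 < nu -> 0 < s ->
  bayes_num 2 (@prior_GM R 2 d nu) y x s = (((2 * pi) `^ (- (d%:R / 2)) * marg_const s *
    (Gamma (nu + d%:R) * 2 `^ (nu + d%:R)))%:E *
    (\int[leb]_(r in Dy) (mixker d nu (3 * quadS y x s) (quadT y x s) r)%:E))%E.
Proof.
move=> nu0 s0.
have dn : 0 < nu + d%:R by rewrite addr_gt0// ltr0n.
rewrite -integralZ_ge0; [|exact: mDy|exact: meas_mixker|by move=> r _; exact: mixker_ge0|]; last first.
  by rewrite mulr_ge0// mulr_ge0 ?powR_ge0 ?(ltW (marg_const_gt0 s0)) ?(ltW (Gamma_gt0 dn)).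
transitivity (\int[leb]_(eta in Dy) vec_int (fun mu => (lik 1 s x y eta mu)%:E *
   \int[leb]_(lam in D1) (latent nu eta lam mu)%:E))%E.
  apply: eq_integral => eta _; apply: eq_iint => t _; congr (_%:E * _)%E.
  by rewrite /lik mul1r mulN1r.
rewrite (@bayes_integral R d nu 1 s x y d0 nu0 ler01 s0).
apply: eq_integral => r; rewrite inE => /DyE r0; congr EFin.
rewrite !mul1r /mixker.
rewrite (_ : (1 + 1) * d%:R / 2 + nu = nu + d%:R); last by field.
rewrite (_ : nu + d%:R - d%:R / 2 = d%:R / 2 + nu); last by field.
rewrite (_ : 1 + 2 + r = 3 + r); last by ring.
rewrite (_ : M0 1 s x y + r * M1 1 s x y = 3 * quadS y x s + r * quadT y x s); last first.
  by rewrite /M0 /M1 /quadS /quadT; field.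
rewrite [d%:R + nu]addrC /marg_const; ring.
Qed.

(** Slightly below [gain] at nu = 0 (63/50 against 127/100, and 99/100 against 1 over d - 1); the
    slack is spent in [log_gain_le]. *)
Definition log_gain : R := if d == 1%N then 63 / 50 else 99 / 100 / (d%:R - 1).

Lemma bayes_den_gt0 nu x s : 0 < nu -> 0 < s ->
  exists2 D : R, 0 < D & bayes_den 2 (@prior_GM R 2 d nu) x s = D%:E.
Proof.
move=> nu0 s0; rewrite bayes_denE//; eexists; last by [].
apply: mulr_gt0; first by apply: mulr_gt0; [exact: marg_const_gt0|exact: powR_gt0].
have s2 : 0 < 2 * s by rewrite mulr_gt0.
have A0 := quadA_gt0 x s0.
by rewrite mulr_gt0 ?powR_gt0// mulr_gt0 ?powR_gt0// mulr_gt0// Gamma_gt0.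
Qed.

Lemma bayes_num_fin nu y x s : 0 < nu -> 0 < s ->
  exists2 N : R, 0 <= N & bayes_num 2 (@prior_GM R 2 d nu) y x s = N%:E.
Proof.
move=> nu0 s0; rewrite bayes_numE//.
have fi : (\int[leb]_(r in Dy) (mixker d nu (3 * quadS y x s) (quadT y x s) r)%:E)%E \is a fin_num.
  by apply: integral_mixker_fin; rewrite ?mulr_gt0 ?quadS_gt0 ?quadT_gt0// ler_pM2l// quadST.
have : (0 <= \int[leb]_(r in Dy) (mixker d nu (3 * quadS y x s) (quadT y x s) r)%:E)%E.
  by apply: integral_ge0 => r _; rewrite lee_fin mixker_ge0.
rewrite -(fineK fi) lee_fin => h; eexists; last by rewrite -EFinM.
have dn : 0 < nu + d%:R by rewrite addr_gt0// ltr0n.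
by rewrite mulr_ge0// mulr_ge0// mulr_ge0 ?powR_ge0 ?(ltW (marg_const_gt0 s0)) ?(ltW (Gamma_gt0 dn)).
Qed.

Lemma best_equivE y x s : 0 < s -> best_equiv 2 y x s =
  Gamma d%:R / Gamma (d%:R / 2) * (2 / (3 * pi)) `^ (d%:R / 2) * s `^ (d%:R / 2) *
  quadS y x s `^ (- d%:R).
Proof.
move=> s0; have S0 := quadS_gt0 y x s0; have p0 := @pi_gt0 R.
rewrite /best_equiv /= mul1n (_ : (2 * d)%:R / 2 = d%:R :> R); last by rewrite natrM; field.
rewrite (_ : 1 + _ = quadS y x s / s); last by rewrite /quadS; field; rewrite gt_eqF.
rewrite (_ : (pi * s)^-1 * _ = 2 / (3 * pi) / s); last first.
  by move: (pi : R) p0 => p p0; field; rewrite !gt_eqF.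
have q0 : 0 < 2 / (3 * pi) :> R by rewrite divr_gt0// mulr_gt0.
move: (2 / (3 * pi)) q0 => q q0; rewrite -[LHS]mulrA -[RHS]mulrA -[RHS]mulrA; congr (_ * _).
rewrite !powE ?divr_gt0// !ln_div ?posrE//.
by rewrite -!expRD; congr expR; field.
Qed.

Lemma best_equiv_gt0 y x s : 0 < s -> 0 < best_equiv 2 y x s.
Proof.
move=> s0; have S0 := quadS_gt0 y x s0; have p0 := @pi_gt0 R; rewrite best_equivE//.
have dn : 0 < d%:R :> R by rewrite ltr0n.
have q0 : 0 < 2 / (3 * pi) :> R by rewrite divr_gt0// mulr_gt0.
by rewrite mulr_gt0 ?powR_gt0// mulr_gt0 ?powR_gt0// mulr_gt0 ?powR_gt0// divr_gt0// Gamma_gt0.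
Qed.

Lemma gain_ge0 nu : 0 < nu <= 1 / 1000 -> 0 <= gain d nu.
Proof.
move=> /andP[nu0 nuk]; rewrite /gain; case: eqP => [_|d1]; first by lra.
have d2 : 1 <= d%:R :> R by rewrite ler1n.
by rewrite divr_ge0//; lra.
Qed.

(** The leading term of the numerator bound divided by the exact denominator is p_R ((3/2) A /
    T)^nu: T^(-nu) comes from the numerator, A^(-nu) from the denominator, and all gamma factors
    cancel except those of p_R. *)
Lemma bayes_pred_ge nu y x s : 0 < nu <= 1 / 1000 -> 0 < s ->
  best_equiv 2 y x s * (3 / 2 * (quadA x s / quadT y x s)) `^ nu *
    (1 + nu * gain d nu * (quadS y x s / quadT y x s)) <=
  bayes_pred 2 (@prior_GM R 2 d nu) y x s.
Proof.
move=> nuk s0; have /andP[nu0 _] := nuk.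
have S0 := quadS_gt0 y x s0; have T0 := quadT_gt0 y x s0; have A0 := quadA_gt0 x s0.
have ST : 3 * quadS y x s <= 3 * quadT y x s by rewrite ler_pM2l// quadST.
have S30 : 0 < 3 * quadS y x s by rewrite mulr_gt0.
have := integral_mixker_ge d0 nuk S30 T0 ST.
have := integral_mixker_fin d0 nu0 S30 T0 ST.
rewrite /bayes_pred bayes_denE// bayes_numE//.
case: (\int[leb]_(r in Dy) _)%E => [I _ /=| |]//; rewrite lee_fin => hI.
have dn : 0 < d%:R :> R by rewrite ltr0n.
have Gd := Gamma_gt0 dn; have Gh := Gamma_gt0 dd; have Gn := Gamma_gt0 nu0.
have Gnd : 0 < Gamma (nu + d%:R) by rewrite Gamma_gt0// addr_gt0.
have C0 := marg_const_gt0 s0; have p0 := @pi_gt0 R.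
have den0 : 0 < marg_const s * 2 `^ (d%:R / 2 + nu + nu) *
    (Gamma nu * Gamma (d%:R / 2) * (2 * s) `^ (- (d%:R / 2)) * quadA x s `^ (- nu)).
  apply: mulr_gt0; first by apply: mulr_gt0; [|exact: powR_gt0].
  have s2 : 0 < 2 * s by rewrite mulr_gt0.
  by rewrite mulr_gt0 ?powR_gt0// mulr_gt0 ?powR_gt0// mulr_gt0// Gamma_gt0.
rewrite ler_pdivlMr//.
set C := (X in _ <= X * I).
have CC0 : 0 < C.
  rewrite /C; apply: mulr_gt0; last by apply: mulr_gt0 => //; rewrite powR_gt0.
  by apply: mulr_gt0 => //; rewrite powR_gt0// mulr_gt0.
have := ler_wpM2l (ltW CC0) hI; apply: le_trans.
rewrite [X in 1 + nu * _ * X](_ : quadS y x s / quadT y x s = 3 * quadS y x s / (3 * quadT y x s)); last first.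
  by field; rewrite gt_eqF.
rewrite [leRHS]mulrA [leLHS]mulrAC; apply: ler_wpM2r.
  by rewrite addr_ge0// mulr_ge0 ?mulr_ge0 ?gain_ge0 ?(ltW nu0)// ?invr_ge0 ?mulr_ge0 ?(ltW S0) ?(ltW T0).
apply: ler_of_eq.
rewrite best_equivE// /C.
move: (marg_const s) C0 (quadS y x s) S0 (quadT y x s) T0 (quadA x s) A0 => c c0 S S0 T T0 A A0.
move: (Gamma d%:R) (Gamma (d%:R / 2)) (Gamma nu) (Gamma (nu + d%:R)) Gd Gh Gn Gnd => g1 g2 g3 g4 g10 g20 g30 g40.
rewrite [LHS](_ : _ = c * g1 * g3 * ((2 / (3 * pi)) `^ (d%:R / 2) * s `^ (d%:R / 2) * S `^ (- d%:R) *
   (3 / 2 * (A / T)) `^ nu * 2 `^ (d%:R / 2 + nu + nu) * (2 * s) `^ (- (d%:R / 2)) * A `^ (- nu))); last first.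
  by field; rewrite gt_eqF.
rewrite [RHS](_ : _ = c * g1 * g3 * ((2 * pi) `^ (- (d%:R / 2)) * 2 `^ (nu + d%:R) *
   3 `^ (d%:R / 2 + nu) * (3 * S) `^ (- d%:R) * T `^ (- nu))); last first.
  by field; rewrite gt_eqF.
congr (_ * _).
rewrite !powE ?divr_gt0 ?mulr_gt0 ?divr_gt0 ?invr_gt0//.
rewrite !lnM ?posrE ?divr_gt0 ?mulr_gt0 ?divr_gt0 ?invr_gt0 ?mulr_gt0// !lnV ?posrE ?mulr_gt0// !lnM ?posrE//.
by rewrite -!expRD; congr expR; field.
Qed.

Lemma bayes_pred_gt0 nu y x s : 0 < nu <= 1 / 1000 -> 0 < s ->
  0 < bayes_pred 2 (@prior_GM R 2 d nu) y x s.
Proof.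
move=> nuk s0; have /andP[nu0 _] := nuk; apply: lt_le_trans (bayes_pred_ge y x nuk s0).
have S0 := quadS_gt0 y x s0; have T0 := quadT_gt0 y x s0; have A0 := quadA_gt0 x s0.
apply: mulr_gt0; first by rewrite mulr_gt0 ?best_equiv_gt0// powR_gt0// mulr_gt0// divr_gt0.
by rewrite ltr_pwDl// mulr_ge0 ?mulr_ge0 ?gain_ge0 ?invr_ge0 ?(ltW nu0) ?(ltW S0) ?(ltW T0).
Qed.

(** From ln (1 + z) >= z / (1 + z) with z <= nu gain. The gap between [gain] and [log_gain] absorbs
    the denominator 1 + z as well as the factors 1 - nu and 1 - nu/2; this is where the numerical
    size of nu matters. *)
Lemma log_gain_le nu w : 0 < nu <= 1 / 1000 -> 0 < w <= 1 ->
  nu * (log_gain * w) <= ln (1 + nu * gain d nu * w).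
Proof.
move=> nuk /andP[w0 w1]; have /andP[nu0 nu1] := nuk.
have g0 := gain_ge0 nuk.
have z0 : 0 <= nu * gain d nu * w by rewrite !mulr_ge0// ltW.
have z1 : 0 < 1 + nu * gain d nu * w by rewrite ltr_pwDl.
apply: le_trans (ln_ge z1).
rewrite (_ : 1 - _ = nu * w * (gain d nu / (1 + nu * gain d nu * w))); last by field; rewrite gt_eqF.
rewrite [leLHS](_ : _ = nu * w * log_gain); last by ring.
rewrite ler_wpM2l ?mulr_ge0 ?(ltW nu0) ?(ltW w0)// ler_pdivlMr//.
have zk : nu * gain d nu * w <= nu * gain d nu by rewrite ler_piMr// mulr_ge0// ltW.
apply: (@le_trans _ _ (log_gain * (1 + nu * gain d nu))).
  rewrite ler_wpM2l ?lerD2l// /log_gain; case: eqP => [_|d1]; first by lra.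
  have d2 : 1 <= d%:R :> R by rewrite ler1n.
  by rewrite divr_ge0//; lra.
rewrite /gain /log_gain; case: eqP => [_|d1]; first by nra.
have d2 : 2 <= d%:R :> R by rewrite ler_nat; case: (d) d0 d1 => [|[|]].
have e0 : 0 < d%:R - 1 :> R by lra.
have e1 : 0 < ((d%:R - 1)^-1 : R) <= 1 by rewrite invr_gt0 e0/= invf_le1//; lra.
move: ((d%:R - 1)^-1) e1 => e /andP[e2 e3].
rewrite [leLHS](_ : _ = e * (99 / 100 * (1 + nu * (1 - nu / 2) * e))); last by ring.
rewrite [leRHS]mulrC ler_pM2l//.
have : nu * (1 - nu / 2) * e <= nu * (1 - nu / 2) by rewrite ler_piMr// mulr_ge0 ?(ltW nu0)//; lra.
by nra.
Qed.

Lemma log_bayes_pred_ge nu y x s : 0 < nu <= 1 / 1000 -> 0 < s ->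
  ln (best_equiv 2 y x s) + nu * (ln (3 / 2) - ln (quadT y x s / quadA x s) +
    log_gain * (quadS y x s / quadT y x s)) <=
  ln (bayes_pred 2 (@prior_GM R 2 d nu) y x s).
Proof.
move=> nuk s0; have /andP[nu0 _] := nuk.
have S0 := quadS_gt0 y x s0; have T0 := quadT_gt0 y x s0; have A0 := quadA_gt0 x s0.
have b0 := best_equiv_gt0 y x s0.
have w01 : 0 < quadS y x s / quadT y x s <= 1.
  by rewrite divr_gt0//= ler_pdivrMr// mul1r quadST.
have hg := log_gain_le nuk w01.
have /andP[w0 w1] := w01.
have z1 : 0 < 1 + nu * gain d nu * (quadS y x s / quadT y x s).
  by rewrite ltr_pwDl// mulr_ge0 ?(ltW w0)// mulr_ge0 ?gain_ge0// ltW.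
have q0 : 0 < 3 / 2 * (quadA x s / quadT y x s) by rewrite mulr_gt0// divr_gt0.
apply: (@le_trans _ _ (ln (best_equiv 2 y x s * (3 / 2 * (quadA x s / quadT y x s)) `^ nu *
    (1 + nu * gain d nu * (quadS y x s / quadT y x s))))); last first.
  rewrite ler_ln ?posrE ?bayes_pred_gt0//; first exact: bayes_pred_ge.
  by apply: mulr_gt0 => //; apply: mulr_gt0 => //; exact: powR_gt0.
have p0 := powR_gt0 nu q0.
have bp0 := mulr_gt0 b0 p0.
have lnq : ln (3 / 2 * (quadA x s / quadT y x s)) = ln (3 / 2) - ln (quadT y x s / quadA x s).
  by rewrite [LHS]lnM ?posrE ?divr_gt0// -lnV ?posrE ?divr_gt0// invf_div.
rewrite (lnM bp0 z1) (lnM b0 p0) ln_powR lnq; lra.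
Qed.

End BayesRatio.

(** * Moments under the model *)

Section OneDimMoments.
Context {R : realType}.
Notation leb := (@lebesgue_measure R).
Notation Dy := (`]0%R, +oo[%classic : set R).
Implicit Types (f g : R -> R) (a b c v p u eta : R).

Definition has_int f v := leb.-integrable [set: R] (EFin \o f) /\
  (\int[leb]_(x in [set: R]) (f x)%:E = v%:E)%E.

Lemma has_int_ge0 f v : measurable_fun setT f -> (forall x, 0 <= f x) ->
  (\int[leb]_(x in [set: R]) (f x)%:E = v%:E)%E -> has_int f v.
Proof.
move=> mf f0 fv; split => //; apply/integrableP; split; first exact/measurable_EFinP.
under eq_integral do rewrite gee0_abs ?lee_fin//.
by rewrite fv ltry.
Qed.

Lemma has_int_eq f g v w : has_int f v -> f =1 g -> v = w -> has_int g w.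
Proof. by move=> h fg <-; rewrite (_ : g = f)//; apply/funext => x; rewrite fg. Qed.

Lemma has_intZ f v (k : R) : has_int f v -> has_int (fun x => k * f x) (k * v).
Proof.
move=> [fi fv]; split; last first.
  by under eq_integral do rewrite EFinM; rewrite integralZl// fv.
rewrite (_ : _ \o _ = fun x => k%:E * (EFin \o f) x)%E; last by apply/funext => x; rewrite /= EFinM.
exact: integrableZl.
Qed.

Lemma has_intD f g v w : has_int f v -> has_int g w -> has_int (fun x => f x + g x) (v + w).
Proof.
move=> [fi fv] [gi gv]; split; last first.
  by under eq_integral do rewrite EFinD; rewrite integralD// fv gv.
rewrite (_ : _ \o _ = (EFin \o f) \+ (EFin \o g))%E; last by apply/funext => x; rewrite /= EFinD.
exact: integrableD.
Qed.

Lemma has_int_le f g v w : has_int f v -> has_int g w -> (forall x, f x <= g x) -> v <= w.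
Proof.
move=> [_ fv] [_ gw] fg; rewrite -lee_fin -fv -gw.
by apply: le_integral_any => x _; rewrite lee_fin.
Qed.

Lemma has_int_dom f g v : measurable_fun setT f -> has_int g v -> (forall x, `|f x| <= g x) ->
  exists w, has_int f w.
Proof.
move=> mf [gi gv] fg.
have fi : leb.-integrable [set: R] (EFin \o f).
  apply: (le_integrable measurableT _ _ gi); first exact/measurable_EFinP.
  by move=> x _ /=; rewrite lee_fin (le_trans (fg x))// ler_norm.
exists (fine (\int[leb]_(x in [set: R]) (f x)%:E)%E); split => //.
by rewrite fineK//; exact: integrable_fin_num.
Qed.

Section GaussianMoments.
Variables (a b c : R) (a0 : 0 < a).
Let m := b / a.
Let e u := expR (- (a * u ^+ 2 - 2 * b * u + c)).
Let W := (pi / a) `^ (1 / 2) * expR (b ^+ 2 / a - c).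

Let W0 : 0 < W.
Proof. by rewrite mulr_gt0 ?expR_gt0// powR_gt0// divr_gt0// pi_gt0. Qed.

Let eint : has_int e W.
Proof. exact: integral_gauss. Qed.

Let me : measurable_fun setT e. Proof. by rewrite /e; meas. Qed.

Let dom2 : exists v, has_int (fun u => (u - m) ^+ 2 * e u) v.
Proof.
(* The dominating function is the Gaussian with the same centre and half the precision: v <= exp v
   with v = a (u - m)^2 / 2 absorbs the square. *)
have a2 : 0 < a / 2 by rewrite divr_gt0.
have h := has_intZ (2 / a) (integral_gauss (b / 2) (c - b ^+ 2 / (2 * a)) a2 : has_int _ _).
apply: (has_int_dom _ h); first by meas.
move=> u; rewrite (ger0_norm (mulr_ge0 (sqr_ge0 _) (expR_ge0 _))) -/(e u).
set E := expR (- (a / 2 * _ - _ + _)).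
have -> : e u = E * expR (- (a * (u - m) ^+ 2 / 2)).
  by rewrite /e -expRD; congr expR; rewrite /m; field; rewrite gt_eqF.
rewrite mulrCA [leRHS]mulrC ler_pM2l ?expR_gt0// expRN ler_pdivrMr ?expR_gt0//.
have := expR_ge1Dx (a * (u - m) ^+ 2 / 2).
have k0 : 0 < 2 / a by rewrite divr_gt0.
rewrite -(ler_pM2l k0); apply: le_trans.
rewrite [leRHS](_ : _ = 2 / a + (u - m) ^+ 2); last by field; rewrite gt_eqF.
by rewrite lerDr divr_ge0// ltW.
Qed.

(* Integrating [1 + B (u - m) <= exp (B (u - m))] gives [B M <= O(B^2)]. *)
Lemma gauss_moment1 : has_int (fun u => (u - m) * e u) 0.
Proof.
have [M2 h2] := dom2.
have [M h1] : exists v, has_int (fun u => (u - m) * e u) v.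
  apply: (has_int_dom _ (has_intD eint h2)); first by meas.
  move=> u; rewrite normrM (ger0_norm (expR_ge0 _)) -/(e u).
  rewrite [leRHS](_ : _ = (1 + (u - m) ^+ 2) * e u); last by ring.
  rewrite ler_wpM2r ?expR_ge0//.
  by rewrite -real_normK ?num_real//; have := sqr_ge0 (`|u - m| - 1); nra.
have key (B : R) : B * M <= W * (expR (B ^+ 2 / (4 * a)) - 1).
  have hB : has_int (fun u => expR (- (a * u ^+ 2 - 2 * (b + B / 2) * u + (c + B * m)))) (W * expR (B ^+ 2 / (4 * a))).
    apply: has_int_eq (integral_gauss _ _ a0) _ _ => //.
    rewrite /W -mulrA -expRD; congr (_ * expR _); rewrite /m; field; rewrite gt_eqF//.
  have := has_int_le (has_intD eint (has_intZ B h1)) hB.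
  move=> /(_ _) h; rewrite mulrBr mulr1 lerBrDl; apply: h => u.
  rewrite (_ : expR _ = expR (B * (u - m)) * e u); last by rewrite -expRD; congr expR; field.
  rewrite (_ : _ + _ = (1 + B * (u - m)) * e u); last by ring.
  by rewrite ler_wpM2r ?expR_ge0// expR_ge1Dx.
have [M0|M0] := eqVneq M 0; first by rewrite -M0.
exfalso; clearbody W.
have MM : 0 < M ^+ 2 by rewrite exprn_even_gt0.
(* The test value is B = ep M. Taking ep = 2a / D gives at once ep < 1, ep M^2 <= 2a (so z <= 1/2
   and exp z - 1 <= 2 z) and ep W < 2a, which contradicts [key]. *)
pose D := W + M ^+ 2 + 2 * a.
have D0 : 0 < D by rewrite !addr_gt0// mulr_gt0.
pose ep := 2 * a / D.
have ep0 : 0 < ep by rewrite divr_gt0// mulr_gt0.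
have epD : ep * D = 2 * a by rewrite /ep; field; rewrite gt_eqF.
have ep1 : ep < 1.
  by rewrite ltr_pdivrMr// mul1r -[ltLHS]add0r ltrD2r addr_gt0.
clearbody ep.
pose z := (ep * M) ^+ 2 / (4 * a).
have zE : z * (4 * a) = ep * (ep * M ^+ 2) by rewrite /z; field; rewrite gt_eqF.
have z0 : 0 <= z by rewrite divr_ge0 ?sqr_ge0// mulr_ge0// ltW.
have q1 : 0 < ep * W by rewrite mulr_gt0.
have q2 : 0 < ep * M ^+ 2 by rewrite mulr_gt0.
have q3 : ep * W + ep * M ^+ 2 + ep * (2 * a) = 2 * a by rewrite -[RHS]epD /D; ring.
have q4 : 0 < ep * (2 * a) by rewrite mulr_gt0// mulr_gt0.
have zh : z <= 1 / 2.
  have : ep * (ep * M ^+ 2) <= 1 * (2 * a) by apply: ler_pM; rewrite ?(ltW ep0) ?(ltW q2) ?(ltW ep1)//; lra.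
  by rewrite -zE; nra.
have ez : expR z - 1 <= 2 * z.
  have := expR_ge1Dx (- z); rewrite expRN => h.
  have ez0 := expR_gt0 z.
  have : (1 - z) * expR z <= 1 by rewrite -ler_pdivlMr// mul1r.
  nra.
have := key (ep * M); rewrite -/z -mulrA -expr2 => h.
have : ep * M ^+ 2 * (4 * a) <= W * (2 * z) * (4 * a).
  rewrite ler_pM2r ?mulr_gt0//; apply: le_trans h _.
  by rewrite ler_wpM2l// ltW.
rewrite [leRHS](_ : _ = 2 * W * (z * (4 * a))); last by ring.
rewrite zE [leRHS](_ : _ = ep * M ^+ 2 * (2 * (ep * W))); last by ring.
rewrite ler_pM2l//; lra.
Qed.

(* From [1 - exp (- t (u - m)^2) <= t (u - m)^2] as [t] tends to 0. *)
Lemma gauss_moment2 : exists2 v, has_int (fun u => (u - m) ^+ 2 * e u) v & W / (2 * a) <= v.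
Proof.
have [M h2] := dom2; exists M => //.
have key (t : R) : 0 < t -> W / (2 * (a + t)) <= M.
  move=> t0; have at0 : 0 < a + t by rewrite addr_gt0.
  pose z := (a / (a + t)) `^ (1 / 2).
  have z2 : z ^+ 2 = a / (a + t).
    by rewrite /z -powR_mulrn ?powR_ge0// -powRrM mul1r mulVf// powRr1// divr_ge0// ltW.
  have ht : has_int (fun u => expR (- ((a + t) * u ^+ 2 - 2 * (b + t * m) * u + (c + t * m ^+ 2)))) (W * z).
    apply: has_int_eq (integral_gauss _ _ at0) _ _ => //.
    rewrite /W /z [RHS]mulrAC -powRM ?divr_ge0 ?pi_ge0 ?(ltW a0) ?(ltW at0)//.
    congr (_ `^ _ * expR _); last by rewrite /m; field; rewrite !gt_eqF.
    by move: (pi : R) => P; field; rewrite !gt_eqF.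
  have h := has_int_le (has_intD eint (has_intZ (-1) ht)) (has_intZ t h2).
  have {}h : W + -1 * (W * z) <= t * M.
    apply: h => u.
    rewrite (_ : expR _ = e u * expR (- (t * (u - m) ^+ 2))); last first.
      by rewrite /e -expRD; congr expR; rewrite /m; field; rewrite gt_eqF.
    have h' := expR_ge1Dx (- (t * (u - m) ^+ 2)).
    have e0 : 0 <= e u by exact: expR_ge0.
    rewrite (_ : _ + _ = e u * (1 - expR (- (t * (u - m) ^+ 2)))); last by ring.
    rewrite [leRHS](_ : _ = e u * (t * (u - m) ^+ 2)); last by ring.
    by apply: ler_wpM2l => //; rewrite lerBlDl -lerBlDr.
  have zz : t / (2 * (a + t)) <= 1 - z.
    have -> : t / (2 * (a + t)) = (1 - z ^+ 2) / 2 by rewrite z2; field; rewrite gt_eqF.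
    by rewrite -subr_ge0 (_ : _ - _ = (1 - z) ^+ 2 / 2) ?divr_ge0 ?sqr_ge0//; field.
  rewrite -(ler_pM2l t0); apply: le_trans h.
  rewrite [leLHS](_ : _ = W * (t / (2 * (a + t)))); last by field; rewrite gt_eqF.
  rewrite [leRHS](_ : _ = W * (1 - z)); last by ring.
  by rewrite ler_pM2l.
rewrite ler_pdivrMr ?mulr_gt0//; rewrite leNgt; apply/negP => lt.
have M0 : 0 < M by apply: lt_le_trans (key 1 ltr01); rewrite divr_gt0// mulr_gt0// addr_gt0.
(* With this t, 2 (a + t) M is the midpoint between 2 a M and W, hence below W, against [key]. *)
pose t := (W - M * (2 * a)) / (4 * M).
have t0 : 0 < t by rewrite divr_gt0 ?mulr_gt0// subr_gt0.
have := key t t0; rewrite ler_pdivrMr ?mulr_gt0 ?addr_gt0//.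
rewrite [leRHS](_ : _ = M * (2 * a) + (W - M * (2 * a)) / 2); last by rewrite /t; field; rewrite gt_eqF.
lra.
Qed.

End GaussianMoments.

End OneDimMoments.

(** * Exponentially tilted one-dimensional factors: masses and moments *)

Section TiltedFactors.
Context {R : realType}.
Notation leb := (@lebesgue_measure R).
Notation Dy := (`]0%R, +oo[%classic : set R).
Implicit Types (a b c v p u s eta tau th : R).

Lemma s_pdf_le0 d eta s : 0 < eta -> s <= 0 -> s_pdf 2 d eta s = 0.
Proof.
by move=> eta0 s0; rewrite /s_pdf /chisq_pdf pmulr_rgt0// ltNge s0/= mulr0.
Qed.

Lemma s_pdf_pos d eta s : (0 < d)%N -> 0 < eta -> 0 < s -> s_pdf 2 d eta s =
  eta `^ (d%:R / 2) / (2 `^ (d%:R / 2) * Gamma (d%:R / 2)) *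
  (s `^ (d%:R / 2 - 1) * expR (- (eta / 2 * s))).
Proof.
move=> d0 eta0 s0; rewrite /s_pdf /chisq_pdf mulr_gt0//= mul1n.
have dd : 0 < d%:R / 2 :> R by rewrite divr_gt0// ltr0n.
rewrite powRM ?(ltW eta0) ?(ltW s0)// -(mulr_powRB1 (ltW eta0) dd).
rewrite (_ : - (eta * s) / 2 = - (eta / 2 * s)); last by ring.
ring.
Qed.

Lemma s_pdf_ge0 d eta s : (0 < d)%N -> 0 < eta -> 0 <= s_pdf 2 d eta s.
Proof.
move=> d0 eta0; have [s0|s0] := leP s 0; first by rewrite s_pdf_le0.
have G0 : 0 < Gamma (d%:R / 2) :> R by rewrite Gamma_gt0// divr_gt0// ltr0n.
rewrite s_pdf_pos// mulr_ge0 ?mulr_ge0 ?powR_ge0 ?expR_ge0// invr_ge0 mulr_ge0 ?powR_ge0//.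
exact: ltW.
Qed.

Lemma meas_s_pdf disp (T : measurableType disp) d eta (f : T -> R) : measurable_fun setT f ->
  measurable_fun setT (fun t => s_pdf 2 d eta (f t)).
Proof.
move=> mf; rewrite /s_pdf /chisq_pdf; apply: measM; first exact: meas_cst.
apply: measurable_fun_ifT; [|by meas|exact: meas_cst].
have m1 : measurable_fun setT (fun t => eta * f t) by meas.
by apply: measurable_fun_ltr => //; exact: meas_cst.
Qed.

(** The free exponent [c] serves three times: 0 for the mass, 1 for the mean of s, and -1/4 for the
    integrable envelope. *)
Lemma has_int_s_pdf d eta c v : (0 < d)%N -> 0 < eta -> 0 < d%:R / 2 + c -> 0 <= v ->
  has_int (fun s => s_pdf 2 d eta s * (s `^ c * expR (- (eta * v * s))))
    (eta `^ (d%:R / 2) / (2 `^ (d%:R / 2) * Gamma (d%:R / 2)) *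
     (Gamma (d%:R / 2 + c) * (eta * (1 / 2 + v)) `^ (- (d%:R / 2 + c)))).
Proof.
move=> d0 eta0 c0 v0.
have G0 : 0 < Gamma (d%:R / 2) :> R by rewrite Gamma_gt0// divr_gt0// ltr0n.
have ms : measurable_fun setT (fun s : R => s_pdf 2 d eta s).
  by apply: meas_s_pdf; exact: measurable_id.
have E s : 0 < s -> s_pdf 2 d eta s * (s `^ c * expR (- (eta * v * s))) =
    eta `^ (d%:R / 2) / (2 `^ (d%:R / 2) * Gamma (d%:R / 2)) *
    (s `^ (d%:R / 2 + c - 1) * expR (- (eta * (1 / 2 + v) * s))).
  move=> s0; rewrite s_pdf_pos//.
  rewrite (_ : d%:R / 2 + c - 1 = d%:R / 2 - 1 + c); last by ring.
  rewrite [in RHS]powRD ?(gt_eqF s0) ?implybT//.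
  rewrite (_ : - (eta * (1 / 2 + v) * s) = - (eta / 2 * s) + - (eta * v * s)); last by field.
  rewrite expRD; ring.
apply: has_int_ge0.
- by meas.
- by move=> s; rewrite mulr_ge0 ?s_pdf_ge0// mulr_ge0 ?powR_ge0 ?expR_ge0.
transitivity (\int[leb]_(s in Dy) (eta `^ (d%:R / 2) / (2 `^ (d%:R / 2) * Gamma (d%:R / 2)) *
    (s `^ (d%:R / 2 + c - 1) * expR (- (eta * (1 / 2 + v) * s))))%:E)%E.
  rewrite [RHS]integral_mkcond; apply: eq_integral => s _; rewrite /patch.
  case: ifPn => [|/negP]; rewrite inE.
    by move=> /DyE s0; rewrite E.
  by move=> s0; rewrite s_pdf_le0 ?mul0r// leNgt; apply/negP => /DyE.
rewrite integralZ_ge0; [|exact: mDy|by meas|by move=> s _; rewrite mulr_ge0 ?powR_ge0 ?expR_ge0|].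
  rewrite integral_Gamma_scale// mulr_gt0// ltr_pwDl//.
by rewrite mulr_ge0 ?powR_ge0// invr_ge0 mulr_ge0 ?powR_ge0// ltW.
Qed.

(* exp (- eta (tilt p) T) turns the variances of the model into p times
   themselves and mu into p mu. *)
Definition tilt p : R := (1 - p) / (2 * p).

Lemma tilt_ge0 p : 0 < p <= 1 -> 0 <= tilt p.
Proof. by move=> /andP[p0 p1]; rewrite divr_ge0 ?subr_ge0// mulr_ge0// ltW. Qed.

Lemma has_int_s0 d eta p : (0 < d)%N -> 0 < eta -> 0 < p <= 1 ->
  has_int (fun s => s_pdf 2 d eta s * expR (- (eta * tilt p * s))) (p `^ (d%:R / 2)).
Proof.
move=> d0 eta0 p01; have /andP[p0 p1] := p01.
have dd : 0 < d%:R / 2 :> R by rewrite divr_gt0// ltr0n.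
have d2 : 0 < d%:R / 2 + 0 :> R by rewrite addr0.
apply: has_int_eq (has_int_s_pdf d0 eta0 d2 (tilt_ge0 p01)) _ _.
  by move=> s; rewrite powRr0 mul1r.
rewrite addr0 (_ : eta * (1 / 2 + tilt p) = eta / (2 * p)); last by rewrite /tilt; field; rewrite gt_eqF.
have G0 : Gamma (d%:R / 2) != 0 :> R by rewrite gt_eqF// Gamma_gt0.
have q0 : 0 < eta / (2 * p) by rewrite divr_gt0// mulr_gt0.
rewrite !powE// ln_div ?posrE ?mulr_gt0// lnM ?posrE//.
rewrite (_ : expR (- (d%:R / 2) * (ln eta - (ln 2 + ln p))) = expR (d%:R / 2 * ln 2) *
  expR (d%:R / 2 * ln p) / expR (d%:R / 2 * ln eta)); last first.
  by rewrite -expRN -!expRD; congr expR; ring.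
by move: (Gamma _) G0 => g g0; field; rewrite g0 !gt_eqF// expR_gt0.
Qed.

Lemma has_int_s1 d eta p : (0 < d)%N -> 0 < eta -> 0 < p <= 1 ->
  has_int (fun s => s_pdf 2 d eta s * (s * expR (- (eta * tilt p * s))))
    (d%:R * p / eta * p `^ (d%:R / 2)).
Proof.
move=> d0 eta0 p01; have /andP[p0 p1] := p01.
have dd : 0 < d%:R / 2 :> R by rewrite divr_gt0// ltr0n.
have d2 : 0 < d%:R / 2 + 1 :> R by rewrite addr_gt0.
apply: has_int_eq (has_int_s_pdf d0 eta0 d2 (tilt_ge0 p01)) _ _.
  move=> s; have [s0|s0] := leP s 0; first by rewrite s_pdf_le0// !mul0r.
  by rewrite powRr1// ltW.
rewrite GammaS// (_ : eta * (1 / 2 + tilt p) = eta / (2 * p)); last by rewrite /tilt; field; rewrite gt_eqF.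
have G0 : Gamma (d%:R / 2) != 0 :> R by rewrite gt_eqF// Gamma_gt0.
have q0 : 0 < eta / (2 * p) by rewrite divr_gt0// mulr_gt0.
rewrite opprD powRD ?(gt_eqF q0) ?implybT// powR_inv1 ?(ltW q0)//.
rewrite !powE ?divr_gt0 ?mulr_gt0// ln_div ?posrE ?mulr_gt0// lnM ?posrE//.
rewrite (_ : expR (- (d%:R / 2) * (ln eta - (ln 2 + ln p))) = expR (d%:R / 2 * ln 2) *
  expR (d%:R / 2 * ln p) / expR (d%:R / 2 * ln eta)); last first.
  by rewrite -expRN -!expRD; congr expR; ring.
by move: (Gamma _) G0 => g g0; field; rewrite g0 !gt_eqF// expR_gt0.
Qed.

Definition gauss1 tau th u : R := (2 * pi * tau) `^ (- (1 / 2)) * expR (- (u - th) ^+ 2 / (2 * tau)).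

Definition tilted tau th p u : R := gauss1 tau th u * expR (- (tilt p / tau * u ^+ 2)).

Definition mass tau th p : R := p `^ (1 / 2) * expR (- (th ^+ 2 * (1 - p) / (2 * tau))).

Section Tilted.
Variables (tau th p : R) (tau0 : 0 < tau) (p01 : 0 < p <= 1).

Let p0 : 0 < p. Proof. by case/andP: p01. Qed.
Let a := (2 * tau * p)^-1.
Let b := th / (2 * tau).
Let c := th ^+ 2 / (2 * tau).
Let k := (2 * pi * tau) `^ (- (1 / 2)).
Let a0 : 0 < a. Proof. by rewrite invr_gt0 !mulr_gt0. Qed.

Let tiltedE u : tilted tau th p u = k * expR (- (a * u ^+ 2 - 2 * b * u + c)).
Proof.
rewrite /tilted /gauss1 -mulrA -expRD; congr (_ * expR _); rewrite /a /b /c /tilt.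
by field; rewrite !gt_eqF.
Qed.

Let massE : mass tau th p = k * ((pi / a) `^ (1 / 2) * expR (b ^+ 2 / a - c)).
Proof.
rewrite /mass mulrA; congr (_ * expR _); last by rewrite /a /b /c; field; rewrite !gt_eqF.
have pi0 := @pi_gt0 R.
rewrite (_ : pi / a = 2 * pi * tau * p); last by rewrite /a invrK; ring.
have q0 : 0 < 2 * pi * tau by rewrite !mulr_gt0.
rewrite [in RHS]powRM ?(ltW q0) ?(ltW p0)// /k powRN mulrA mulVf ?mul1r//.
by rewrite gt_eqF// powR_gt0.
Qed.

Lemma has_int_tilted : has_int (tilted tau th p) (mass tau th p).
Proof.
by apply: has_int_eq (has_intZ k (integral_gauss b c a0 : has_int _ _)) _ _.
Qed.

Let mE : b / a = p * th.
Proof. by rewrite /a /b; field; rewrite !gt_eqF. Qed.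

Lemma has_int_tilted1 : has_int (fun u => (u - p * th) * tilted tau th p u) 0.
Proof.
apply: has_int_eq (has_intZ k (gauss_moment1 b c a0)) _ _; last by rewrite mulr0.
by move=> u; rewrite tiltedE mE; ring.
Qed.

(** Only a lower bound on the second moment is recorded: it enters through the lower bound on E
    w. *)
Lemma has_int_tilted2 : exists2 v, has_int (fun u => (u - p * th) ^+ 2 * tilted tau th p u) v &
  p * tau * mass tau th p <= v.
Proof.
have [v hv le] := gauss_moment2 b c a0.
exists (k * v).
  apply: has_int_eq (has_intZ k hv) _ _ => //.
  by move=> u; rewrite tiltedE mE; ring.
rewrite massE mulrCA ler_wpM2l ?powR_ge0//; apply: le_trans le.
rewrite [p * tau](_ : _ = (2 * a)^-1); first by rewrite mulrC.
by rewrite /a; field; rewrite !gt_eqF.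
Qed.

End Tilted.

End TiltedFactors.

(** * The risk as one iterated integral over 2d + 1 coordinates *)

Section Flattening.
Context {R : realType}.
Notation leb := (@lebesgue_measure R).
Notation Dy := (`]0%R, +oo[%classic : set R).
Variables (d : nat).
Implicit Types (l : seq R).

Definition xpart l : 'rV[R]_d := \row_j nth 0 l j.+1.
Definition ypart l : 'rV[R]_d := \row_j nth 0 l (d + j).+1.

(** The half-line integral in s becomes an ordinary coordinate because the integrand vanishes for s
    <= 0; linearity and domination are then needed for [iint_seq] only. *)
Lemma flatten_iint (F : R -> 'rV[R]_d -> 'rV[R]_d -> \bar R) :
  (forall s x y, s <= 0 -> F s x y = 0%E) ->
  (\int[leb]_(s in Dy) vec_int (fun x => vec_int (fun y => F s x y)) =
   iint_seq (d + d).+1 (fun l => F (nth 0%R l 0%N) (xpart l) (ypart l)))%E.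
Proof.
move=> F0 /=; rewrite integral_mkcond; apply: eq_integral => s _; rewrite iint_cat /patch.
have E : vec_int (fun x => vec_int (fun y => F s x y)) =
  iint_seq d (fun t => iint_seq d (fun u => F s (xpart (s :: t ++ u)) (ypart (s :: t ++ u)))).
  apply: eq_iint => t td; apply: eq_iint => u ud; congr F; apply/rowP => j; rewrite !mxE/=.
    by rewrite nth_cat td ltn_ord.
  by rewrite nth_cat td ltnNge leq_addr/= addKn.
case: ifPn => [_|/negP]; first by rewrite E.
rewrite inE => s0; rewrite -[LHS](iint0 d); apply: eq_iint => t _.
rewrite -[LHS](iint0 d); apply: eq_iint => u _; rewrite /= F0// leNgt.
by apply/negP => /DyE.
Qed.

(* A family indexed by the coordinates (s, x_1..x_d, y_1..y_d). *)
Let tri (A : Type) (a : A) (b c : 'I_d -> A) (i : nat) : A :=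
  if i is i'.+1 then
    if insub i' is Some j then b j else if insub (i' - d)%N is Some j then c j else a
  else a.

Let tri_ind (A B : Type) (P : A -> B -> Prop) a a' b b' c c' i :
  P a a' -> (forall j, P (b j) (b' j)) -> (forall j, P (c j) (c' j)) ->
  P (tri a b c i) (tri a' b' c' i).
Proof. by case: i => //= i Pa Pb Pc; case: insub => //; case: insub. Qed.

Let tri_rshift (A : Type) (a : A) (b c : 'I_d -> A) (j : 'I_d) : tri a b c (d + j).+1 = c j.
Proof. by rewrite /tri insubN ?addKn ?valK// -leqNgt leq_addr. Qed.

Lemma iint_tri (a : R -> R) (b c : 'I_d -> R -> R) (va : R) (vb vc : 'I_d -> R) :
  has_int a va -> (forall j, has_int (b j) (vb j)) -> (forall j, has_int (c j) (vc j)) ->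
  Int (d + d).+1 (fun l => (a (nth 0 l 0) * \prod_(j < d) b j (xpart l ord0 j) *
    \prod_(j < d) c j (ypart l ord0 j))%:E) /\
  iint_seq (d + d).+1 (fun l => (a (nth 0 l 0) * \prod_(j < d) b j (xpart l ord0 j) *
    \prod_(j < d) c j (ypart l ord0 j))%:E) = (va * \prod_(j < d) vb j * \prod_(j < d) vc j)%:E.
Proof.
move=> ha hb hc.
have := @iint_prod R (d + d).+1 (tri a b c) (tri va vb vc).
rewrite (_ : \prod_(i < _) tri va vb vc i = va * \prod_(j < d) vb j * \prod_(j < d) vc j); last first.
  rewrite big_ord_recl big_split_ord/= -mulrA; congr (_ * (_ * _)).
    by apply: eq_bigr => j _; rewrite valK.
  by apply: eq_bigr => j _; exact: (tri_rshift va vb vc).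
rewrite (_ : (fun s => (\prod_(i < _) _)%:E) = (fun l => (a (nth 0 l 0) *
  \prod_(j < d) b j (xpart l ord0 j) * \prod_(j < d) c j (ypart l ord0 j))%:E)); last first.
  apply/funext => l; rewrite big_ord_recl big_split_ord/= -mulrA; congr (_ * (_ * _))%:E.
    by apply: eq_bigr => j _; rewrite valK mxE.
  by apply: eq_bigr => j _; rewrite -(tri_rshift a b c) mxE.
apply => i _; exact: (@tri_ind _ _ (fun f v => leb.-integrable [set: R] (EFin \o f) /\
     (\int[leb]_(x in [set: R]) (f x)%:E = v%:E)%E)).
Qed.

Lemma gauss_pdf_prod (x th : 'rV[R]_d) tau :
  gauss_pdf x th tau = \prod_(j < d) gauss1 tau (th ord0 j) (x ord0 j).
Proof.
rewrite /gauss_pdf /gauss1 big_split/= big_const_ord iter_mulr_1 prodr_expR; congr (_ * expR _).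
  by rewrite -powR_mulrn ?powR_ge0// -powRrM; congr (_ `^ _); field.
by rewrite /sqnorm -sumrN mulr_suml; apply: eq_bigr => j _; rewrite !mxE.
Qed.

End Flattening.

(** * Expectations of product form under the model *)

Section Expectation.
Context {R : realType}.
Notation leb := (@lebesgue_measure R).
Variables (d : nat) (d0 : (0 < d)%N) (eta : R) (eta0 : 0 < eta) (mu : 'rV[R]_d).
Implicit Types (F G : R -> 'rV[R]_d -> 'rV[R]_d -> R) (v w p s : R) (x y : 'rV[R]_d).

Definition flat F (l : seq R) : \bar R := (F (nth 0 l 0) (xpart d l) (ypart d l))%:E.

Definition has_iint F v := Int (d + d).+1 (flat F) /\ iint_seq (d + d).+1 (flat F) = v%:E.

Lemma has_iint_eq F G v w : has_iint F v -> (forall s x y, F s x y = G s x y) -> v = w ->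
  has_iint G w.
Proof.
move=> hF FG <-; rewrite (_ : G = F)//.
by apply/funext => s; apply/funext => x; apply/funext => y; rewrite FG.
Qed.

Lemma has_iintD F G v w : has_iint F v -> has_iint G w ->
  has_iint (fun s x y => F s x y + G s x y) (v + w).
Proof.
move=> [iF vF] [iG vG]; have [iD vD] := IntD iF iG.
by split; rewrite ?EFinD -?vF -?vG -?vD.
Qed.

Lemma has_iintZ (k : R) F v : has_iint F v -> has_iint (fun s x y => k * F s x y) (k * v).
Proof.
move=> [iF vF]; have [iZ vZ] := IntZ k iF.
by split; rewrite ?EFinM -?vF -?vZ.
Qed.

Lemma has_iint_sum n (F : 'I_n -> R -> 'rV[R]_d -> 'rV[R]_d -> R) (v : 'I_n -> R) :
  has_iint (fun s x y => 0) 0 -> (forall i, has_iint (F i) (v i)) ->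
  has_iint (fun s x y => \sum_(i < n) F i s x y) (\sum_(i < n) v i).
Proof.
move=> h0; elim: n F v => [|n IH] F v Fv.
  by apply: has_iint_eq h0 _ _ => [s x y|]; rewrite big_ord0.
apply: has_iint_eq (has_iintD (Fv ord0) (IH _ _ (fun i => Fv (lift ord0 i)))) _ _.
  by move=> s x y; rewrite big_ord_recl.
by rewrite big_ord_recl.
Qed.

Definition dens s x y : R :=
  gauss_pdf y mu eta^-1 * gauss_pdf x mu (2 * eta)^-1 * s_pdf 2 d eta s.

Lemma dens_ge0 s x y : 0 <= dens s x y.
Proof. by rewrite /dens mulr_ge0 ?s_pdf_ge0// mulr_ge0 ?gauss_pdf_ge0. Qed.

Lemma dens_le0 s x y : s <= 0 -> dens s x y = 0.
Proof. by move=> s0; rewrite /dens s_pdf_le0// mulr0. Qed.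

Let m := eta * sqnorm mu.
Let eV0 : 0 < eta^-1. Proof. by rewrite invr_gt0. Qed.
Let e2V0 : 0 < (2 * eta)^-1. Proof. by rewrite invr_gt0 mulr_gt0. Qed.

Lemma prod_mass tau p : \prod_(j < d) mass tau (mu ord0 j) p =
  p `^ (d%:R / 2) * expR (- (sqnorm mu * (1 - p) / (2 * tau))).
Proof.
rewrite /mass big_split/= big_const_ord iter_mulr_1 prodr_expR; congr (_ * expR _).
  by rewrite -powR_mulrn ?powR_ge0// -powRrM; congr (_ `^ _); field.
by rewrite sumrN /sqnorm; congr (- _); rewrite -mulrA mulr_suml; apply: eq_bigr => j _; rewrite mulrA.
Qed.

Let pick (j i : 'I_d) (h : R -> R) u : R := if i == j then h u else 1.

Let prod_pick j h (u : 'I_d -> R) : \prod_(i < d) pick j i h (u i) = h (u j).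
Proof. by rewrite /pick -big_mkcond big_pred1_eq. Qed.

(** Source of all expectations below: weights on s and on the j-th coordinates of x and y, with tilt
    p on (s, x) and p' on y. Taking p' = p tilts T, and p' = 1 tilts A alone. The pair (s, x)
    contributes g^2 since s adds d degrees of freedom and x has twice the precision of y. *)
Lemma has_iint_factor p p' (j : 'I_d) (ha hb hc : R -> R) (ra rb rc : R) :
  0 < p <= 1 -> 0 < p' <= 1 ->
  has_int (fun s => s_pdf 2 d eta s * (ha s * expR (- (eta * tilt p * s)))) (ra * p `^ (d%:R / 2)) ->
  has_int (fun u => hb u * tilted (2 * eta)^-1 (mu ord0 j) p u) (rb * mass (2 * eta)^-1 (mu ord0 j) p) ->
  has_int (fun u => hc u * tilted eta^-1 (mu ord0 j) p' u) (rc * mass eta^-1 (mu ord0 j) p') ->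
  has_iint (fun s x y => dens s x y * (ha s * hb (x ord0 j) * hc (y ord0 j) *
      expR (- (eta * tilt p * quadA x s)) * expR (- (eta * tilt p' * sqnorm y))))
    (ra * rb * rc * (gg d m p ^+ 2 * gg d m p')).
Proof.
move=> p01 p01' Ha Hb Hc; have /andP[p0 p1] := p01.
pose b i u := pick j i hb u * tilted (2 * eta)^-1 (mu ord0 i) p u.
pose c i u := pick j i hc u * tilted eta^-1 (mu ord0 i) p' u.
pose vb i := pick j i (fun=> rb) 0 * mass (2 * eta)^-1 (mu ord0 i) p.
pose vc i := pick j i (fun=> rc) 0 * mass eta^-1 (mu ord0 i) p'.
have Hb' i : has_int (b i) (vb i).
  rewrite /b /vb /pick; case: eqP => [->//|_].
  by apply: has_int_eq (has_int_tilted (mu ord0 i) e2V0 p01) _ _ => [u|]; rewrite mul1r.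
have Hc' i : has_int (c i) (vc i).
  rewrite /c /vc /pick; case: eqP => [->//|_].
  by apply: has_int_eq (has_int_tilted (mu ord0 i) eV0 p01') _ _ => [u|]; rewrite mul1r.
have := iint_tri Ha Hb' Hc'.
have -> : \prod_(i < d) vb i = rb * \prod_(i < d) mass (2 * eta)^-1 (mu ord0 i) p.
  by rewrite big_split (prod_pick j (fun=> rb) (fun=> 0)).
have -> : \prod_(i < d) vc i = rc * \prod_(i < d) mass eta^-1 (mu ord0 i) p'.
  by rewrite big_split (prod_pick j (fun=> rc) (fun=> 0)).
rewrite !prod_mass.
set V := (X in _ = X%:E); set G := fun l : seq R => _.
have -> : V = ra * rb * rc * (gg d m p ^+ 2 * gg d m p').
  rewrite /V /gg /m.
  rewrite (_ : sqnorm mu * (1 - p) / (2 * (2 * eta)^-1) = eta * sqnorm mu * (1 - p) / 2 + eta * sqnorm mu * (1 - p) / 2); last by field; rewrite gt_eqF.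
  rewrite (_ : sqnorm mu * (1 - p') / (2 * eta^-1) = eta * sqnorm mu * (1 - p') / 2); last by field; rewrite gt_eqF.
  rewrite opprD expRD; ring.
rewrite (_ : G = flat (fun s x y => dens s x y * (ha s * hb (x ord0 j) * hc (y ord0 j) *
      expR (- (eta * tilt p * quadA x s)) * expR (- (eta * tilt p' * sqnorm y)))))//.
apply/funext => l; rewrite /G /flat; congr EFin.
move: (xpart d l) (ypart d l) (nth 0 l 0) => x y s.
have -> : \prod_(i < d) b i (x ord0 i) = hb (x ord0 j) * (\prod_(i < d) gauss1 (2 * eta)^-1 (mu ord0 i) (x ord0 i) *
    expR (\sum_(i < d) - (tilt p / (2 * eta)^-1 * x ord0 i ^+ 2))).
  by rewrite big_split (prod_pick j hb (fun i => x ord0 i)) -prodr_expR -big_split.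
have -> : \prod_(i < d) c i (y ord0 i) = hc (y ord0 j) * (\prod_(i < d) gauss1 eta^-1 (mu ord0 i) (y ord0 i) *
    expR (\sum_(i < d) - (tilt p' / eta^-1 * y ord0 i ^+ 2))).
  by rewrite big_split (prod_pick j hc (fun i => y ord0 i)) -prodr_expR -big_split.
rewrite /dens !gauss_pdf_prod.
rewrite (_ : eta * tilt p * quadA x s = eta * tilt p * s +
   \sum_(i < d) tilt p / (2 * eta)^-1 * x ord0 i ^+ 2); last first.
  rewrite -mulr_sumr /quadA /sqnorm invrK; ring.
rewrite (_ : eta * tilt p' * sqnorm y = \sum_(i < d) tilt p' / eta^-1 * y ord0 i ^+ 2); last first.
  rewrite -mulr_sumr /sqnorm invrK; ring.
rewrite opprD expRD !sumrN; ring.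
Qed.

End Expectation.

(** * Tilted expectations and an integrable envelope *)

Section TiltedExpectations.
Context {R : realType}.
Notation leb := (@lebesgue_measure R).
Notation D1 := (`]0%R, 1%R[%classic : set R).
Variables (d : nat) (d0 : (0 < d)%N) (eta : R) (eta0 : 0 < eta) (mu : 'rV[R]_d).
Implicit Types (v w p s tau th : R) (x y : 'rV[R]_d) (j : 'I_d).

Let m := eta * sqnorm mu.
Let eV0 : 0 < eta^-1. Proof. by rewrite invr_gt0. Qed.
Let e2V0 : 0 < (2 * eta)^-1. Proof. by rewrite invr_gt0 mulr_gt0. Qed.
Let l11 : 0 < (1 : R) <= 1. Proof. by rewrite ltr01 lexx. Qed.
Let dd : 0 < d%:R / 2 :> R. Proof. by rewrite divr_gt0// ltr0n. Qed.
Local Notation dens := (@dens R d eta mu).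

Lemma tilt1 : tilt 1 = 0 :> R.
Proof. by rewrite /tilt subrr mul0r. Qed.

Lemma gg1 : gg d m 1 = 1.
Proof. by rewrite /gg powR1 subrr mulr0 mul0r oppr0 expR0 mulr1. Qed.

Let s1 p : 0 < p <= 1 ->
  has_int (fun s => s_pdf 2 d eta s * (1 * expR (- (eta * tilt p * s)))) (1 * p `^ (d%:R / 2)).
Proof.
by move=> p01; apply: has_int_eq (has_int_s0 d0 eta0 p01) _ _ => [s|]; rewrite mul1r.
Qed.

Let t1 tau th p : 0 < tau -> 0 < p <= 1 ->
  has_int (fun u => 1 * tilted tau th p u) (1 * mass tau th p).
Proof.
by move=> tau0 p01; apply: has_int_eq (has_int_tilted th tau0 p01) _ _ => [s|]; rewrite mul1r.
Qed.

Let mass_gt0 tau th p : 0 < p -> 0 < mass tau th p.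
Proof. by move=> p0; rewrite mulr_gt0 ?powR_gt0 ?expR_gt0. Qed.

Let t2 tau th p : 0 < tau -> 0 < p <= 1 -> exists2 r,
  has_int (fun u => (u - p * th) ^+ 2 * tilted tau th p u) (r * mass tau th p) & p * tau <= r.
Proof.
move=> tau0 p01; have [v hv le] := has_int_tilted2 th tau0 p01.
have /andP[p0 _] := p01; have m0 := mass_gt0 tau th p0.
exists (v / mass tau th p); last by rewrite ler_pdivlMr.
by rewrite divfK// gt_eqF.
Qed.

Let expT p s x y : expR (- (eta * tilt p * quadA x s)) * expR (- (eta * tilt p * sqnorm y)) =
  expR (- (eta * tilt p * quadT y x s)).
Proof. by rewrite -expRD; congr expR; rewrite /quadA /quadT; ring. Qed.

Lemma has_iint_expT p : 0 < p <= 1 ->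
  has_iint (fun s x y => dens s x y * expR (- (eta * tilt p * quadT y x s))) (gg d m p ^+ 3).
Proof.
move=> p01; pose j := Ordinal d0.
have H := has_iint_factor eta0 p01 p01 (s1 p01)
  (t1 (mu ord0 j) e2V0 p01) (t1 (mu ord0 j) eV0 p01).
apply: (has_iint_eq H).
  by move=> s x y; rewrite !mul1r expT.
by rewrite !mul1r; ring.
Qed.

Lemma has_iint_expA p : 0 < p <= 1 ->
  has_iint (fun s x y => dens s x y * expR (- (eta * tilt p * quadA x s))) (gg d m p ^+ 2).
Proof.
move=> p01; pose j := Ordinal d0.
have H := has_iint_factor eta0 p01 l11 (s1 p01)
  (t1 (mu ord0 j) e2V0 p01) (t1 (mu ord0 j) eV0 l11).
apply: (has_iint_eq H).
  by move=> s x y; rewrite !mul1r tilt1 mulr0 mul0r oppr0 expR0 mulr1.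
by rewrite !mul1r -/m gg1 mulr1.
Qed.

Lemma has_iint_dens : has_iint dens 1.
Proof.
apply: has_iint_eq (has_iint_expT l11) _ _; last by rewrite gg1 expr1n.
by move=> s x y; rewrite tilt1 mulr0 mul0r oppr0 expR0 mulr1.
Qed.

Lemma has_iint0 : has_iint (fun (s : R) (x y : 'rV[R]_d) => 0) 0.
Proof.
by apply: has_iint_eq (has_iintZ 0 has_iint_dens) _ _ => [s x y|]; rewrite mul0r.
Qed.

(** Under the tilt both coordinates are centred at p th, so the cross term of the expanded square
    has mean 0 and the variances p / (2 eta) and p / eta add up to 3 p / (2 eta). *)
Lemma has_iint_diff2 p j : 0 < p <= 1 ->
  exists2 v, has_iint (fun s x y => dens s x y *
     ((y ord0 j - x ord0 j) ^+ 2 * expR (- (eta * tilt p * quadT y x s)))) v &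
   3 / 2 * p / eta * gg d m p ^+ 3 <= v.
Proof.
move=> p01; have /andP[p0 _] := p01; set th := mu ord0 j.
have [r1 hr1 le1] := t2 th e2V0 p01.
have [r2 hr2 le2] := t2 th eV0 p01.
have H1 := has_iint_factor eta0 p01 p01 (s1 p01) hr1 (t1 th eV0 p01).
have H2 := has_iint_factor eta0 p01 p01 (s1 p01) (t1 th e2V0 p01) hr2.
have c0 tau (tau0 : 0 < tau) : has_int (fun u => (u - p * th) * tilted tau th p u) (0 * mass tau th p).
  by rewrite mul0r; exact: has_int_tilted1.
have H3 := has_iint_factor eta0 p01 p01 (s1 p01) (c0 _ e2V0) (c0 _ eV0).
have H := has_iintD (has_iintD H1 H2) (has_iintZ (-2) H3).
eexists; first apply: has_iint_eq H _ erefl.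
  by move=> s x y; rewrite -!expT; ring.
rewrite -/m; have g0 : 0 < gg d m p ^+ 3 by rewrite exprn_gt0// gg_gt0.
rewrite [leRHS](_ : _ = (r1 + r2) * gg d m p ^+ 3); last by ring.
rewrite ler_pM2r//; apply: le_trans (lerD le1 le2).
by apply: ler_of_eq; field; rewrite gt_eqF.
Qed.

Lemma has_iint_quadS p : 0 < p <= 1 ->
  exists2 v, has_iint (fun s x y => dens s x y *
     (quadS y x s * expR (- (eta * tilt p * quadT y x s)))) v &
   2 * d%:R * p / eta * gg d m p ^+ 3 <= v.
Proof.
move=> p01; pose j0 := Ordinal d0.
have Hs : has_int (fun s => s_pdf 2 d eta s * (s * expR (- (eta * tilt p * s))))
    (d%:R * p / eta * p `^ (d%:R / 2)) by exact: has_int_s1.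
have H1 := has_iint_factor eta0 p01 p01 Hs (t1 (mu ord0 j0) e2V0 p01) (t1 (mu ord0 j0) eV0 p01).
have /choice[v hv] : forall j, exists v, has_iint (fun s x y => dens s x y *
     ((y ord0 j - x ord0 j) ^+ 2 * expR (- (eta * tilt p * quadT y x s)))) v /\
   3 / 2 * p / eta * gg d m p ^+ 3 <= v.
  by move=> j; have [v] := has_iint_diff2 j p01; exists v.
have H2 := has_iint_sum has_iint0 (fun j => (hv j).1).
have H := has_iintD H1 (has_iintZ (2 / 3) H2).
eexists; first apply: has_iint_eq H _ erefl.
  move=> s x y; rewrite /= -mulr_sumr -mulr_suml -expT.
  rewrite (_ : quadS y x s = s + 2 / 3 * \sum_(i < d) (y ord0 i - x ord0 i) ^+ 2); first ring.
  by rewrite /quadS /sqnorm; congr (_ + _ * _); apply: eq_bigr => i _; rewrite !mxE.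
(* Both parts of S contribute d p / eta: the mean of s, and 2/3 of d times 3 p / (2 eta). *)
have : \sum_(i < d) (3 / 2 * p / eta * gg d m p ^+ 3) <= \sum_(i < d) v i.
  by apply: ler_sum => i _; exact: (hv i).2.
rewrite sumr_const card_ord -[_ *+ d]mulr_natr -/m => h.
have h23 : 0 <= 2 / 3 :> R by [].
have {}h := ler_wpM2l h23 h; apply: le_trans (lerD (lexx _) h).
by apply: ler_of_eq; field; rewrite gt_eqF.
Qed.

(** The power s^(-1/4) dominates - ln s up to a factor 4, and its exponent is small enough for d/2 -
    1/4 > 0 already at d = 1. *)
Definition envelope s x y : R := 1 + s + s `^ (- (1 / 4)) + sqnorm (x - mu) + sqnorm (y - mu).

Lemma has_iint_envelope : exists v, has_iint (fun s x y => dens s x y * envelope s x y) v.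
Proof.
pose j0 := Ordinal d0; pose th := mu ord0 j0.
have Hs : has_int (fun s => s_pdf 2 d eta s * (s * expR (- (eta * tilt 1 * s))))
    (d%:R * 1 / eta * 1 `^ (d%:R / 2)) by exact: has_int_s1.
have H1 := has_iint_factor eta0 l11 l11 Hs (t1 th e2V0 l11) (t1 th eV0 l11).
have d4 : 0 < d%:R / 2 + - (1 / 4) :> R.
  have : 1 <= d%:R :> R by rewrite ler1n.
  lra.
have [k Hk] : exists k, has_int (fun s => s_pdf 2 d eta s * (s `^ (- (1 / 4)) * expR (- (eta * tilt 1 * s))))
    (k * 1 `^ (d%:R / 2)).
  eexists; apply: has_int_eq (has_int_s_pdf d0 eta0 d4 (tilt_ge0 l11)) _ _ => //.
  by rewrite powR1 mulr1.
have H2 := has_iint_factor eta0 l11 l11 Hk (t1 th e2V0 l11) (t1 th eV0 l11).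
have /choice[v hv] : forall j, exists v, has_iint (fun s x y => dens s x y * (x ord0 j - mu ord0 j) ^+ 2) v.
  move=> j; have [r hr _] := t2 (mu ord0 j) e2V0 l11.
  eexists; apply: has_iint_eq (has_iint_factor eta0 l11 l11 (s1 l11) hr (t1 (mu ord0 j) eV0 l11)) _ erefl.
  by move=> s x y; rewrite tilt1 !mulr0 !mul0r oppr0 expR0 !mulr1 !mul1r.
have /choice[w hw] : forall j, exists v, has_iint (fun s x y => dens s x y * (y ord0 j - mu ord0 j) ^+ 2) v.
  move=> j; have [r hr _] := t2 (mu ord0 j) eV0 l11.
  eexists; apply: has_iint_eq (has_iint_factor eta0 l11 l11 (s1 l11) (t1 (mu ord0 j) e2V0 l11) hr) _ erefl.
  by move=> s x y; rewrite tilt1 !mulr0 !mul0r oppr0 expR0 !mulr1 !mul1r.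
have H3 := has_iint_sum has_iint0 hv.
have H4 := has_iint_sum has_iint0 hw.
have H := has_iintD (has_iintD (has_iintD (has_iintD has_iint_dens H1) H2) H3) H4.
eexists; apply: has_iint_eq H _ erefl.
move=> s x y; rewrite /= -!mulr_sumr tilt1 !mulr0 !mul0r oppr0 expR0 !mulr1.
rewrite /envelope /sqnorm.
have E z : \sum_(i < d) (z - mu) ord0 i ^+ 2 = \sum_(i < d) (z ord0 i - mu ord0 i) ^+ 2.
  by apply: eq_bigr => i _; rewrite !mxE.
rewrite !E; ring.
Qed.

End TiltedExpectations.

(** * Laplace representations of S / T and ln (T / A) *)

Section LaplaceRepresentations.
Context {R : realType}.
Notation leb := (@lebesgue_measure R).
Notation D1 := (`]0%R, 1%R[%classic : set R).
Variables (eta : R) (eta0 : 0 < eta).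
Implicit Types (p r a b : R).

Lemma integral_exp_itv (k c a b : R) : k != 0 -> a < b ->
  (\int[leb]_(r in `[a, b]) (c * expR (- (k * r)))%:E =
   (c / k * (expR (- (k * a)) - expR (- (k * b))))%:E)%E.
Proof.
move=> k0 ab.
have dF r : is_derive r 1 (fun r => - (c / k) * expR (- (k * r))) (c * expR (- (k * r))).
  by der; field.
have cf r : {for r, continuous (fun r => c * expR (- (k * r)))} by dcont.
rewrite (@continuous_FTC2 _ _ (fun r => - (c / k) * expR (- (k * r))) _ _ ab).
- by rewrite -EFinB; congr EFin; ring.
- by apply: continuous_in_subspaceT => r _; exact: cf.
- split.
  + by move=> r _; exact: (der_derivable (dF r)).
  + by apply: cvg_at_right_filter; exact: (der_continuous (dF a)).
  + by apply: cvg_at_left_filter; exact: (der_continuous (dF b)).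
- by move=> r _; exact: (der_val (dF r)).
Qed.

(** The integral of S exp (- v T) over v > 0, in the variable p with v = eta (1 - p) / (2 p) and
    |dv| = eta / (2 p^2) dp. *)
Lemma laplace_frac (S T : R) : 0 <= S -> 0 < T ->
  (\int[leb]_(p in D1) (eta * S / (2 * p ^+ 2) * expR (- (eta * tilt p * T)))%:E = (S / T)%:E)%E.
Proof.
move=> S0 T0; rewrite -[in RHS](subr0 (S / T)).
apply: (@FTC01 _ (fun p => eta * S / (2 * p ^+ 2) * expR (- (eta * tilt p * T)))
  (fun p => S / T * expR (- (eta * tilt p * T)))).
- move=> p /andP[p0 p1]; rewrite /tilt; have p2 : 2 * p != 0 by rewrite gt_eqF// mulr_gt0.
  by der => //; field; rewrite !gt_eqF.
- move=> p /andP[p0 p1]; rewrite /tilt; have p2 : 2 * p != 0 by rewrite gt_eqF// mulr_gt0.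
  have p3 : 2 * p ^+ 2 != 0 by rewrite gt_eqF// mulr_gt0// exprn_gt0.
  by dcont.
- move=> p _; apply: mulr_ge0; last exact: expR_ge0.
  by apply: divr_ge0; apply: mulr_ge0; rewrite ?sqr_ge0 ?(ltW eta0).
(* Upper barrier at 0, from exp (- v) <= 1 / (1 + v). *)
- pose g p := S / T * (2 * p / (2 * p + eta * T * (1 - p))).
  have eT : 0 < eta * T by rewrite mulr_gt0.
  apply: (@squeeze_cvgr _ _ _ _ (fun=> 0) g).
  + near=> p; have p0 : 0 < p by near: p; exact: nbhs_right_gt.
    have p1 : p < 1 by near: p; exact: nbhs_right_lt.
    have ST : 0 <= S / T by rewrite divr_ge0// ltW.
    rewrite mulr_ge0 ?expR_ge0//= ler_wpM2l// expRN.
    have q0 : 0 < 2 * p + eta * T * (1 - p).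
      by rewrite addr_gt0// mulr_gt0// subr_gt0.
    rewrite -[leRHS]invf_div lef_pV2 ?posrE ?expR_gt0 ?divr_gt0 ?mulr_gt0//.
    apply: le_trans (expR_ge1Dx _).
    by apply: ler_of_eq; rewrite /tilt; field; rewrite gt_eqF.
  + exact: cvg_cst.
  + have c1 : {for 0, continuous g}.
      have q0 : 2 * 0 + eta * T * (1 - 0) != 0 by rewrite mulr0 add0r subr0 mulr1 gt_eqF.
      by rewrite /g; dcont.
    by eapply cvg_eqr; [exact: (cvg_at_right_filter c1)|rewrite /g mulr0 mul0r mulr0].
- have c1 : {for 1, continuous (fun p => S / T * expR (- (eta * tilt p * T)))}.
    rewrite /tilt; have p2 : 2 * 1 != 0 :> R by rewrite mulr1.
    by dcont.
  eapply cvg_eqr; first exact: (cvg_at_left_filter c1).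
  by rewrite tilt1 mulr0 mul0r oppr0 expR0 mulr1.
Unshelve. all: by end_near. Qed.

(** Frullani's formula: ln (T / A) is the integral of 1 / r over [A, T], each 1 / r is expanded by
    [laplace_frac], and the integrals are exchanged. In the variable p the measure dv / v reads dp /
    (p (1 - p)). *)
Lemma laplace_ln (A T : R) : 0 < A -> A <= T ->
  (\int[leb]_(p in D1) ((expR (- (eta * tilt p * A)) - expR (- (eta * tilt p * T))) /
      (p * (1 - p)))%:E = (ln (T / A))%:E)%E.
Proof.
move=> A0; rewrite le_eqVlt => /predU1P[<-|AT].
  rewrite divff ?gt_eqF// ln1; under eq_integral do rewrite subrr mul0r.
  by rewrite integral0.
have T0 : 0 < T by exact: lt_trans AT.
rewrite ln_div ?posrE// -integral_inv//.
have mAT : measurable (`[A, T]%classic : set R) by exact: measurable_itv.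
transitivity (\int[leb]_(p in D1) \int[leb]_(r in `[A, T])
   (eta * 1 / (2 * p ^+ 2) * expR (- (eta * tilt p * r)))%:E)%E.
  apply: eq_integral => p; rewrite inE => /D1E/andP[p0 p1].
  have q0 : 0 < 1 - p by rewrite subr_gt0.
  have t0 : 0 < eta * tilt p by rewrite mulr_gt0// divr_gt0// mulr_gt0.
  rewrite integral_exp_itv ?gt_eqF//; congr EFin.
  rewrite mulrC; congr (_ * _); rewrite /tilt.
  by field; rewrite !gt_eqF.
rewrite tonelli_leb//; first last.
- move=> p r _ _; rewrite lee_fin; apply: mulr_ge0; last exact: expR_ge0.
  by apply: divr_ge0; apply: mulr_ge0; rewrite ?sqr_ge0 ?(ltW eta0).
- by apply/measurable_EFinP; rewrite /tilt; meas.
apply: eq_integral => r; rewrite inE/= in_itv/= => /andP[rA _].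
by rewrite laplace_frac// ?mul1r//; exact: lt_le_trans rA.
Qed.

End LaplaceRepresentations.

(** * Risk comparison *)

Section RiskTerms.
Context {R : realType}.
Notation leb := (@lebesgue_measure R).
Notation D1 := (`]0%R, 1%R[%classic : set R).
Variables (d : nat) (d0 : (0 < d)%N) (eta : R) (eta0 : 0 < eta) (mu : 'rV[R]_d).
Implicit Types (F G : R -> 'rV[R]_d -> 'rV[R]_d -> R) (v w p s : R) (x y : 'rV[R]_d).

Let m := eta * sqnorm mu.
Let N := (d + d).+1.
Local Notation dens := (@dens R d eta mu).
Local Notation envelope := (@envelope R d mu).

(** The first component is a dummy parameter, present because [jmeas] and [Int_dom] expect one. *)
Definition flat_meas F := measurable_fun [set: R * N.-tuple R]
  (fun q => F (nth 0 q.2 0) (xpart d q.2) (ypart d q.2)).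

Lemma has_iint_dom F G v : flat_meas F -> (forall s x y, `|F s x y| <= G s x y) -> has_iint G v ->
  exists w, has_iint F w.
Proof.
move=> mF FG [iG _].
have iF : Int N (flat F).
  apply: (@Int_dom R N _ R 0 (fun=> flat F) (flat G)) => //.
  - exact/measurable_EFinP.
  - by move=> l _; rewrite /flat lee_fin.
by exists (fine (iint_seq N (flat F))); split; rewrite ?fineK//; exact: Int_fin.
Qed.

Let ms : measurable_fun setT (fun q : R * N.-tuple R => nth 0 q.2 0).
Proof. exact: meas_nth. Qed.

Let mx j : measurable_fun setT (fun q : R * N.-tuple R => xpart d q.2 ord0 j).
Proof.
rewrite (_ : (fun q => _) = (fun q : R * N.-tuple R => nth 0 q.2 j.+1)); first exact: meas_nth.
by apply/funext => q; rewrite mxE.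
Qed.

Let my j : measurable_fun setT (fun q : R * N.-tuple R => ypart d q.2 ord0 j).
Proof.
rewrite (_ : (fun q => _) = (fun q : R * N.-tuple R => nth 0 q.2 (d + j).+1)); first exact: meas_nth.
by apply/funext => q; rewrite mxE.
Qed.

Let mnx : measurable_fun setT (fun q : R * N.-tuple R => sqnorm (xpart d q.2)).
Proof. exact: meas_sqnorm. Qed.

Let mny : measurable_fun setT (fun q : R * N.-tuple R => sqnorm (ypart d q.2)).
Proof. exact: meas_sqnorm. Qed.

Let mnyx : measurable_fun setT (fun q : R * N.-tuple R => sqnorm (ypart d q.2 - xpart d q.2)).
Proof.
apply: meas_sqnorm => j; have mxj := mx j; have myj := my j.
rewrite (_ : (fun q => _) = (fun q : R * N.-tuple R => ypart d q.2 ord0 j - xpart d q.2 ord0 j)).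
  by meas.
by apply/funext => q; rewrite !mxE.
Qed.

Let mT : measurable_fun setT (fun q : R * N.-tuple R => quadT (ypart d q.2) (xpart d q.2) (nth 0 q.2 0)).
Proof. by rewrite /quadT; meas. Qed.

Let mA : measurable_fun setT (fun q : R * N.-tuple R => quadA (xpart d q.2) (nth 0 q.2 0)).
Proof. by rewrite /quadA; meas. Qed.

Let mS : measurable_fun setT (fun q : R * N.-tuple R => quadS (ypart d q.2) (xpart d q.2) (nth 0 q.2 0)).
Proof. by rewrite /quadS; meas. Qed.

Let mgy tau : measurable_fun setT (fun q : R * N.-tuple R => gauss_pdf (ypart d q.2) mu tau).
Proof. by apply: meas_gauss_pdf => [|i|]; [exact: my|exact: meas_cst|exact: meas_cst]. Qed.

Let mgx tau : measurable_fun setT (fun q : R * N.-tuple R => gauss_pdf (xpart d q.2) mu tau).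
Proof. by apply: meas_gauss_pdf => [|i|]; [exact: mx|exact: meas_cst|exact: meas_cst]. Qed.

Let mdens : flat_meas dens.
Proof.
have m1 := mgy eta^-1; have m2 := mgx (2 * eta)^-1.
have m3 := meas_s_pdf d eta ms.
by rewrite /flat_meas /dens; meas.
Qed.

Lemma sqnormB_le (u v : 'rV[R]_d) : sqnorm (u - v) <= 2 * sqnorm u + 2 * sqnorm v.
Proof.
rewrite /sqnorm !mulr_sumr -big_split/=; apply: ler_sum => j _; rewrite !mxE.
by have := sqr_ge0 (u ord0 j + v ord0 j); nra.
Qed.

Lemma envelope_ge s x y : 0 < s -> [/\ 1 <= envelope s x y, `|ln s| <= 4 * envelope s x y,
  s <= envelope s x y, sqnorm (x - mu) <= envelope s x y & sqnorm (y - mu) <= envelope s x y].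
Proof.
move=> s0; rewrite /envelope.
have p0 : 0 < s `^ (- (1 / 4)) by exact: powR_gt0.
have X0 := sqnorm_ge0 (x - mu); have Y0 := sqnorm_ge0 (y - mu).
have h1 := ln_le s0.
have h2 := ln_le p0; rewrite ln_powR in h2.
move: (s `^ (- (1 / 4))) p0 h2 (sqnorm _) X0 (sqnorm _) Y0 => P P0 h2 X X0 Y Y0.
split; try lra.
by rewrite ler_norml; apply/andP; split; lra.
Qed.

Lemma ln_quadS_le_envelope s x y : 0 < s -> `|ln (quadS y x s)| <= 8 * envelope s x y.
Proof.
move=> s0; have [b1 bl bs bx bY] := envelope_ge x y s0.
have S0 := quadS_gt0 y x s0.
have h1 : ln s <= ln (quadS y x s) by rewrite ler_ln ?posrE// quadS_ge.
have h2 := ln_le S0.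
have h3 : quadS y x s <= 4 * envelope s x y.
  have := sqnormB_le (y - mu) (x - mu); rewrite opprB addrA subrK => h.
  by rewrite /quadS; lra.
by move: bl; rewrite !ler_norml => /andP[l1 l2]; apply/andP; split; lra.
Qed.

Definition ellR s x y : R := ln (gauss_pdf y mu eta^-1 / best_equiv 2 y x s).

Lemma gauss_pdf_gt0 (th z : 'rV[R]_d) tau : 0 < tau -> 0 < gauss_pdf z th tau.
Proof. by move=> tau0; rewrite mulr_gt0 ?expR_gt0// powR_gt0// !mulr_gt0// pi_gt0. Qed.

Lemma ellR_le_envelope : exists C, forall s x y, 0 < s -> `|ellR s x y| <= C * envelope s x y.
Proof.
pose k1 : R := (2 * pi * eta^-1) `^ (- (d%:R / 2)).
pose k2 : R := Gamma d%:R / Gamma (d%:R / 2) * (2 / (3 * pi)) `^ (d%:R / 2).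
have p0 := @pi_gt0 R.
have dn : 0 < d%:R :> R by rewrite ltr0n.
have k10 : 0 < k1 by rewrite powR_gt0// !mulr_gt0// invr_gt0.
have k20 : 0 < k2.
  rewrite mulr_gt0 ?powR_gt0//; last by rewrite divr_gt0// mulr_gt0.
  by rewrite divr_gt0// Gamma_gt0// divr_gt0.
exists (`|ln k1| + eta / 2 + `|ln k2| + d%:R / 2 * 4 + d%:R * 8) => s x y s0.
have [b1 bl bs bx bY] := envelope_ge x y s0.
have bS := ln_quadS_le_envelope x y s0.
have S0 := quadS_gt0 y x s0.
have -> : ellR s x y = ln k1 - eta / 2 * sqnorm (y - mu) - ln k2 - d%:R / 2 * ln s + d%:R * ln (quadS y x s).
  rewrite /ellR best_equivE// -/k2 ln_div ?posrE; first last.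
  - by apply: mulr_gt0; rewrite ?powR_gt0//; apply: mulr_gt0; rewrite ?powR_gt0.
  - by rewrite gauss_pdf_gt0// invr_gt0.
  have s1 : 0 < s `^ (d%:R / 2) by exact: powR_gt0.
  have S1 : 0 < quadS y x s `^ (- d%:R) by exact: powR_gt0.
  rewrite /gauss_pdf -/k1 (lnM k10 (expR_gt0 _)) (lnM (mulr_gt0 k20 s1) S1) (lnM k20 s1) expRK !ln_powR.
  by clearbody k1 k2; field; rewrite gt_eqF.
have n1 : `|ln k1| <= `|ln k1| * envelope s x y by rewrite ler_peMr.
have n2 : `|ln k2| <= `|ln k2| * envelope s x y by rewrite ler_peMr.
have n3 : `|eta / 2 * sqnorm (y - mu)| <= eta / 2 * envelope s x y.
  have e2 : 0 <= eta / 2 by rewrite divr_ge0// ltW.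
  rewrite ger0_norm; first exact: ler_wpM2l.
  by apply: mulr_ge0 => //; exact: sqnorm_ge0.
have n4 : `|d%:R / 2 * ln s| <= d%:R / 2 * 4 * envelope s x y.
  by rewrite normrM ger0_norm ?divr_ge0// -mulrA ler_wpM2l ?divr_ge0.
have n5 : `|d%:R * ln (quadS y x s)| <= d%:R * 8 * envelope s x y.
  by rewrite normrM ger0_norm// -mulrA ler_wpM2l.
rewrite !mulrDl.
apply: le_trans (ler_normD _ _) _; rewrite lerD//.
apply: le_trans (ler_normB _ _) _; rewrite lerD//.
apply: le_trans (ler_normB _ _) _; rewrite lerD//.
by apply: le_trans (ler_normB _ _) _; rewrite lerD.
Qed.

Lemma has_iint_ellR : exists v, has_iint (fun s x y => dens s x y * ellR s x y) v.
Proof.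
have [C hC] := ellR_le_envelope; have [v hv] := has_iint_envelope d0 eta0 mu.
apply: (has_iint_dom _ _ (has_iintZ C hv)).
  have m1 := mgy eta^-1.
  rewrite /flat_meas /ellR /best_equiv; have md := mdens; rewrite /flat_meas in md.
  by meas.
move=> s x y; have [s0|s0] := leP s 0; first by rewrite dens_le0// !mul0r mulr0 normr0.
by rewrite normrM (ger0_norm (dens_ge0 d0 eta0 mu s x y)) mulrCA ler_wpM2l ?dens_ge0// hC.
Qed.

Lemma has_iint_ln : exists2 v,
  has_iint (fun s x y => dens s x y * ln (quadT y x s / quadA x s)) v &
  (v%:E = \int[leb]_(p in D1) ((gg d m p ^+ 2 - gg d m p ^+ 3) / (p * (1 - p)))%:E)%E.
Proof.
have [v hv] := has_iint_envelope d0 eta0 mu.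
have mu0 := sqnorm_ge0 mu.
(* The envelope first shows that the expectation is a real number; Tonelli then identifies it with
   the integral over p. *)
have [w [iw hw]] : exists w, has_iint (fun s x y => dens s x y * ln (quadT y x s / quadA x s)) w.
  apply: (has_iint_dom _ _ (has_iintZ (12 + 6 * sqnorm mu) hv)).
    by have md := mdens; rewrite /flat_meas in md *; meas.
  move=> s x y; have [s0|s0] := leP s 0; first by rewrite dens_le0// !mul0r mulr0 normr0.
  rewrite normrM (ger0_norm (dens_ge0 d0 eta0 mu s x y)) mulrCA ler_wpM2l ?dens_ge0//.
  have [b1 bl bs bx bY] := envelope_ge x y s0.
  have T0 := quadT_gt0 y x s0; have A0 := quadA_gt0 x s0.
  have h1 : ln (quadA x s) <= ln (quadT y x s) by rewrite ler_ln ?posrE// quadAT.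
  have h2 : ln s <= ln (quadA x s) by rewrite ler_ln ?posrE// quadA_ge.
  have h3 := ln_le T0.
  have hx := sqnormB_le (x - mu) (- mu); have hy := sqnormB_le (y - mu) (- mu).
  rewrite !opprK !subrK in hx hy.
  have nmu : sqnorm (- mu) = sqnorm mu by apply: eq_bigr => i _; rewrite mxE sqrrN.
  rewrite nmu in hx hy.
  have h4 : quadT y x s <= (7 + 6 * sqnorm mu) * envelope s x y.
    have : sqnorm mu <= sqnorm mu * envelope s x y by rewrite ler_peMr.
    by rewrite /quadT; lra.
  rewrite ln_div ?posrE//; move: bl; rewrite !ler_norml => /andP[l1 l2].
  rewrite mulrDl in h4; rewrite mulrDl.
  have : 0 <= 6 * sqnorm mu * envelope s x y by rewrite !mulr_ge0//; lra.
  by move=> ?; apply/andP; split; lra.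
exists w; first by split.
rewrite -hw.
pose K p (l : seq R) : \bar R := flat (fun s x y => dens s x y *
  ((expR (- (eta * tilt p * quadA x s)) - expR (- (eta * tilt p * quadT y x s))) / (p * (1 - p)))) l.
have Ek p s x y : 0 < p < 1 -> 0 < s ->
    0 <= (expR (- (eta * tilt p * quadA x s)) - expR (- (eta * tilt p * quadT y x s))) / (p * (1 - p)).
  move=> /andP[p0 p1] s0; have q0 : 0 < 1 - p by rewrite subr_gt0.
  rewrite divr_ge0 ?mulr_ge0 ?(ltW p0) ?(ltW q0)// subr_ge0 ler_expR lerN2.
  by rewrite ler_wpM2l ?quadAT// mulr_ge0 ?(ltW eta0)// tilt_ge0// p0 ltW.
transitivity (iint_seq N (fun l => \int[leb]_(p in D1) K p l)%E).
  apply: eq_iint => l _; rewrite /K /flat.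
  move: (xpart d l) (ypart d l) (nth 0 l 0) => x y s.
  have [s0|s0] := leP s 0.
    rewrite dens_le0// mul0r; under eq_integral do rewrite mul0r.
    by rewrite integral0.
  rewrite integralZ_ge0 ?dens_ge0//.
  - by rewrite laplace_ln ?quadA_gt0 ?quadAT.
  - by rewrite /tilt; meas.
  - by move=> p /D1E p01; exact: Ek.
rewrite -(@iint_swap _ _ _ (measurableTypeR R) leb D1 K)//; first last.
- move=> p l /D1E p01 _; rewrite /K /flat lee_fin.
  move: (xpart d l) (ypart d l) (nth 0 l 0) => x y s.
  have [s0|s0] := leP s 0; first by rewrite dens_le0// mul0r.
  by rewrite mulr_ge0 ?dens_ge0// Ek.
- apply/measurable_EFinP; have md := mdens; rewrite /flat_meas in md.
  by rewrite /tilt; meas.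
apply: eq_integral => p; rewrite inE => /D1E p01; have /andP[p0 p1] := p01.
have p1' : 0 < p <= 1 by rewrite p0 ltW.
have H1 := has_iint_expA d0 eta0 mu p1'.
have H2 := has_iint_expT d0 eta0 mu p1'.
have [_ H] := has_iintZ (p * (1 - p))^-1 (has_iintD H1 (has_iintZ (-1) H2)).
transitivity ((p * (1 - p))^-1 * (gg d m p ^+ 2 + -1 * gg d m p ^+ 3))%:E; last first.
  by congr EFin; ring.
by rewrite -H; apply: eq_iint => l _; rewrite /K /flat; congr EFin; ring.
Qed.

(** Tonelli with [laplace_frac]: the bound 2 d p g^3 / eta of [has_iint_quadS], multiplied by eta /
    (2 p^2), is d g^3 / p. *)
Lemma has_iint_w : exists2 v,
  has_iint (fun s x y => dens s x y * (quadS y x s / quadT y x s)) v &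
  (d%:R%:E * \int[leb]_(p in D1) (gg d m p ^+ 3 / p)%:E <= v%:E)%E.
Proof.
have [w [iw hw]] : exists w, has_iint (fun s x y => dens s x y * (quadS y x s / quadT y x s)) w.
  apply: (has_iint_dom _ _ (has_iint_dens d0 eta0 mu)).
    by have md := mdens; rewrite /flat_meas in md *; meas.
  move=> s x y; have [s0|s0] := leP s 0; first by rewrite dens_le0// !mul0r normr0.
  rewrite normrM (ger0_norm (dens_ge0 d0 eta0 mu s x y)) ler_piMr ?dens_ge0//.
  have T0 := quadT_gt0 y x s0; have S0 := quadS_gt0 y x s0.
  by rewrite ger0_norm ?divr_ge0 ?(ltW S0) ?(ltW T0)// ler_pdivrMr// mul1r quadST.
exists w; first by split.
rewrite -hw.
pose K p (l : seq R) : \bar R := flat (fun s x y => dens s x y *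
  (eta * quadS y x s / (2 * p ^+ 2) * expR (- (eta * tilt p * quadT y x s)))) l.
have Ek p s x y : 0 < s ->
    0 <= eta * quadS y x s / (2 * p ^+ 2) * expR (- (eta * tilt p * quadT y x s)).
  move=> s0; apply: mulr_ge0; last exact: expR_ge0.
  by apply: divr_ge0; apply: mulr_ge0; rewrite ?sqr_ge0 ?(ltW eta0)// ltW// quadS_gt0.
rewrite (_ : iint_seq _ _ = iint_seq N (fun l => \int[leb]_(p in D1) K p l)%E); last first.
  apply: eq_iint => l _; rewrite /K /flat.
  move: (xpart d l) (ypart d l) (nth 0 l 0) => x y s.
  have [s0|s0] := leP s 0.
    rewrite dens_le0// mul0r; under eq_integral do rewrite mul0r.
    by rewrite integral0.
  rewrite integralZ_ge0 ?dens_ge0//.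
  - by rewrite laplace_frac ?(ltW (quadS_gt0 _ _ _)) ?quadT_gt0.
  - by rewrite /tilt; meas.
  - by move=> p _; exact: Ek.
rewrite -(@iint_swap _ _ _ (measurableTypeR R) leb D1 K)//; first last.
- move=> p l _ _; rewrite /K /flat lee_fin.
  move: (xpart d l) (ypart d l) (nth 0 l 0) => x y s.
  have [s0|s0] := leP s 0; first by rewrite dens_le0// mul0r.
  by rewrite mulr_ge0 ?dens_ge0// Ek.
- apply/measurable_EFinP; have md := mdens; rewrite /flat_meas in md.
  by rewrite /tilt; meas.
have mg := mgg d m.
rewrite -integralZ_ge0; [|exact: mD1|by meas| |by []]; last first.
  by move=> p /D1E/andP[p0 _]; rewrite divr_ge0 ?(ltW p0)// exprn_ge0// ltW// gg_gt0.
apply: le_integral_any => p /D1E p01; have /andP[p0 p1] := p01.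
have p1' : 0 < p <= 1 by rewrite p0 ltW.
have [u Hu le] := has_iint_quadS d0 eta0 mu p1'.
have [_ H] := has_iintZ (eta / (2 * p ^+ 2)) Hu.
apply: (@le_trans _ _ (eta / (2 * p ^+ 2) * u)%:E).
  rewrite lee_fin.
  have q0 : 0 < eta / (2 * p ^+ 2) by rewrite divr_gt0// mulr_gt0// exprn_gt0.
  apply: le_trans (ler_wpM2l (ltW q0) le).
  by apply: ler_of_eq; rewrite -/m; field; rewrite !gt_eqF.
by rewrite -H; apply: le_iint => l _; rewrite /K /flat lee_fin; apply: ler_of_eq; ring.
Qed.

(** Positivity makes the risk inequality strict at every (mu, eta). *)
Lemma integral_gg3_gt0 : (0 < \int[leb]_(p in D1) (gg d m p ^+ 3 / p)%:E)%E.
Proof.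
have mg := mgg d m.
have m0 : 0 <= m by rewrite mulr_ge0 ?sqnorm_ge0// ltW.
pose c := (4^-1 `^ (d%:R / 2) * expR (- (m / 2))) ^+ 3.
have c0 : 0 < c by rewrite exprn_gt0// mulr_gt0 ?expR_gt0// powR_gt0// invr_gt0.
have ab : 4^-1 < 2^-1 :> R by lra.
apply: (integral_gt0 (a := 4^-1) (b := 2^-1) (c := c)) => //.
- by meas.
- by move=> p /D1E/andP[p0 _]; rewrite divr_ge0 ?(ltW p0)// exprn_ge0// ltW// gg_gt0.
move=> p /andP[pa pb]; have p0 : 0 < p by lra.
split; first by apply/D1E; apply/andP; split; lra.
rewrite ler_pdivlMr//.
have dd : 0 <= d%:R / 2 :> R by rewrite divr_ge0.
apply: (@le_trans _ _ c); first by rewrite ler_piMr ?(ltW c0)//; lra.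
rewrite /c /gg lerXn2r ?nnegrE ?mulr_ge0 ?powR_ge0 ?expR_ge0//.
apply: ler_pM; rewrite ?powR_ge0 ?expR_ge0//.
  by rewrite ge0_ler_powR// nnegrE// ltW.
by rewrite ler_expR lerN2 ler_pM2r ?invr_gt0// ler_piMr//; lra.
Qed.

Lemma log_ratio_pos (q : @pred_density R d) s x y : 0 < q y x s ->
  log_ratio mu eta q y x s = (ln (gauss_pdf y mu eta^-1 / q y x s))%:E.
Proof. by move=> q0; rewrite /log_ratio q0. Qed.

Lemma KL_riskE (q : @pred_density R d) : KL_risk 2 mu eta q =
  iint_seq N (fun l => ((dens (nth 0%R l 0%N) (xpart d l) (ypart d l))%:E *
    log_ratio mu eta q (ypart d l) (xpart d l) (nth 0%R l 0%N))%E).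
Proof.
rewrite -(@flatten_iint R d (fun s x y => ((dens s x y)%:E * log_ratio mu eta q y x s)%E))//.
by move=> s x y s0; rewrite dens_le0// mul0e.
Qed.

(** All constants meet here: 5/4 < 63/50 for d = 1, and 27/32 < 99/100 < (99/100) d / (d - 1) for d
    >= 2. *)
Lemma kappa_lt_log_gain : kappa d < d%:R * log_gain d :> R.
Proof.
rewrite /kappa /log_gain; case: eqP => [->|d1]; first by lra.
have d2 : 2 <= d%:R :> R by rewrite ler_nat; case: (d) d0 d1 => [|[|]].
have e0 : 0 < d%:R - 1 :> R by lra.
by rewrite mulrA ltr_pdivlMr//; lra.
Qed.

Lemma KL_risk_lt nu : 0 < nu <= 1 / 1000 ->
  (KL_risk 2 mu eta (@bayes_pred R 2 d (@prior_GM R 2 d nu)) <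
   KL_risk 2 mu eta (@best_equiv R 2 d))%E.
Proof.
move=> nuk; have /andP[nu0 _] := nuk.
have [vR hR] := has_iint_ellR.
have [vL hL eL] := has_iint_ln.
have [vw hw ew] := has_iint_w.
have m0 : 0 <= m by rewrite mulr_ge0 ?sqnorm_ge0// ltW.
have := integral_log_le d0 m0; rewrite -eL => hLam.
have Ip := integral_gg3_gt0.
have dn : 0 < d%:R :> R by rewrite ltr0n.
(* The integral is finite because d times it is at most the real number [vw]. *)
have [I0 [I00 IE]] : exists I : R, 0 < I /\ (\int[leb]_(p in D1) (gg d m p ^+ 3 / p)%:E = I%:E)%E.
  move: Ip ew; case: (\int[leb]_(p in D1) _)%E => [r| |]//.
    by rewrite lte_fin => r0 _; exists r.
  by rewrite gt0_muley ?lte_fin.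
move: hLam ew; rewrite IE -!EFinM -EFinD !lee_fin => hLam ew.
have HR : KL_risk 2 mu eta (@best_equiv R 2 d) = vR%:E.
  rewrite KL_riskE -hR.2; apply: eq_iint => l _; rewrite /flat.
  move: (xpart d l) (ypart d l) (nth 0 l 0) => x y s.
  have [s0|s0] := leP s 0; first by rewrite dens_le0// mul0e mul0r.
  by rewrite log_ratio_pos ?best_equiv_gt0.
have H1 := has_iint_dens d0 eta0 mu.
have H := has_iintD hR (has_iintZ nu (has_iintD hL (has_iintD (has_iintZ (- ln (3 / 2)) H1)
  (has_iintZ (- log_gain d) hw)))).
(* The Bayes risk is only bounded above by the integral of an explicit integrable function. As
   [le_iint] needs no measurability, neither measurability nor finiteness is established for the
   integrand of the Bayes risk. *)
rewrite HR; apply: (@le_lt_trans _ _ (vR + nu * (vL + (- ln (3 / 2) * 1 + - log_gain d * vw)))%:E).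
  rewrite -H.2 KL_riskE; apply: le_iint => l _; rewrite /flat.
  move: (xpart d l) (ypart d l) (nth 0 l 0) => x y s.
  have [s0|s0] := leP s 0.
    by rewrite dens_le0// mul0e !mul0r !mulr0 !addr0 mulr0.
  have b0 := bayes_pred_gt0 d0 y x nuk s0.
  rewrite log_ratio_pos// -EFinM lee_fin.
  rewrite [leRHS](_ : _ = dens s x y * (ellR s x y + nu * (ln (quadT y x s / quadA x s) - ln (3 / 2)
    - log_gain d * (quadS y x s / quadT y x s)))); last by ring.
  rewrite ler_wpM2l ?dens_ge0//.
  have := log_bayes_pred_ge d0 y x nuk s0.
  have g0 : 0 < gauss_pdf y mu eta^-1 by rewrite gauss_pdf_gt0// invr_gt0.
  rewrite /ellR [ln (_ / best_equiv _ _ _ _)]ln_div ?posrE ?best_equiv_gt0//.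
  rewrite [ln (_ / bayes_pred _ _ _ _ _)]ln_div ?posrE// => h.
  rewrite -addrA lerD2l lerNl opprD opprK -mulrN; apply: le_trans h; rewrite lerD2l ler_pM2l//.
  by apply: ler_of_eq; ring.
rewrite lte_fin -ltrBrDl subrr pmulr_rlt0//.
have g0 : 0 < log_gain d :> R.
  have := kappa_lt_log_gain; rewrite -(pmulr_rgt0 _ dn); apply: lt_trans.
  by rewrite /kappa; case: ifP => _; lra.
have h1 : log_gain d * (d%:R * I0) <= log_gain d * vw by rewrite ler_pM2l.
have h2 : kappa d * I0 < d%:R * log_gain d * I0 by rewrite ltr_pM2r ?kappa_lt_log_gain.
lra.
Qed.

End RiskTerms.

(** * Normalization of the Bayes predictive density *)

Section Normalization.
Context {R : realType}.
Notation leb := (@lebesgue_measure R).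
Notation Dy := (`]0%R, +oo[%classic : set R).
Variables (d : nat) (d0 : (0 < d)%N) (nu : R) (nu0 : 0 < nu) (x : 'rV[R]_d) (s : R) (s0 : 0 < s).
Implicit Types (r t c : R) (y : 'rV[R]_d).

Let dd : 0 < d%:R / 2 :> R. Proof. by rewrite divr_gt0// ltr0n. Qed.
Let e : R := nu + d%:R.
Let e0 : 0 < e. Proof. by rewrite addr_gt0// ltr0n. Qed.
Let A := quadA x s.
Let A0 : 0 < A. Proof. exact: quadA_gt0. Qed.
Let rp r : R := r `^ (nu - 1) * (1 + r / 2) `^ (- nu) * (3 + r) `^ (d%:R / 2 + nu).
Let Q r y : R := 3 * quadS y x s + r * quadT y x s.
Let Qm r : R := (3 + r) * (2 * s + A * r) / (2 + r).
Let H c r t y : R := c * rp r * (t `^ (e - 1) * expR (- (Q r y * t))).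

Let rp_ge0 r : 0 <= rp r. Proof. by rewrite !mulr_ge0 ?powR_ge0. Qed.

Let H_ge0 c r t y : 0 <= c -> 0 <= H c r t y.
Proof.
by move=> c0; apply: mulr_ge0; [apply: mulr_ge0 => //|rewrite mulr_ge0 ?powR_ge0 ?expR_ge0].
Qed.

Let integral_H c r y : 0 <= c -> 0 < r ->
  (\int[leb]_(t in Dy) (H c r t y)%:E =
   (c * Gamma e * mixker d nu (3 * quadS y x s) (quadT y x s) r)%:E)%E.
Proof.
move=> c0 r0; have Q0 : 0 < Q r y.
  by rewrite addr_gt0// mulr_gt0 ?quadS_gt0 ?quadT_gt0.
rewrite integralZ_ge0; [|exact: mDy|by meas|by move=> t _; rewrite mulr_ge0 ?powR_ge0 ?expR_ge0|exact: mulr_ge0].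
rewrite integral_Gamma_scale// -EFinM; congr EFin.
by rewrite /mixker /rp -/(Q r y) [d%:R + nu]addrC -/e; move: (Gamma e) => G; ring.
Qed.

Let vec_int_H c r t : 0 < r -> 0 < t -> vec_int (fun y => (H c r t y)%:E) =
  (c * rp r * (pi / (2 + r)) `^ (d%:R / 2) * (t `^ (nu + d%:R / 2 - 1) * expR (- (Qm r * t))))%:E.
Proof.
move=> r0 t0; have r2 : 0 < 2 + r by rewrite addr_gt0.
have a0 : 0 < t * (2 + r) by rewrite mulr_gt0.
have := @vec_int_gauss R d (t * (2 + r)) (c * rp r * t `^ (e - 1) * expR (- ((3 + r) * s * t)))
  (fun i => 2 * t * x ord0 i) (fun i => (2 + 2 * r) * t * x ord0 i ^+ 2) a0.
rewrite (_ : vec_int _ = vec_int (fun y => (H c r t y)%:E)) => [->|]; last first.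
  congr vec_int; apply/funext => y; congr EFin; rewrite /H -[LHS]mulrA -[LHS]mulrA; congr (_ * (_ * _)).
  rewrite -expRD; congr expR; rewrite -opprD; congr (- _).
  rewrite /Q /quadS /quadT /sqnorm.
  rewrite [RHS](_ : _ = (3 + r) * s * t + (2 * t * \sum_(i < d) (y - x) ord0 i ^+ 2 +
    (r * t * \sum_(i < d) y ord0 i ^+ 2 + 2 * r * t * \sum_(i < d) x ord0 i ^+ 2))); last by field.
  rewrite -!mulrA; congr (_ + _); rewrite !mulr_sumr -!big_split/=; apply: eq_bigr => i _.
  by rewrite !mxE; ring.
congr EFin.
rewrite (_ : \sum_(i < d) _ = - ((3 + r) * (2 * r * sqnorm x) * t / (2 + r))); last first.
  rewrite /sqnorm !mulr_sumr !mulr_suml -sumrN; apply: eq_bigr => i _.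
  by field; rewrite !gt_eqF.
have p0 := @pi_gt0 R.
have pr : 0 < pi / (2 + r) by rewrite divr_gt0.
have -> : pi / (t * (2 + r)) = pi / (2 + r) / t.
  by move: (pi : R) => P; field; rewrite !gt_eqF.
move: (pi / (2 + r)) (rp r) pr => P z P0; rewrite -[LHS]mulrA -[LHS]mulrA -[RHS]mulrA; congr (_ * _).
rewrite !powE ?divr_gt0// ln_div ?posrE// -!expRD; congr expR.
by rewrite /Qm /A /quadA /e; field; rewrite gt_eqF.
Qed.

Let integral_vec_int_H c r : 0 <= c -> 0 < r ->
  (\int[leb]_(t in Dy) vec_int (fun y => (H c r t y)%:E) =
   (c * pi `^ (d%:R / 2) * Gamma (nu + d%:R / 2) * 2 `^ nu *
     (r `^ (nu - 1) * (2 * s + A * r) `^ (- (nu + d%:R / 2))))%:E)%E.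
Proof.
move=> c0 r0; have r2 : 0 < 2 + r by rewrite addr_gt0.
have r3 : 0 < 3 + r by rewrite addr_gt0.
have r1 : 0 < 1 + r / 2 by rewrite addr_gt0// divr_gt0.
have p0 := @pi_gt0 R.
have sA : 0 < 2 * s + A * r by rewrite addr_gt0// mulr_gt0.
have Q0 : 0 < Qm r by rewrite divr_gt0// mulr_gt0.
transitivity (\int[leb]_(t in Dy) ((c * rp r * (pi / (2 + r)) `^ (d%:R / 2)) *
    (t `^ (nu + d%:R / 2 - 1) * expR (- (Qm r * t))))%:E)%E.
  by apply: eq_integral => t; rewrite inE => /DyE t0; rewrite vec_int_H.
rewrite integralZ_ge0; [|exact: mDy|by meas|by move=> t _; rewrite mulr_ge0 ?powR_ge0 ?expR_ge0|
  by rewrite mulr_ge0 ?powR_ge0// mulr_ge0].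
rewrite integral_Gamma_scale ?addr_gt0// -EFinM; congr EFin.
move: (Gamma _) => G.
rewrite [LHS](_ : _ = c * G * (rp r * (pi / (2 + r)) `^ (d%:R / 2) * Qm r `^ (- (nu + d%:R / 2)))); last by ring.
rewrite [RHS](_ : _ = c * G * (pi `^ (d%:R / 2) * 2 `^ nu *
     (r `^ (nu - 1) * (2 * s + A * r) `^ (- (nu + d%:R / 2))))); last by ring.
congr (_ * _); rewrite /rp /Qm.
(* [Qm] is the minimum of [Q] over y. Its factor 3 + r cancels the power of 3 + r in [rp], and the
   powers of 2 + r collapse to 2^nu, which leaves the beta integrand of the denominator. *)
rewrite (_ : 1 + r / 2 = (2 + r) / 2); last by field.
rewrite !powE ?divr_gt0 ?mulr_gt0// !ln_div ?posrE ?mulr_gt0// lnM ?posrE//.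
by rewrite -!expRD; congr expR; field.
Qed.

(** A gamma integral in t replaces the power of the quadratic form [Q] by a Gaussian in y.
    Exchanging the integrals, the one over y is explicit and reproduces the denominator. *)
Lemma vec_int_bayes_pred : vec_int (fun y => (bayes_pred 2 (@prior_GM R 2 d nu) y x s)%:E) = 1%E.
Proof.
have [D D0 DE] := bayes_den_gt0 d0 x nu0 s0.
pose kn : R := (2 * pi) `^ (- (d%:R / 2)) * marg_const d s * (Gamma e * 2 `^ e).
pose c : R := kn / D / Gamma e.
have p0 := @pi_gt0 R; have G0 := Gamma_gt0 e0.
have S0 := marg_const_gt0 d0 s0.
have kn0 : 0 <= kn by apply: mulr_ge0; apply: mulr_ge0; rewrite ?powR_ge0// ltW.
have c0 : 0 <= c by apply: divr_ge0; [apply: divr_ge0 => //|]; exact: ltW.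
pose F r (l : seq R) : \bar R := (\int[leb]_(t in Dy) (H c r t (\row_i nth 0%R l i))%:E)%E.
have mrow i : measurable_fun setT (fun q : (R * d.-tuple R) * R => (\row_(j < d) nth 0 q.1.2 j : 'rV[R]_d) ord0 i).
  rewrite (_ : (fun q => _) = (fun q : (R * d.-tuple R) * R => nth 0 q.1.2 i)).
    exact: (measurableT_comp (@meas_nth R _ _ d i) measurable_fst).
  by apply/funext => q; rewrite mxE.
have mr : measurable_fun setT (fun q : (R * d.-tuple R) * R => q.1.1).
  exact: (measurableT_comp measurable_fst measurable_fst).
have mH : measurable_fun setT (fun q : (R * d.-tuple R) * R => H c q.1.1 q.2 (\row_(j < d) nth 0 q.1.2 j)).
  have m1 : measurable_fun setT (fun q : (R * d.-tuple R) * R => sqnorm (\row_(j < d) nth 0 q.1.2 j : 'rV[R]_d)).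
    exact: meas_sqnorm.
  have m2 : measurable_fun setT (fun q : (R * d.-tuple R) * R => sqnorm (\row_(j < d) nth 0 q.1.2 j - x)).
    apply: meas_sqnorm => i; have mi := mrow i.
    rewrite (_ : (fun q => _) = (fun q : (R * d.-tuple R) * R => (\row_(j < d) nth 0 q.1.2 j : 'rV[R]_d) ord0 i - x ord0 i)).
      by meas.
    by apply/funext => q; rewrite !mxE.
  by rewrite /H /rp /Q /quadS /quadT; meas.
transitivity (iint_seq d (fun l => \int[leb]_(r in Dy) F r l)%E).
  apply: eq_iint => l _; set y := \row_i _.
  have [N N0 NE] := bayes_num_fin d0 y x nu0 s0.
  rewrite /bayes_pred NE DE/= -/e.
  transitivity (\int[leb]_(r in Dy) ((c * Gamma e) * mixker d nu (3 * quadS y x s) (quadT y x s) r)%:E)%E; last first.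
    by apply: eq_integral => r; rewrite inE => /DyE r0; rewrite /F integral_H.
  rewrite integralZ_ge0; [|exact: mDy|exact: meas_mixker|by move=> r _; exact: mixker_ge0|
    by rewrite mulr_ge0// ltW].
  move: NE; rewrite bayes_numE// -/e -/kn.
  have -> : c * Gamma e = D^-1 * kn by rewrite /c; field; rewrite !gt_eqF.
  by rewrite [(D^-1 * kn)%:E]EFinM -muleA => ->; rewrite -EFinM mulrC.
rewrite -(@iint_swap _ _ _ (measurableTypeR R) leb Dy F); first last.
- by move=> r l _ _; apply: integral_ge0 => t _; rewrite lee_fin H_ge0.
- apply: (@measurable_integral_on R _ _ (R * d.-tuple R)%type (measurableTypeR R) leb Dy
    (fun q t => (H c q.1 t (\row_i nth 0%R q.2 i))%:E)) => //.
  - exact/measurable_EFinP.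
  - by move=> q t _; rewrite lee_fin H_ge0.
- exact: mDy.
transitivity (\int[leb]_(r in Dy) ((c * pi `^ (d%:R / 2) * Gamma (nu + d%:R / 2) * 2 `^ nu) *
     (r `^ (nu - 1) * (2 * s + A * r) `^ (- (nu + d%:R / 2))))%:E)%E.
  apply: eq_integral => r; rewrite inE => /DyE r0.
  rewrite -integral_vec_int_H//.
  rewrite -(@iint_swap _ _ _ (measurableTypeR R) leb Dy (fun t l => (H c r t (\row_i nth 0%R l i))%:E))//.
  - apply/measurable_EFinP.
    have mc : measurable_fun setT (fun q : R * d.-tuple R => ((r, q.2), q.1)).
      apply/measurable_fun_pairP; split => /=; last exact: measurable_fst.
      by apply/measurable_fun_pairP; split => /=; [exact: measurable_cst|exact: measurable_snd].
    exact: (measurableT_comp mH mc).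
  - by move=> t l _ _; rewrite lee_fin H_ge0.
have G1 : 0 < Gamma (nu + d%:R / 2) by rewrite Gamma_gt0// addr_gt0.
have s2 : 0 < 2 * s by rewrite mulr_gt0.
rewrite integralZ_ge0; [|exact: mDy|by meas|by move=> r _; rewrite mulr_ge0 ?powR_ge0|
  by rewrite mulr_ge0 ?powR_ge0// mulr_ge0 ?(ltW G1)// mulr_ge0 ?powR_ge0].
rewrite beta_Gamma// -EFinM; congr EFin.
move: DE; rewrite bayes_denE// => -[DE].
rewrite /c /kn -DE.
have Gn := Gamma_gt0 nu0; have Gd := Gamma_gt0 dd.
have q1 : 0 < (2 * s) `^ (- (d%:R / 2)) by exact: powR_gt0.
have q2 : 0 < A `^ (- nu) by exact: powR_gt0.
rewrite -/A.
have key : (2 * pi) `^ (- (d%:R / 2)) * 2 `^ e * pi `^ (d%:R / 2) * 2 `^ nu = 2 `^ (d%:R / 2 + nu + nu) :> R.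
  rewrite !powE ?mulr_gt0// lnM ?posrE// -!expRD; congr expR; rewrite /e; by field.
have P0 : 0 < 2 `^ (d%:R / 2 + nu + nu) :> R by exact: powR_gt0.
move: ((2 * s) `^ (- (d%:R / 2))) (A `^ (- nu)) q1 q2 => a b a0 b0.
move: ((2 * pi) `^ (- (d%:R / 2))) (pi `^ (d%:R / 2)) (2 `^ e) (2 `^ nu) (2 `^ (d%:R / 2 + nu + nu)) key P0.
move=> z1 z2 z3 z4 z5 key P0; clear kn kn0 c c0 F mH DE.
move: (Gamma nu) (Gamma (d%:R / 2)) (Gamma e) (Gamma (nu + _)) (marg_const d s) Gn Gd G0 G1 S0.
move=> g1 g2 g3 g4 S g10 g20 g30 g40 S0.
transitivity (z1 * z3 * z2 * z4 / z5); first by field; rewrite !gt_eqF.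
by rewrite key divff// gt_eqF.
Qed.

Lemma bayes_pred_is_pred_density_at :
  (forall y, 0 <= bayes_pred 2 (@prior_GM R 2 d nu) y x s) /\
  vec_int (fun y => (bayes_pred 2 (@prior_GM R 2 d nu) y x s)%:E) = 1%E.
Proof.
split; last exact: vec_int_bayes_pred.
move=> y; have [D D0 DE] := bayes_den_gt0 d0 x nu0 s0.
have [N N0 NE] := bayes_num_fin d0 y x nu0 s0.
by rewrite /bayes_pred NE DE/= divr_ge0// ltW.
Qed.

End Normalization.

Theorem theorem2 (R : realType) (d : nat) :
  (1 <= d <= 4)%N ->
  @inadmissible R 2 d (@best_equiv R 2 d) /\
  exists nu_star : R, 0 < nu_star /\
    forall nu : R, 0 < nu -> nu <= nu_star ->
      @dominates R 2 d (@bayes_pred R 2 d (@prior_GM R 2 d nu)) (@best_equiv R 2 d).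
Proof.
move=> /andP[d0 _].
have dom (nu : R) : 0 < nu -> nu <= 1 / 1000 ->
    @dominates R 2 d (@bayes_pred R 2 d (@prior_GM R 2 d nu)) (@best_equiv R 2 d).
  move=> nu0 nu1; have nuk : 0 < nu <= 1 / 1000 by rewrite nu0.
  split; first by move=> mu eta eta0; apply/ltW/KL_risk_lt.
  (* The inequality is strict at every parameter, so mu = 0 and eta = 1 are an arbitrary witness. *)
  by exists 0, 1; split => //; exact: KL_risk_lt.
have nu0 : (0 : R) < 1 / 1000 by lra.
split; last by exists (1 / 1000).
exists (@bayes_pred R 2 d (@prior_GM R 2 d (1 / 1000))); split; last exact: dom.
by move=> x s s0; exact: bayes_pred_is_pred_density_at.
Qed.
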